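(* Let $n\in\mathbb{Z}^+$ with $n\geq 2$ and $0<R_1<R_2<\infty$. Let $f:\overline{A(R_1,R_2)}\to\mathbb{R}$ be real analytic on $\overline{A(R_1,R_2)}$ and satisfy $\int_{A(R_1,R_2)} f\,\mathrm{Vol}_{\mathbb{R}^n}=0$. Then there exists a vector field $\mathbf{U}:\overline{A(R_1,R_2)}\to\mathbb{R}^n$, real analytic on $\overline{A(R_1,R_2)}$, such that $\operatorname{div}_{\mathbb{R}^n}\mathbf{U}(x)=f(x)$ for all $x\in\overline{A(R_1,R_2)}$ and $\mathbf{U}|_{\partial A(R_1,R_2)}=0$.
   Context: $A(R_1,R_2)=\{x\in\mathbb{R}^n: R_1<|x|<R_2\}$ and $\overline{A(R_1,R_2)}=\{x\in\mathbb{R}^n: R_1\leq|x|\leq R_2\}$. A function (scalar- or $\mathbb{R}^n$-valued) on $\overline{A(R_1,R_2)}$ is called real analytic on $\overline{A(R_1,R_2)}$ if there exist $\delta\in(0,1)$ and a real analytic function $\widetilde f$ on the open annulus $A(R_1(1-\delta),R_2(1+\delta))$ whose restriction to $\overline{A(R_1,R_2)}$ equals the given function. $\mathrm{Vol}_{\mathbb{R}^n}$ is Lebesgue measure. *)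

(* Defs.v *)
From HB Require Import structures.
From mathcomp Require Import all_boot all_order all_algebra.
From mathcomp Require Import all_classical all_reals all_analysis.
Set Implicit Arguments. Unset Strict Implicit. Unset Printing Implicit Defensive.
Import Order.TTheory GRing.Theory Num.Theory.
Import numFieldNormedType.Exports.
Local Open Scope classical_set_scope.
Local Open Scope ring_scope.

(* Euclidean norm |x| on R^n (the library's norm on matrices is the max-norm). *)
Definition enorm {R : realType} {n : nat} (x : 'rV[R]_n) : R :=
  Num.sqrt (\sum_(i < n) x 0 i ^+ 2).

Definition open_annulus {R : realType} {n : nat} (R1 R2 : R) : set 'rV[R]_n :=
  [set x | R1 < enorm x < R2].

Definition closed_annulus {R : realType} {n : nat} (R1 R2 : R) : set 'rV[R]_n :=
  [set x | R1 <= enorm x <= R2].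

Definition monomial {R : realType} {n : nat} (alpha : 'I_n -> nat)
    (a x : 'rV[R]_n) : R :=
  \prod_(i < n) (x 0 i - a 0 i) ^+ alpha i.

Definition sum_deg {R : realType} {n : nat} (k : nat) (g : ('I_n -> nat) -> R) : R :=
  \sum_(alpha : {ffun 'I_n -> 'I_k.+1} | (\sum_(i < n) (alpha i : nat))%N == k)
     g (fun i => nat_of_ord (alpha i)).

(* f is real analytic on the set D: around every point a of D, f is given by an
   absolutely convergent multivariate power series sum_alpha c_alpha (x-a)^alpha
   on a ball of positive radius contained in D (the series is summed by
   increasing total degree, which is harmless thanks to absolute convergence). *)
Definition real_analytic_on {R : realType} {n : nat} (D : set 'rV[R]_n)
    (f : 'rV[R]_n -> R) : Prop :=
  forall a, D a ->
    exists r : R, 0 < r /\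
    exists c : ('I_n -> nat) -> R,
      forall x : 'rV[R]_n, enorm (x - a) < r ->
        D x /\
        cvg ((fun N => \sum_(k < N) sum_deg k (fun alpha => `|c alpha * monomial alpha a x|))
               @ \oo) /\
        ((fun N => \sum_(k < N) sum_deg k (fun alpha => c alpha * monomial alpha a x))
               @ \oo --> f x).

Definition real_analytic_on_closed_annulus {R : realType} {n : nat} (R1 R2 : R)
    (f : 'rV[R]_n -> R) : Prop :=
  exists delta : R, 0 < delta < 1 /\
  exists ft : 'rV[R]_n -> R,
    real_analytic_on (open_annulus (R1 * (1 - delta)) (R2 * (1 + delta))) ft /\
    (forall x, closed_annulus R1 R2 x -> ft x = f x).

Definition divergence {R : realType} {n : nat} (U : 'rV[R]_n -> 'rV[R]_n)
    (x : 'rV[R]_n) : R :=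
  \sum_(i < n) derive (fun y : 'rV[R]_n => U y 0 i) x (delta_mx 0 i).

(* Integral over R^n with respect to Lebesgue measure, written as the iterated
   integral over the coordinates (Fubini); used only for bounded measurable
   functions with compact support.  x = (t, y) with t the first coordinate. *)
Fixpoint integral_Rn {R : realType} (n : nat) : ('rV[R]_n -> R) -> R :=
  match n return ('rV[R]_n -> R) -> R with
  | 0 => fun g => g 0
  | m.+1 => fun g =>
      Rintegral (@lebesgue_measure R) setT
        (fun t : R => integral_Rn (fun y : 'rV[R]_m =>
                        g (row_mx (\row_(j < 1) t) y)))
  end.

(* Main.v *)
Require Import Defs.
From HB Require Import structures.
From mathcomp Require Import all_boot all_order all_algebra.
From mathcomp Require Import all_classical all_reals all_analysis.
From mathcomp Require Import ring lra finmap.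
Set Implicit Arguments. Unset Strict Implicit. Unset Printing Implicit Defensive.
Import Order.TTheory GRing.Theory Num.Theory.
Import numFieldNormedType.Exports.
Local Open Scope classical_set_scope.
Local Open Scope ring_scope.

(** Let [F x] be the integral of [s^(n-1) f(s x/|x|)] for [R1 <= s <= R2], a function that is
    homogeneous of degree 0. Averaging [F] over the rotations in a coordinate plane, with a power
    of the sine of the angle as weight, changes [F] by the divergence of a tangential analytic
    field, because the difference is a derivative along the generator of these rotations. The
    weights are those of the Euler angles, so the successive averages in the planes of adjacent
    axes compose to a rotation invariant function, that is, to a constant [c]. Thus
    [F - c = div W] with [W] analytic and tangential.

    Let [phi] be the multiple of [(|x|^2 - R1^2) (R2^2 - |x|^2)] such that [s^(n-1) phi(s)] has
    integral 1, and let [h = f - phi F]; the integral of [s^(n-1) h] along each ray from radius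
    [R1] to radius [R2] is zero. Hence the field [phi W + |x|^-n H x], where [H x] is the integral
    of [s^(n-1) h(s x/|x|)] for [R1 <= s <= |x|], vanishes on both spheres. Its divergence is
    [phi (F - c) + h = f - c phi].

    Finally [c = 0]. The extension by zero of the field is Lipschitz, so the sum of its coordinate
    difference quotients has integral zero by translation invariance, while it differs from
    [f - c phi] by [O(h)] outside shells of width [O(h)] around the two spheres. As [f] has
    integral zero and [phi] has positive integral, [c = 0]. *)

(** * Absolutely convergent sums over arbitrary index types *)

Section Sums.
Context {R : realType}.

(** The field must vanish on the spheres entirely, not only in its normal component, and must stay
    analytic beyond them. Integrating [f] along rays gives a radial field that vanishes on the inner
    sphere, but on the outer one only if the mean along every ray is zero; hence the tangential
    correction, which moves mass between rays. On the sphere this would be a Poisson equation.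
    Averaging replaces it by explicit parameter integrals, so that analyticity reduces to one
    statement about such integrals. The factor [phi] passes through the divergence of [W], because
    its gradient is radial and [W] is tangential.

    Polar coordinates or the divergence theorem would be the usual way to [c = 0]. Here the integral
    is iterated over the coordinates, and the extension of [f] by zero jumps on the spheres. It is
    therefore squeezed between Lipschitz functions with compact support, for which iterated
    integrals are elementary. Slicing bounds the volume of a shell only by the square root of its
    width, which is enough. *)

Definition bnd {I : choiceType} (u : I -> R) (N : R) : Prop :=
  (\esum_(i in [set: I]) (`|u i|)%:E <= N%:E)%E.

Definition ns {I : choiceType} (u : I -> R) : R :=
  fine (\esum_(i in [set: I]) (`|u i|)%:E)%E.

(** Going through positive and negative parts leaves only sums of nonnegative extended reals, which
    can be rearranged freely. The value is meaningful when some [bnd u N] holds; otherwise [fine]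
    may have sent an infinite sum to 0. *)
Definition tot {I : choiceType} (u : I -> R) : R :=
  ns (fun i => Num.max (u i) 0) - ns (fun i => Num.max (- u i) 0).

Lemma esum_abs_ge0 {I : choiceType} (u : I -> R) :
  (0 <= \esum_(i in [set: I]) (`|u i|)%:E)%E.
Proof. by apply: esum_ge0 => i _; rewrite lee_fin. Qed.

Lemma bnd_nsE {I : choiceType} (u : I -> R) N : bnd u N ->
  (\esum_(i in [set: I]) (`|u i|)%:E = (ns u)%:E)%E.
Proof.
move=> h; rewrite /ns fineK// ge0_fin_numE ?esum_abs_ge0//.
exact: le_lt_trans h (ltry _).
Qed.

Lemma bnd_ns_le {I : choiceType} (u : I -> R) N : bnd u N -> ns u <= N.
Proof. by move=> h; rewrite -lee_fin -(bnd_nsE h). Qed.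

Lemma bnd_ns {I : choiceType} (u : I -> R) N : bnd u N -> bnd u (ns u).
Proof. by move=> h; rewrite /bnd (bnd_nsE h). Qed.

Lemma ns_ge0 {I : choiceType} (u : I -> R) : 0 <= ns u.
Proof. by rewrite fine_ge0// esum_abs_ge0. Qed.

Lemma bnd_ge0 {I : choiceType} (u : I -> R) N : bnd u N -> 0 <= N.
Proof. by move=> /bnd_ns_le; apply: le_trans; apply: ns_ge0. Qed.

Lemma bnd_le {I : choiceType} (u v : I -> R) N :
  (forall i, `|u i| <= `|v i|) -> bnd v N -> bnd u N.
Proof.
by move=> h; apply: le_trans; apply: le_esum => i _; rewrite lee_fin.
Qed.

Lemma bndW {I : choiceType} (u : I -> R) N M : N <= M -> bnd u N -> bnd u M.
Proof. by move=> h b; apply: le_trans b _; rewrite lee_fin. Qed.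

Lemma ns_le {I : choiceType} (u v : I -> R) N :
  (forall i, `|u i| <= `|v i|) -> bnd v N -> ns u <= ns v.
Proof. by move=> h b; apply: bnd_ns_le; apply: (bnd_le h); apply: bnd_ns b. Qed.

Lemma eq_ns {I : choiceType} (u v : I -> R) :
  (forall i, `|u i| = `|v i|) -> ns u = ns v.
Proof. by move=> h; rewrite /ns; congr fine; apply: eq_esum => i _; rewrite h. Qed.

Lemma esum_absD {I : choiceType} (u v : I -> R) :
  (\esum_(i in [set: I]) (`|u i| + `|v i|)%:E =
   \esum_(i in [set: I]) (`|u i|)%:E + \esum_(i in [set: I]) (`|v i|)%:E)%E.
Proof.
by rewrite -esumD => [|i _|i _]; rewrite ?lee_fin//; apply: eq_esum => i _; rewrite EFinD.
Qed.

Lemma bndD {I : choiceType} (u v : I -> R) N M :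
  bnd u N -> bnd v M -> bnd (fun i => u i + v i) (N + M).
Proof.
move=> hu hv; rewrite /bnd.
apply: (@le_trans _ _ (\esum_(i in [set: I]) (`|u i| + `|v i|)%:E)%E).
  by apply: le_esum => i _; rewrite lee_fin ler_normD.
by rewrite esum_absD EFinD leeD.
Qed.

Lemma nsD {I : choiceType} (u v : I -> R) N M :
  (forall i, 0 <= u i) -> (forall i, 0 <= v i) ->
  bnd u N -> bnd v M -> ns (fun i => u i + v i) = ns u + ns v.
Proof.
move=> u0 v0 hu hv.
have := esum_absD u v; rewrite (bnd_nsE hu) (bnd_nsE hv) -EFinD => e.
rewrite -[RHS]/(fine (ns u + ns v)%:E) -e; congr fine.
by apply: eq_esum => i _; rewrite !ger0_norm// ?addr_ge0.
Qed.

Lemma bndZ {I : choiceType} (u : I -> R) k N :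
  bnd u N -> bnd (fun i => k * u i) (`|k| * N).
Proof.
move=> hu; apply: ge_ereal_sup => _ [A [fA _]] <-.
under eq_fsbigr do rewrite normrM EFinM.
rewrite -ge0_mule_fsumr; last by move=> i; rewrite lee_fin.
rewrite EFinM lee_wpmul2l ?lee_fin//.
by apply: le_trans hu; apply: ereal_sup_ubound; exists A.
Qed.

(** [bndZ] for the factor [k] gives one inequality, and for the factor [k^-1] the other. *)
Lemma nsZ {I : choiceType} (u : I -> R) k N :
  bnd u N -> ns (fun i => k * u i) = `|k| * ns u.
Proof.
move=> /bnd_ns hu; apply/eqP; rewrite eq_le (bnd_ns_le (bndZ k hu))/=.
have [->|k0] := eqVneq k 0; first by rewrite normr0 mul0r ns_ge0.
have := bnd_ns_le (bndZ k^-1 (bnd_ns (bndZ k hu))).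
rewrite (@eq_ns _ (fun i => k^-1 * _) u); last by move=> i; rewrite mulKf.
by rewrite normfV mulrC ler_pdivlMr ?normr_gt0// mulrC.
Qed.

Lemma bnd_pos {I : choiceType} (u : I -> R) N :
  bnd u N -> bnd (fun i => Num.max (u i) 0) N.
Proof.
apply: bnd_le => i; have [h|h] := leP (u i) 0; first by rewrite normr0.
by [].
Qed.

Lemma bndN {I : choiceType} (u : I -> R) N : bnd u N -> bnd (fun i => - u i) N.
Proof. by apply: bnd_le => i; rewrite normrN. Qed.

(** From [u = v - w] follows [u^+ + w = u^- + v], and additivity on nonnegative families concludes.
    Any convenient decomposition thus computes [tot], which yields linearity and Fubini below. *)
Lemma tot_diff {I : choiceType} (u v w : I -> R) N M :
  (forall i, 0 <= v i) -> (forall i, 0 <= w i) -> bnd v N -> bnd w M ->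
  (forall i, u i = v i - w i) -> tot u = ns v - ns w.
Proof.
move=> v0 w0 hv hw uE.
have hu : bnd u (N + M).
  by apply: bnd_le (bndD hv (bndN hw)) => i; rewrite uE.
have hp := bnd_pos hu; have hn := bnd_pos (bndN hu).
rewrite /tot.
suff : ns (fun i => Num.max (u i) 0) + ns w = ns (fun i => Num.max (- u i) 0) + ns v.
  by lra.
have m0 (x : R) : 0 <= Num.max x 0 by rewrite le_max lexx orbT.
rewrite -(nsD _ _ hp hw)// -(nsD _ _ hn hv)//; apply: eq_ns => i; congr (`| _ |).
rewrite uE; case: (leP (v i - w i) 0); case: (leP (- (v i - w i)) 0) => ? ?; lra.
Qed.

Lemma eq_tot {I : choiceType} (u v : I -> R) : u =1 v -> tot u = tot v.
Proof. by move=> /funext ->. Qed.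

Lemma tot_ge0E {I : choiceType} (u : I -> R) N : bnd u N ->
  (forall i, 0 <= u i) -> tot u = ns u.
Proof.
move=> h u0; rewrite (@tot_diff _ u u (fun=> 0) N 0)//; last 2 first.
- by rewrite /bnd esum1// => i _; rewrite normr0.
- by move=> i; rewrite subr0.
by rewrite /ns [X in _ - fine X]esum1 ?subr0// => i _; rewrite normr0.
Qed.

Lemma posneg (x : R) : x = Num.max x 0 - Num.max (- x) 0.
Proof. by case: (leP x 0); case: (leP (- x) 0) => ? ?; lra. Qed.

Lemma pos_ge0 (x : R) : 0 <= Num.max x 0.
Proof. by rewrite le_max lexx orbT. Qed.
Local Hint Resolve pos_ge0 : core.

Lemma totD {I : choiceType} (u v : I -> R) N M : bnd u N -> bnd v M ->
  tot (fun i => u i + v i) = tot u + tot v.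
Proof.
move=> hu hv.
have hup := bnd_pos hu; have hun := bnd_pos (bndN hu).
have hvp := bnd_pos hv; have hvn := bnd_pos (bndN hv).
rewrite (tot_diff _ _ (bndD hup hvp) (bndD hun hvn)); last 3 first.
- by move=> i; rewrite addr_ge0.
- by move=> i; rewrite addr_ge0.
- by move=> i; rewrite {1}(posneg (u i)) {1}(posneg (v i)); lra.
by rewrite (nsD _ _ hup hvp)// (nsD _ _ hun hvn)// /tot; lra.
Qed.

Lemma totN {I : choiceType} (u : I -> R) : tot (fun i => - u i) = - tot u.
Proof.
rewrite /tot opprB; congr (ns _ - ns _).
by apply/funext => i; rewrite opprK.
Qed.

Lemma totZ {I : choiceType} (u : I -> R) k N : bnd u N ->
  tot (fun i => k * u i) = k * tot u.
Proof.
wlog k0 : k / 0 <= k => [hw hu|hu].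
  have [k0|/ltW k0] := leP 0 k; first exact: hw.
  rewrite -[k]opprK mulNr -(hw (- k))// ?oppr_ge0// -totN.
  by apply: eq_tot => i; rewrite mulNr.
have hup := bnd_pos hu; have hun := bnd_pos (bndN hu).
rewrite (tot_diff _ _ (bndZ k hup) (bndZ k hun)); last 3 first.
- by move=> i; rewrite mulr_ge0.
- by move=> i; rewrite mulr_ge0.
- by move=> i; rewrite {1}(posneg (u i)); lra.
by rewrite (nsZ _ hup) (nsZ _ hun) ger0_norm// /tot mulrBr.
Qed.

Lemma ler_norm_tot {I : choiceType} (u : I -> R) N : bnd u N -> `|tot u| <= ns u.
Proof.
move=> hu; rewrite ler_norml /tot.
have hup := bnd_pos hu; have hun := bnd_pos (bndN hu).
have h1 : ns (fun i => Num.max (u i) 0) <= ns u.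
  by apply: (ns_le _ hu) => i; case: (leP (u i) 0) => h; rewrite ?normr0.
have h2 : ns (fun i => Num.max (- u i) 0) <= ns u.
  by apply: (ns_le _ hu) => i; case: (leP (- u i) 0) => h; rewrite ?normr0// normrN.
have := ns_ge0 (fun i => Num.max (u i) 0).
have := ns_ge0 (fun i => Num.max (- u i) 0).
by lra.
Qed.

Lemma ler_tot {I : choiceType} (u : I -> R) N : bnd u N -> `|tot u| <= N.
Proof. by move=> h; apply: le_trans (ler_norm_tot h) (bnd_ns_le h). Qed.

Lemma bnd_row {I J : choiceType} (u : I * J -> R) N i :
  bnd u N -> bnd (fun j => u (i, j)) N.
Proof.
move=> hu; apply: le_trans hu.
rewrite [leRHS](_ : _ = \esum_(k in [set: I]) \esum_(j in [set: J]) (`|u (k, j)|)%:E)%E.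
  apply: (@le_trans _ _ (\esum_(k in [set i])
     \esum_(j in [set: J]) (`|u (k, j)|)%:E)%E).
    by rewrite esum_set1//; apply: esum_abs_ge0.
  rewrite esum_mkcond; apply: le_esum => k _; case: ifP => // _.
  exact: (esum_abs_ge0 (fun j => u (k, j))).
rewrite (@esum_esum R I J setT (fun=> setT) (fun i j => (`|u (i, j)|)%:E)).
  by rewrite (_ : _ `*`` _ = setT)//; [apply: eq_esum; case|apply/seteqP; split].
by move=> *; rewrite lee_fin.
Qed.

Lemma bnd_nsrow {I J : choiceType} (u : I * J -> R) N :
  bnd u N -> bnd (fun i => ns (fun j => u (i, j))) N /\
  ns (fun i => ns (fun j => u (i, j))) = ns u.
Proof.
move=> hu.
have e : (\esum_(k in [set: I]) (`|ns (fun j => u (k, j))|)%:E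
   = \esum_(i in [set: I * J]) (`|u i|)%:E)%E.
  transitivity (\esum_(k in [set: I]) \esum_(j in [set: J]) (`|u (k, j)|)%:E)%E.
    apply: eq_esum => k _; rewrite ger0_norm ?ns_ge0//.
    by rewrite (bnd_nsE (bnd_row k hu)).
  rewrite (@esum_esum R I J setT (fun=> setT) (fun i j => (`|u (i, j)|)%:E)).
    by rewrite (_ : _ `*`` _ = setT)//; [apply: eq_esum; case|apply/seteqP; split].
  by move=> *; rewrite lee_fin.
by split; [rewrite /bnd e|rewrite /ns e].
Qed.

Lemma tot_row {I J : choiceType} (u : I * J -> R) N : bnd u N ->
  tot (fun i => tot (fun j => u (i, j))) = tot u.
Proof.
move=> hu.
have hup := bnd_pos hu; have hun := bnd_pos (bndN hu).
have [bp ep] := bnd_nsrow hup; have [bn en] := bnd_nsrow hun.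
rewrite (tot_diff _ _ bp bn); last 3 first.
- by move=> i; apply: ns_ge0.
- by move=> i; apply: ns_ge0.
- by [].
by rewrite ep en.
Qed.

Lemma bnd_tot_row {I J : choiceType} (u : I * J -> R) N : bnd u N ->
  bnd (fun i => tot (fun j => u (i, j))) N.
Proof.
move=> hu; have [h _] := bnd_nsrow hu; apply: bnd_le h => i.
by rewrite [leRHS]ger0_norm ?ns_ge0//; apply: ler_norm_tot (bnd_row i hu).
Qed.

Lemma bnd_pair {I J : choiceType} (u : I * J -> R) (M : I -> R) N :
  (forall i, bnd (fun j => u (i, j)) (M i)) -> bnd M N -> bnd u N.
Proof.
move=> hr hM; apply: le_trans hM.
rewrite (_ : \esum_(i in _) _ =
  \esum_(k in [set: I]) \esum_(j in [set: J]) (`|u (k, j)|)%:E)%E; last first.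
  rewrite (@esum_esum R I J setT (fun=> setT) (fun i j => (`|u (i, j)|)%:E)).
    by rewrite (_ : _ `*`` _ = setT)//; [apply: eq_esum; case|apply/seteqP; split].
  by move=> *; rewrite lee_fin.
apply: le_esum => i _; apply: le_trans (hr i) _.
by rewrite lee_fin ler_norm.
Qed.

Lemma esum_swap {I J : choiceType} (u : I * J -> R) :
  (\esum_(i in [set: J * I]) (`|u (i.2, i.1)|)%:E =
   \esum_(i in [set: I * J]) (`|u i|)%:E)%E.
Proof.
rewrite [RHS](@reindex_esum _ _ _ setT setT (fun x : J * I => (x.2, x.1)))//.
by rewrite setTT_bijective; exists (fun x => (x.2, x.1)) => -[].
Qed.

Lemma bnd_swap {I J : choiceType} (u : I * J -> R) N :
  bnd u N -> bnd (fun i : J * I => u (i.2, i.1)) N.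
Proof. by rewrite /bnd esum_swap. Qed.

Lemma tot_swap {I J : choiceType} (u : I * J -> R) :
  tot (fun i : J * I => u (i.2, i.1)) = tot u.
Proof.
rewrite /tot /ns (esum_swap (fun i => Num.max (u i) 0)).
by rewrite (esum_swap (fun i => Num.max (- u i) 0)).
Qed.

Lemma bnd1 {I : choiceType} (i0 : I) (k : R) :
  bnd (fun i => if i == i0 then k else 0) `|k|.
Proof.
rewrite /bnd -[leRHS](@esum_set1 R I i0 (fun=> (`|k|)%:E)) ?lee_fin//.
rewrite [leRHS]esum_mkcond; apply: le_esum => i _.
case: eqP => [->|/eqP ne]; first by rewrite mem_set.
by rewrite normr0; case: ifP => _; rewrite lee_fin.
Qed.

Lemma ns1 {I : choiceType} (i0 : I) (k : R) :
  ns (fun i => if i == i0 then k else 0) = `|k|.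
Proof.
apply/eqP; rewrite eq_le (bnd_ns_le (bnd1 _ _))/= -lee_fin -(bnd_nsE (bnd1 i0 k)).
apply: esum_ge; exists [set i0]; first by split.
by rewrite fsbig_set1 eqxx.
Qed.

Lemma tot1 {I : choiceType} (i0 : I) (k : R) :
  tot (fun i => if i == i0 then k else 0) = k.
Proof.
rewrite (tot_diff (N := `|Num.max k 0|) (M := `|Num.max (- k) 0|)
  (v := fun i => if i == i0 then Num.max k 0 else 0)
  (w := fun i => if i == i0 then Num.max (- k) 0 else 0)).
- by rewrite !ns1 !ger0_norm// -posneg.
- by move=> i; case: ifP.
- by move=> i; case: ifP.
- exact: bnd1.
- exact: bnd1.
- by move=> i; case: ifP => _; [exact: posneg|rewrite subr0].
Qed.

Lemma bnd0 {I : choiceType} : bnd (fun _ : I => 0) 0.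
Proof. by rewrite /bnd esum1// => i _; rewrite normr0. Qed.

Lemma tot0 {I : choiceType} : tot (fun _ : I => 0) = 0.
Proof. by apply/eqP; rewrite -normr_le0; apply: ler_tot bnd0. Qed.

Lemma bnd_sum {I J : choiceType} (r : seq J) (P : pred J) (u : J -> I -> R)
    (N : J -> R) : (forall j, P j -> bnd (u j) (N j)) ->
  bnd (fun i => \sum_(j <- r | P j) u j i) (\sum_(j <- r | P j) N j) /\
  tot (fun i => \sum_(j <- r | P j) u j i) = \sum_(j <- r | P j) tot (u j).
Proof.
move=> h; elim: r => [|j r [b e]].
  rewrite !big_nil (_ : (fun i => _) = fun=> 0); first by split; [exact: bnd0|exact: tot0].
  by apply/funext => i; rewrite big_nil.
rewrite !big_cons; case: ifP => Pj; last first.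
  by rewrite (_ : (fun i => _) = fun i => \sum_(j <- r | P j) u j i)//;
    apply/funext => i; rewrite big_cons Pj.
rewrite (_ : (fun i => _) = fun i => u j i + \sum_(j <- r | P j) u j i); last first.
  by apply/funext => i; rewrite big_cons Pj.
split; first exact: bndD (h _ Pj) b.
by rewrite (totD (h _ Pj) b) e.
Qed.

(** A finite set of indices already carries the sum up to [e], and [sz] is bounded on it. The
    grading is the length for words and the identity for series; this connects unordered sums with
    limits of partial sums. *)
Lemma ns_grading {I : choiceType} (sz : I -> nat) (u : I -> R) N : bnd u N ->
  forall e, 0 < e -> exists n0, forall n, (n0 <= n)%N ->
  ns u - e <= ns (fun i => if (sz i < n)%N then u i else 0).
Proof.
move=> hu e e0.
have : ((ns u - e)%:E < \esum_(i in [set: I]) (`|u i|)%:E)%E.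
  by rewrite (bnd_nsE hu) lte_fin ltrBlDr ltrDl.
move=> /ereal_sup_gt[_ [A [fA _]] <-] lt.
exists (\max_(i <- fset_set A) sz i).+1 => n hn.
have hb : bnd (fun i => if (sz i < n)%N then u i else 0) N.
  by apply: bnd_le hu => i; case: ifP; rewrite ?normr0.
rewrite -lee_fin -(bnd_nsE hb); apply: le_trans (ltW lt) _.
apply: esum_ge; exists A; first by split.
apply: lee_fsum => // i Ai; rewrite ifT// (leq_trans _ hn)// ltnS.
by apply: leq_bigmax_seq => //; rewrite in_fset_set//; exact: mem_set.
Qed.

Lemma tot_grading {I : choiceType} (sz : I -> nat) (u : I -> R) N : bnd u N ->
  (fun n => tot (fun i => if (sz i < n)%N then u i else 0)) @ \oo --> tot u.
Proof.
move=> hu; apply/cvgrPdist_le => e e0.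
have hup := bnd_pos hu; have hun := bnd_pos (bndN hu).
have e20 : 0 < e / 2 by lra.
have [n1 h1] := ns_grading sz hup e20.
have [n2 h2] := ns_grading sz hun e20.
exists (maxn n1 n2) => // n /=; rewrite geq_max => /andP[/h1 {}h1 /h2 {}h2].
pose cut v := fun i : I => if (sz i < n)%N then (v i : R) else 0.
have bcut v M : bnd v M -> bnd (cut v) M.
  by apply: bnd_le => i; rewrite /cut; case: ifP; rewrite ?normr0.
have lecut v M : bnd v M -> ns (cut v) <= ns v.
  by apply: ns_le => i; rewrite /cut; case: ifP; rewrite ?normr0.
rewrite (_ : tot (fun i => if _ then _ else _) =
  ns (cut (fun i => Num.max (u i) 0)) - ns (cut (fun i => Num.max (- u i) 0))); last first.
  apply: (tot_diff _ _ (bcut _ _ hup) (bcut _ _ hun)) => i; rewrite /cut; case: ifP => // _.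
    exact: posneg.
  by rewrite subr0.
have := lecut _ _ hup; have := lecut _ _ hun; rewrite /tot ler_norml.
by move: h1 h2; rewrite -/(cut _) -/(cut (fun i => Num.max (- u i) 0)); lra.
Qed.

Lemma bnd_series (u : nat -> R) N :
  (forall n, \sum_(k < n) `|u k| <= N) -> bnd u N.
Proof.
move=> h; rewrite /bnd -nneseries_esumT; last by move=> n; rewrite lee_fin.
apply: lime_le; first by apply: is_cvg_nneseries => i _ _; rewrite lee_fin.
by apply: nearW => n; rewrite sumEFin lee_fin big_mkord.
Qed.

Lemma bnd_cvg_series (u : nat -> R) :
  cvg ((fun n => \sum_(k < n) `|u k|) @ \oo) -> exists N, bnd u N.
Proof.
move=> h; exists (lim ((fun n => \sum_(k < n) `|u k|) @ \oo)).
apply: bnd_series => n; apply: nondecreasing_cvgn_le => // i j ij.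
rewrite -!(big_mkord xpredT (fun k => `|u k|)) (big_cat_nat (leq0n i) ij)//=.
by rewrite lerDl sumr_ge0.
Qed.

Lemma tot_series (u : nat -> R) N : bnd u N ->
  (fun n => \sum_(k < n) u k) @ \oo --> tot u.
Proof.
move=> hu; have := tot_grading id hu; set f1 := fun n => _; set f2 := fun n => _.
suff -> : f2 = f1 by [].
apply/funext => n; rewrite /f1 /f2.
pose v (j : 'I_n) (i : nat) : R := if i == j then u j else 0.
have [_ e] := @bnd_sum nat 'I_n (index_enum _) xpredT v
  (fun j => `|u j|) (fun j _ => bnd1 (j : nat) (u j)).
rewrite (_ : (fun i => if _ then _ else _) = fun i => \sum_(j < n) v j i).
  by rewrite e; apply: eq_bigr => i _; rewrite tot1.
apply/funext => i; rewrite /v; case: ltnP => hin.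
  rewrite (bigD1 (Ordinal hin))//= eqxx big1 ?addr0// => j jne.
  by rewrite ifN//; apply: contra jne => /eqP e'; apply/eqP/val_inj.
by rewrite big1// => j _; rewrite ifN// gtn_eqF// (leq_trans _ hin).
Qed.

End Sums.

(** * Germs of analytic functions as absolutely summable power series *)

Section Germs.
Context {R : realType}.

Definition cube {V : finType} (p : V -> R) (r : R) (y : V -> R) : Prop :=
  forall v, `|y v - p v| <= r.

(* Germs are encoded by noncommutative power series (indexed by words in the
   variables): products become concatenations, and no multi-index arithmetic is
   needed. *)
Definition inB {V : finType} (p : V -> R) (r N : R) (g : (V -> R) -> R) : Prop :=
  exists2 c : seq V -> R, bnd (fun w => c w * r ^+ size w) N &
    forall y, cube p r y -> g y = tot (fun w => c w * \prod_(x <- w) (y x - p x)).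

Definition analytic_at {V : finType} (p : V -> R) (g : (V -> R) -> R) : Prop :=
  exists2 r, 0 < r & exists N, inB p r N g.

Lemma cubeW {V : finType} (p y : V -> R) r s : r <= s -> cube p r y -> cube p s y.
Proof. by move=> rs h v; apply: le_trans (h v) rs. Qed.

Lemma cube_refl {V : finType} (p : V -> R) r : 0 <= r -> cube p r p.
Proof. by move=> r0 v; rewrite subrr normr0. Qed.

Lemma ler_word {V : finType} (p y : V -> R) r (w : seq V) : cube p r y ->
  `|\prod_(x <- w) (y x - p x)| <= r ^+ size w.
Proof.
move=> h; elim: w => [|x w ih]; first by rewrite big_nil normr1.
by rewrite big_cons normrM exprS ler_pM.
Qed.

Lemma bnd_word {V : finType} {I : choiceType} (p y : V -> R) r N (c : I -> R) (W : I -> seq V) :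
  cube p r y -> 0 <= r -> bnd (fun i => c i * r ^+ size (W i)) N ->
  bnd (fun i => c i * \prod_(x <- W i) (y x - p x)) N.
Proof.
move=> h r0; apply: bnd_le => i; rewrite !normrM ler_wpM2l//.
by rewrite (ger0_norm (exprn_ge0 _ r0)) ler_word.
Qed.

Section GermsV.
Variable V : finType.
Implicit Types (p q y z : V -> R) (f g h : (V -> R) -> R) (w : seq V).

Lemma eq_inB p r N g g' : (forall y, cube p r y -> g y = g' y) ->
  inB p r N g -> inB p r N g'.
Proof. by move=> e [c bc gE]; exists c => // y hy; rewrite -e// gE. Qed.

Lemma inBW p r N M g : N <= M -> inB p r N g -> inB p r M g.
Proof. by move=> h [c bc gE]; exists c => //; apply: bndW bc. Qed.

Lemma inB_bound p r N g y : 0 <= r -> inB p r N g -> cube p r y -> `|g y| <= N.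
Proof. by move=> r0 [c bc gE] hy; rewrite gE//; apply: ler_tot (bnd_word hy r0 bc). Qed.

Lemma inB_sub p r r' N g : 0 <= r' <= r -> inB p r N g -> inB p r' N g.
Proof.
move=> /andP[r'0 r'r] [c bc gE]; exists c; last first.
  by move=> y hy; apply: gE; apply: cubeW hy.
apply: bnd_le bc => w; rewrite !normrM ler_wpM2l// !ger0_norm ?exprn_ge0//.
  by rewrite lerXn2r ?nnegrE// (le_trans r'0).
exact: le_trans r'r.
Qed.

Lemma inB_mon p r k w : 0 <= r ->
  inB p r (`|k| * r ^+ size w) (fun y => k * \prod_(x <- w) (y x - p x)).
Proof.
move=> r0; exists (fun w' => if w' == w then k else 0).
  have := bnd1 w (k * r ^+ size w); rewrite normrM (ger0_norm (exprn_ge0 _ r0)).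
  by apply: bnd_le => w'; case: eqP => [->|]; rewrite ?mul0r.
move=> y hy; rewrite -[LHS](tot1 w); apply: eq_tot => w'.
by case: eqP => [->|]; rewrite ?mul0r.
Qed.

(** Coefficient families of finite weighted norm form a complete space, so a series of germs with
    summable norms is again a germ. The proof is Fubini for the double family over [K] and the
    words; dividing by [r ^+ size w] makes the coefficients of a single word summable in [k]. *)
Lemma inB_sum {K : choiceType} p r (N : K -> R) M (g : K -> (V -> R) -> R) : 0 < r ->
  (forall k, inB p r (N k) (g k)) -> bnd N M ->
  inB p r M (fun y => tot (fun k => g k y)).
Proof.
move=> r0 hg hN.
have /choice[c hc] : forall k, exists c : seq V -> R,
    bnd (fun w => c w * r ^+ size w) (N k) /\
    forall y, cube p r y -> g k y = tot (fun w => c w * \prod_(x <- w) (y x - p x)).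
  by move=> k; have [c ? ?] := hg k; exists c.
pose u kw : R := c kw.1 kw.2 * r ^+ size kw.2.
have bu : bnd u M by apply: bnd_pair hN => k; have [h _] := hc k.
have bk w : bnd (fun k => c k w * r ^+ size w) M by exact: bnd_row w (bnd_swap bu).
have rn w : r ^+ size w != 0 by rewrite expf_neq0// gt_eqF.
have bk' w : exists M', bnd (fun k => c k w) M'.
  eexists; apply: bnd_le (bndZ (r ^- size w) (bk w)) => k.
  by rewrite mulrC mulfK.
exists (fun w => tot (fun k => c k w)).
  apply: bnd_le (bnd_tot_row (bnd_swap bu)) => w /=.
  rewrite mulrC; have [M' h] := bk' w; rewrite -(totZ _ h).
  by rewrite [X in _ <= `|X|](@eq_tot _ _ _ (fun k => r ^+ size w * c k w))// => k;
    rewrite mulrC.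
move=> y hy.
pose v (kw : K * seq V) : R := c kw.1 kw.2 * \prod_(x <- kw.2) (y x - p x).
have bv : bnd v M.
  apply: bnd_le bu => -[k w]; rewrite !normrM ler_wpM2l//.
  by rewrite (ger0_norm (exprn_ge0 _ (ltW r0))) ler_word.
transitivity (tot v).
  by rewrite -(tot_row bv); apply: eq_tot => k; have [_ ->] := hc k.
rewrite -(tot_swap v) -(tot_row (bnd_swap bv)); apply: eq_tot => w /=.
have [M' h] := bk' w.
by rewrite mulrC -(totZ _ h); apply: eq_tot => k; rewrite mulrC.
Qed.

Lemma inB_fam {I : choiceType} p r N (c : I -> R) (W : I -> seq V) : 0 < r ->
  bnd (fun i => c i * r ^+ size (W i)) N ->
  inB p r N (fun y => tot (fun i => c i * \prod_(x <- W i) (y x - p x))).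
Proof.
move=> r0 h.
apply: (@inB_sum I p r (fun i => `|c i| * r ^+ size (W i))) => //.
  by move=> i; apply: inB_mon; apply: ltW.
by apply: bnd_le h => i; rewrite !normrM normr_id.
Qed.

Lemma inB_cst p r k : 0 <= r -> inB p r `|k| (fun=> k).
Proof.
move=> r0; have := inB_mon p k [::] r0; rewrite mulr1.
by apply: eq_inB => y _; rewrite big_nil mulr1.
Qed.

Lemma inB_var p r v : 0 <= r -> inB p r r (fun y => y v - p v).
Proof.
move=> r0; have := inB_mon p 1 [:: v] r0; rewrite normr1 mul1r expr1.
by apply: eq_inB => y _; rewrite big_seq1 mul1r.
Qed.

Lemma inB_add p r N M g h : 0 <= r -> inB p r N g -> inB p r M h ->
  inB p r (N + M) (fun y => g y + h y).
Proof.
move=> r0 [c bc gE] [d bd hE]; exists (fun w => c w + d w).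
  by apply: bnd_le (bndD bc bd) => w; rewrite mulrDl.
move=> y hy; rewrite gE// hE// -(totD (bnd_word hy r0 bc) (bnd_word hy r0 bd)).
by apply: eq_tot => w; rewrite mulrDl.
Qed.

Lemma inB_scale p r N k g : 0 <= r -> inB p r N g -> inB p r (`|k| * N) (fun y => k * g y).
Proof.
move=> r0 [c bc gE]; exists (fun w => k * c w).
  by apply: bnd_le (bndZ k bc) => w; rewrite mulrA.
move=> y hy; rewrite gE// -(totZ _ (bnd_word hy r0 bc)).
by apply: eq_tot => w; rewrite mulrA.
Qed.

(** Concatenation adds lengths, hence the weighted norm is submultiplicative, as in a Banach
    algebra. *)
Lemma inB_mul p r N M g h : 0 < r -> inB p r N g -> inB p r M h ->
  inB p r (N * M) (fun y => g y * h y).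
Proof.
move=> r0 [c bc gE] [d bd hE].
have M0 := bnd_ge0 bd.
apply: (@eq_inB _ _ _ (fun y => tot (fun w => c w *
   (tot (fun w' => d w' * \prod_(x <- w ++ w') (y x - p x)))))).
  move=> y hy; rewrite gE// [RHS]mulrC -(totZ _ (bnd_word hy (ltW r0) bc)).
  apply: eq_tot => w; rewrite mulrCA; congr (_ * _).
  rewrite hE// [RHS]mulrC -(totZ _ (bnd_word hy (ltW r0) bd)).
  by apply: eq_tot => w'; rewrite big_cat/= mulrCA.
apply: (@inB_sum _ p r (fun w => `|c w| * (r ^+ size w * M))) => // [w|].
  apply: inB_scale; first exact: ltW.
  apply: inB_fam => //; have := bndZ (r ^+ size w) bd.
  rewrite (ger0_norm (exprn_ge0 _ (ltW r0))); apply: bnd_le => w'.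
  by rewrite size_cat exprD mulrCA.
have := bndZ M bc; rewrite (ger0_norm M0) mulrC; apply: bnd_le => w.
by rewrite !normrM normr_id mulrA mulrC.
Qed.

(** Without its constant term a series has only words of length at least 1, and each of them gains a
    factor [s] when the radius is multiplied by [s]. This makes increments small enough to be
    substituted into another germ. *)
Lemma inB_shrink p r N g s : 0 < r -> 0 <= s <= 1 -> inB p r N g ->
  inB p (s * r) (s * N) (fun y => g y - g p).
Proof.
move=> r0 /andP[s0 s1] [c bc gE].
have sr0 : 0 <= s * r by rewrite mulr_ge0// ltW.
have gp : g p = c [::].
  rewrite gE; last by apply: cube_refl; exact: ltW.
  rewrite -[RHS](tot1 (Nil V)); apply: eq_tot => -[|x w]/=; first by rewrite big_nil mulr1.
  by rewrite big_cons subrr mul0r mulr0.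
exists (fun w => if w is [::] then 0 else c w).
  have := bndZ s bc; rewrite (ger0_norm s0); apply: bnd_le => -[|x w].
    by rewrite mul0r normr0.
  rewrite mulrCA !normrM ler_wpM2l// !exprMn normrM ler_wpM2r//.
  rewrite !ger0_norm ?exprn_ge0// exprS ler_piMr// exprn_ile1//.
move=> y hy.
have hy' : cube p r y by apply: cubeW hy; rewrite ler_piMl// ltW.
have bcy := bnd_word hy' (ltW r0) bc.
rewrite gE// gp -[X in _ - X](tot1 (Nil V)) -totN.
rewrite -(totD bcy (bndN (bnd1 _ _))); apply: eq_tot => -[|x w]/=.
  by rewrite big_nil mulr1 subrr mul0r.
by rewrite subr0.
Qed.

End GermsV.

(** By submultiplicativity a word [w] of [f] becomes a germ of norm at most [s ^+ size w], exactly
    the weight of [w] in the norm of [f]. Substitution therefore does not increase the norm. *)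
Lemma inB_comp {V V' : finType} (p : V -> R) r (q : V' -> R) s N
    (f : (V' -> R) -> R) (h : V' -> (V -> R) -> R) : 0 < r -> 0 <= s ->
  inB q s N f -> (forall v, inB p r s (fun y => h v y - q v)) ->
  inB p r N (fun y => f (fun v => h v y)).
Proof.
move=> r0 s0 [c bc fE] hh.
have hw (w : seq V') : inB p r (s ^+ size w) (fun y => \prod_(x <- w) (h x y - q x)).
  elim: w => [|x w ih].
    have := inB_cst p 1 (ltW r0); rewrite normr1.
    by apply: eq_inB => y _; rewrite big_nil.
  have := inB_mul r0 (hh x) ih; rewrite -exprS.
  by apply: eq_inB => y _; rewrite big_cons.
apply: (@eq_inB _ _ _ _ (fun y => tot (fun w => c w * \prod_(x <- w) (h x y - q x)))).
  by move=> y hy; rewrite fE// => v; apply: inB_bound (hh v) hy; apply: ltW.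
apply: (@inB_sum _ _ p r (fun w => `|c w| * s ^+ size w)) => // [w|].
  by apply: inB_scale; first exact: ltW.
by apply: bnd_le bc => w; rewrite !normrM normr_id.
Qed.

Lemma finite_radius {T : finType} (P : T -> R -> Prop) :
  (forall t, exists2 d, 0 < d & forall d', 0 < d' <= d -> P t d') ->
  exists2 d, 0 < d & forall t d', 0 < d' <= d -> P t d'.
Proof.
move=> h.
have /choice[d hd] : forall t, exists d, 0 < d /\ forall d', 0 < d' <= d -> P t d'.
  by move=> t; have [d ? ?] := h t; exists d.
exists (\big[Num.min/1]_t d t).
  by apply: (big_ind (fun x => 0 < x)) => // [x y x0 y0|t _]; [rewrite lt_min x0|have [] := hd t].
move=> t d' /andP[d'0 d'd]; have [_] := hd t; apply; rewrite d'0 (le_trans d'd)//.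
by rewrite (bigD1 t)//= ge_min lexx.
Qed.

Lemma finite_radius_mono {T : finType} (P : T -> R -> Prop) :
  (forall t d d', d' <= d -> P t d -> P t d') ->
  (forall t, exists2 d, 0 < d & P t d) -> exists2 d, 0 < d & forall t, P t d.
Proof.
move=> Pm h; have [d d0 hd] : exists2 d, 0 < d & forall t d', 0 < d' <= d -> P t d'.
  apply: finite_radius => t; have [d d0 hd] := h t; exists d => // d' /andP[_ d'd].
  exact: Pm hd.
by exists d => // t; apply: hd; rewrite d0 lexx.
Qed.

Section AnalyticAt.
Variable V : finType.
Implicit Types (p q y z : V -> R) (f g h : (V -> R) -> R).

Lemma analytic_small p g s : analytic_at p g -> 0 < s ->
  exists2 d, 0 < d & forall d', 0 < d' <= d -> inB p d' s (fun y => g y - g p).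
Proof.
move=> [r r0 [N hg]] s0; have N0 : 0 <= N by have [c /bnd_ge0] := hg.
(* Chosen so that [t * (N + 1) <= s]; the added 1 avoids a division by [N = 0]. *)
pose t := Num.min 1 (s / (N + 1)).
have N1 : 0 < N + 1 by lra.
have t0 : 0 < t by rewrite lt_min ltr01 divr_gt0.
have tle : t <= s / (N + 1) by rewrite ge_min lexx orbT.
have ht : 0 <= t <= 1 by rewrite (ltW t0) ge_min lexx.
exists (t * r); first exact: mulr_gt0.
move=> d' /andP[d'0 d'r]; apply: (@inB_sub _ _ (t * r)); first by rewrite (ltW d'0).
apply: inBW (inB_shrink r0 ht hg); apply: (@le_trans _ _ (t * (N + 1))).
  by rewrite ler_wpM2l// ?(ltW t0)// lerDl.
by rewrite -ler_pdivlMr.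
Qed.

Lemma analytic_common p g h : analytic_at p g -> analytic_at p h ->
  exists2 r, 0 < r & exists N M, inB p r N g /\ inB p r M h.
Proof.
move=> [r r0 [N hg]] [s s0 [M hh]]; exists (Num.min r s); first by rewrite lt_min r0.
have m0 : 0 <= Num.min r s by rewrite le_min !ltW.
exists N, M; split.
  by apply: inB_sub hg; rewrite m0 ge_min lexx.
by apply: inB_sub hh; rewrite m0 ge_min lexx orbT.
Qed.

Lemma analytic_near p g g' d : 0 < d -> (forall y, cube p d y -> g y = g' y) ->
  analytic_at p g -> analytic_at p g'.
Proof.
move=> d0 e [r r0 [N hg]]; have m0 : 0 < Num.min r d by rewrite lt_min r0.
exists (Num.min r d) => //; exists N.
apply: (@eq_inB _ _ _ _ g).
  by move=> y hy; apply: e; apply: cubeW hy; rewrite ge_min lexx orbT.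
by apply: inB_sub hg; rewrite (ltW m0) ge_min lexx.
Qed.

Lemma eq_analytic p g g' : g =1 g' -> analytic_at p g -> analytic_at p g'.
Proof. by move=> /funext ->. Qed.

Lemma analytic_cst p k : analytic_at p (fun=> k).
Proof. by exists 1 => //; exists `|k|; apply: inB_cst. Qed.

Lemma analytic_add p g h : analytic_at p g -> analytic_at p h ->
  analytic_at p (fun y => g y + h y).
Proof.
move=> ag ah; have [r r0 [N [M [hg hh]]]] := analytic_common ag ah.
by exists r => //; exists (N + M); apply: inB_add => //; apply: ltW.
Qed.

Lemma analytic_mul p g h : analytic_at p g -> analytic_at p h ->
  analytic_at p (fun y => g y * h y).
Proof.
move=> ag ah; have [r r0 [N [M [hg hh]]]] := analytic_common ag ah.
by exists r => //; exists (N * M); apply: inB_mul.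
Qed.

Lemma analytic_scale p k g : analytic_at p g -> analytic_at p (fun y => k * g y).
Proof. by move=> ag; apply: analytic_mul ag; apply: analytic_cst. Qed.

Lemma analytic_opp p g : analytic_at p g -> analytic_at p (fun y => - g y).
Proof.
by move=> /(analytic_scale (-1)); apply: eq_analytic => y; rewrite mulN1r.
Qed.

Lemma analytic_sub p g h : analytic_at p g -> analytic_at p h ->
  analytic_at p (fun y => g y - h y).
Proof. by move=> ag ah; apply: analytic_add => //; apply: analytic_opp. Qed.

Lemma analytic_var p v : analytic_at p (fun y => y v).
Proof.
apply: (@eq_analytic _ (fun y => p v + (y v - p v))) => [y|]; first by rewrite addrC subrK.
apply: analytic_add; first exact: analytic_cst.
by exists 1 => //; exists 1; apply: inB_var.
Qed.

Lemma analytic_exp p g n : analytic_at p g -> analytic_at p (fun y => g y ^+ n).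
Proof.
move=> ag; elim: n => [|n ih]; first exact: analytic_cst.
by apply: eq_analytic (analytic_mul ag ih) => y; rewrite exprS.
Qed.

Lemma analytic_sum p (J : Type) (r : seq J) (P : pred J) (g : J -> (V -> R) -> R) :
  (forall j, analytic_at p (g j)) -> analytic_at p (fun y => \sum_(j <- r | P j) g j y).
Proof.
move=> ag; elim: r => [|j r ih].
  by apply: eq_analytic (analytic_cst p 0) => y; rewrite big_nil.
have [Pj|Pj] := boolP (P j); last first.
  by apply: eq_analytic ih => y; rewrite big_cons (negPf Pj).
by apply: eq_analytic (analytic_add (ag j) ih) => y; rewrite big_cons Pj.
Qed.

Lemma analytic_cont p g e : analytic_at p g -> 0 < e ->
  exists2 d, 0 < d & forall y, cube p d y -> `|g y - g p| <= e.
Proof.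
move=> ag e0; have [d d0 hd] := analytic_small ag e0; exists d => // y hy.
have h : inB p d e (fun y => g y - g p) by apply: hd; rewrite d0 lexx.
exact: (inB_bound (ltW d0) h hy).
Qed.

(** Recentring is composition with the identity: [y - p = (y - q) + (q - p)] has norm at most
    [r / 2 + r / 2] around [q], so [inB_comp] expands the series anew there. *)
Lemma analytic_shift p g : analytic_at p g ->
  exists2 d, 0 < d & forall q, cube p d q -> analytic_at q g.
Proof.
move=> [r r0 [N hg]]; exists (r / 2); first by lra.
move=> q hq; exists (r / 2); first by lra.
exists N; apply: (@inB_comp V V q (r / 2) p r N g (fun v y => y v)) => //; try lra.
move=> v; apply: inBW (_ : r / 2 + `|q v - p v| <= r) _; first by have := hq v; lra.
apply: (@eq_inB _ _ _ _ (fun y => (y v - q v) + (q v - p v))).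
  by move=> y _; ring.
apply: inB_add; first by lra.
  by apply: inB_var; lra.
by apply: inB_cst; lra.
Qed.

End AnalyticAt.

Lemma analytic_comp {V V' : finType} (p : V -> R) (f : (V' -> R) -> R)
    (h : V' -> (V -> R) -> R) :
  (forall v, analytic_at p (h v)) -> analytic_at (fun v => h v p) f ->
  analytic_at p (fun y => f (fun v => h v y)).
Proof.
move=> ah [s s0 [N hf]].
have [d d0 hd] := @finite_radius V' _ (fun v => analytic_small (ah v) s0).
exists d => //; exists N; apply: inB_comp (ltW s0) hf _ => // v.
by apply: hd; rewrite d0 lexx.
Qed.

Definition twop {V : finType} (y z : V -> R) (v : V + V) : R :=
  match v with inl v => y v | inr v => z v end.

(** The difference of a word at [y] and at [z] telescopes letter by letter. [dquo v] collects the
    terms in which the changed letter is [v]; the letters before it are taken at [y], those after it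
    at [z]. *)
Fixpoint dquo {V : finType} (v : V) (w : seq V) (y z : V -> R) : R :=
  if w is x :: w' then
    (x == v)%:R * \prod_(u <- w') z u + y x * dquo v w' y z
  else 0.

Lemma dquoP {V : finType} (w : seq V) (y z : V -> R) :
  \prod_(x <- w) y x - \prod_(x <- w) z x = \sum_v (y v - z v) * dquo v w y z.
Proof.
elim: w => [|x w ih]; first by rewrite !big_nil subrr big1// => v _; rewrite mulr0.
rewrite !big_cons /=.
rewrite [RHS](eq_bigr (fun v => (y v - z v) * ((x == v)%:R * \prod_(u <- w) z u) +
  y x * ((y v - z v) * dquo v w y z))); last by move=> v _; rewrite mulrDr (mulrCA (y x)).
rewrite big_split/= -mulr_sumr -ih (bigD1 x)//= eqxx mul1r [X in _ = _ + X + _]big1; first by ring.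
by move=> v vx; rewrite eq_sym (negPf vx) mul0r mulr0.
Qed.

(** On the diagonal [dquo v] is the partial derivative along [v]. The initial letter [v] keeps the
    formula free of a division by [y v]; words of this form occur in the series of a primitive. *)
Lemma dquo_diag {V : finType} (v : V) (w : seq V) (y : V -> R) :
  dquo v (v :: w) y y = (count_mem v w).+1%:R * \prod_(x <- w) y x.
Proof.
suff e : y v * dquo v w y y = (count_mem v w)%:R * \prod_(x <- w) y x.
  by rewrite /= e eqxx mul1r -natr1 mulrDl mul1r addrC.
elim: w => [|x w ih] /=; first by rewrite mulr0 mul0r.
rewrite big_cons mulrDr [X in _ + X]mulrCA ih natrD mulrDl.
congr (_ + _); last by rewrite mulrCA.
by case: eqP => [->|_]; rewrite ?mul0r ?mulr0 ?mul1r.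
Qed.

Lemma inB_dquo {V : finType} (v : V) (w : seq V) (p : V -> R) r : 0 < r ->
  inB (twop p p) r ((size w)%:R * r ^+ (size w).-1)
    (fun Y => dquo v w (fun v => Y (inl v) - p v) (fun v => Y (inr v) - p v)).
Proof.
move=> r0; elim: w => [|x w ih] /=.
  by rewrite mul0r; have := inB_cst (twop p p) 0 (ltW r0); rewrite normr0.
have h1 : inB (twop p p) r (r ^+ size w)
    (fun Y => (x == v)%:R * \prod_(u <- w) (Y (inr u) - p u)).
  have h := inB_mon (twop p p) (x == v)%:R (map inr w) (ltW r0).
  apply: (@eq_inB _ _ _ _ (fun Y => (x == v)%:R *
     \prod_(u <- map inr w) (Y u - twop p p u))).
    by move=> Y _; rewrite big_map.
  apply: inBW h; rewrite size_map; case: eqP => _.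
    by rewrite normr1 mul1r.
  by rewrite normr0 mul0r exprn_ge0// ltW.
have h2 := inB_mul r0 (inB_var (twop p p) (inl x) (ltW r0)) ih.
apply: inBW (inB_add (ltW r0) h1 h2).
rewrite -natr1 mulrDl mul1r addrC lerD2r mulrCA.
by case: w {ih h1 h2} => [|x' w] /=; rewrite ?mul0r// -exprS.
Qed.

(** From [n s^(n-1) (r - s) <= r^n - s^n]. This is the Cauchy estimate: differentiation costs a
    smaller radius and a factor [(r - s)^-1]. *)
Lemma size_geom (r s : R) n : 0 <= s < r ->
  n%:R * s ^+ n.-1 <= (r - s)^-1 * r ^+ n.
Proof.
move=> /andP[s0 sr]; have d0 : 0 < r - s by lra.
rewrite mulrC [leRHS]mulrC ler_pdivlMr//.
suff : s ^+ n.-1 * n%:R * (r - s) <= r ^+ n - s ^+ n.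
  by have := exprn_ge0 n s0; lra.
elim: n => [|n ih] /=; first by rewrite mulr0 mul0r !expr0 subrr.
have e : s ^+ n * n.+1%:R = s ^+ n + s * (s ^+ n.-1 * n%:R).
  case: n {ih} => [|n]; first by rewrite !mulr0 addr0 mulr1.
  by rewrite /= mulrA -exprS -[in LHS]natr1 mulrDr mulr1 addrC.
have d1 : 0 <= r ^+ n - s ^+ n.
  by rewrite subr_ge0 lerXn2r ?nnegrE//; lra.
have h1 := ler_wpM2l s0 ih.
have h2 : s * (r ^+ n - s ^+ n) <= r * (r ^+ n - s ^+ n).
  by rewrite ler_wpM2r// ltW.
rewrite e !exprS; set X := s ^+ n.-1 * n%:R in h1 *.
move: h1 h2; set a := r ^+ n; set b := s ^+ n; nra.
Qed.

(** Hadamard's lemma, with quotients analytic in the pair [(y, z)], comes from summing [dquo] over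
    the series; the loss of radius pays for the factor [size w] in its norm. The chain rule, the
    Lipschitz and Taylor estimates and differentiation under the integral all rest on it. The words
    form a family over any [I] so that the series of a primitive fits as well. *)
Lemma hadamard {V : finType} {I : choiceType} (p : V -> R) r r' N (c : I -> R)
    (W : I -> seq V) (g : (V -> R) -> R) : 0 < r' < r ->
  bnd (fun i => c i * r ^+ size (W i)) N ->
  (forall y, cube p r y -> g y = tot (fun i => c i * \prod_(x <- W i) (y x - p x))) ->
  exists k : V -> (V + V -> R) -> R,
  [/\ forall v, inB (twop p p) r' ((r - r')^-1 * N) (k v),
      forall y z, cube p r' y -> cube p r' z ->
        g y - g z = \sum_v (y v - z v) * k v (twop y z) &
      forall v y, k v (twop y y) =
        tot (fun i => c i * dquo v (W i) (fun v => y v - p v) (fun v => y v - p v))].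
Proof.
move=> /andP[r'0 r'r] bc gE.
have hr : 0 <= r' < r by rewrite (ltW r'0).
have dr0 : 0 < r - r' by lra.
pose t i Y v := dquo v (W i) (fun v => Y (inl v) - p v) (fun v => Y (inr v) - p v).
have bM : bnd (fun i => `|c i| * ((size (W i))%:R * r' ^+ (size (W i)).-1)) ((r - r')^-1 * N).
  have := bndZ (r - r')^-1 bc; rewrite (ger0_norm (ltW _)) ?invr_gt0//.
  apply: bnd_le => i; rewrite normrM normr_id mulrCA [leRHS]normrM ler_wpM2l//.
  rewrite ler_norml; apply/andP; split.
    by rewrite lerNl (@le_trans _ _ 0)// ?oppr_le0 ?mulr_ge0// exprn_ge0// ltW.
  by rewrite ger0_norm ?size_geom// mulr_ge0// ?invr_ge0 ?exprn_ge0//; lra.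
exists (fun v Y => tot (fun i => c i * t i Y v)); split.
- move=> v; apply: (@inB_sum _ I _ _ _ _ (fun i Y => c i * t i Y v) r'0 _ bM) => i.
  by apply: inB_scale; [exact: ltW|exact: inB_dquo].
- move=> y z hy hz.
  have hy' : cube p r y by apply: cubeW hy; apply: ltW.
  have hz' : cube p r z by apply: cubeW hz; apply: ltW.
  have r0 : 0 <= r by lra.
  have by' := bnd_word hy' r0 bc; have bz' := bnd_word hz' r0 bc.
  have bt v : bnd (fun i => c i * t i (twop y z) v) ((r - r')^-1 * N).
    apply: bnd_le bM => i; rewrite normrM [X in _ <= X]normrM normr_id ler_wpM2l//.
    rewrite [leRHS]ger0_norm ?mulr_ge0 ?exprn_ge0// ?(ltW r'0)//.
    apply: (inB_bound (ltW r'0) (inB_dquo v (W i) p r'0)) => -[u|u] /=.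
      exact: hy.
    exact: hz.
  rewrite gE// gE// -totN -(totD by' (bndN bz')).
  under eq_bigr do rewrite -(totZ _ (bt _)).
  have [_ <-] := @bnd_sum _ I V (index_enum V) xpredT
    (fun v i => (y v - z v) * (c i * t i (twop y z) v)) _ (fun v _ => bndZ _ (bt v)).
  apply: eq_tot => i; rewrite -mulrBr.
  rewrite (dquoP (W i) (fun v => y v - p v) (fun v => z v - p v)) mulr_sumr.
  by apply: eq_bigr => v _; rewrite mulrCA /t /=; congr (_ * _); ring.
- by [].
Qed.

End Germs.

(** * Calculus in one variable, partial derivatives, and integrals defined by primitives *)

Section Calculus.
Context {R : realType}.

Notation deriv f x d := (is_derive (x : R) (1 : R) (f : R -> R) (d : R)).

Lemma deriv_eq (f : R -> R) x d d' : d = d' -> deriv f x d -> deriv f x d'.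
Proof. by move=> ->. Qed.

Lemma deriv_cst (k x : R) : deriv (fun=> k) x 0.
Proof. exact: is_derive_cst. Qed.

Lemma deriv_id (x : R) : deriv (fun t => t) x 1.
Proof. exact: is_derive_id. Qed.

Lemma derivD (f g : R -> R) x d e : deriv f x d -> deriv g x e ->
  deriv (fun t => f t + g t) x (d + e).
Proof. exact: is_deriveD. Qed.

Lemma derivM (f g : R -> R) x d e : deriv f x d -> deriv g x e ->
  deriv (fun t => f t * g t) x (d * g x + f x * e).
Proof.
move=> hf hg; have h := is_deriveM hf hg; apply: deriv_eq h.
by rewrite /GRing.scale/= addrC [g x * d]mulrC.
Qed.

Lemma derivZ (f : R -> R) k x d : deriv f x d -> deriv (fun t => k * f t) x (k * d).
Proof. by move=> h; apply: deriv_eq (derivM (deriv_cst k x) h); rewrite mul0r add0r. Qed.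

Lemma derivN (f : R -> R) x d : deriv f x d -> deriv (fun t => - f t) x (- d).
Proof. exact: is_deriveN. Qed.

Lemma derivB (f g : R -> R) x d e : deriv f x d -> deriv g x e ->
  deriv (fun t => f t - g t) x (d - e).
Proof. exact: is_deriveB. Qed.

Lemma deriv_comp (f g : R -> R) x d e : deriv f (g x) d -> deriv g x e ->
  deriv (fun t => f (g t)) x (d * e).
Proof. exact: is_derive1_comp. Qed.

Lemma derivX (f : R -> R) n x d : deriv f x d ->
  deriv (fun t => f t ^+ n) x (n%:R * f x ^+ n.-1 * d).
Proof.
move=> h; elim: n => [|n ih].
  by apply: deriv_eq (deriv_cst 1 x); rewrite !mul0r.
have := derivM h ih; rewrite (_ : (fun t => _) = fun t => f t ^+ n.+1); last first.
  by apply/funext => t; rewrite exprS.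
apply: deriv_eq; case: n {ih} => [|n] /=.
  by rewrite !expr0; ring.
by rewrite -[in RHS]natr1 exprS; ring.
Qed.

Lemma deriv_near (f g : R -> R) x d e : 0 < e ->
  (forall t, `|t - x| < e -> f t = g t) -> deriv f x d -> deriv g x d.
Proof.
move=> e0 h; apply: near_eq_is_derive; apply/nbhs_ballP; exists e => //= t.
by rewrite /ball/= distrC => /h.
Qed.

Lemma deriv_uniq (f : R -> R) x d d' : deriv f x d -> deriv f x d' -> d = d'.
Proof. by move=> [_ <-] [_ <-]. Qed.

Lemma deriv_continuous (f : R -> R) x d : deriv f x d -> {for x, continuous f}.
Proof. by move=> [h _]; exact/differentiable_continuous/derivable1_diffP. Qed.

Lemma continuous_eps (q : R -> R) (x : R) :
  (forall e, 0 < e -> exists2 d, 0 < d & forall z, `|z - x| <= d -> `|q z - q x| <= e) ->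
  {for x, continuous q}.
Proof.
move=> h; apply/cvgrPdist_le => e e0; have [d d0 hd] := h e e0.
apply/nbhs_ballP; exists d => //= z; rewrite /ball/= distrC => /ltW zd.
by rewrite distrC; apply: hd.
Qed.

Lemma eps_continuous (q : R -> R) (x : R) : {for x, continuous q} ->
  forall e, 0 < e -> exists2 d, 0 < d & forall z, `|z - x| <= d -> `|q z - q x| <= e.
Proof.
move=> /cvgrPdist_le h e e0; have /nbhs_ballP[d /= d0 hd] := h e e0.
exists (d / 2); first by lra.
move=> z hz; rewrite distrC; apply: hd; rewrite /ball/= distrC.
by apply: le_lt_trans hz _; lra.
Qed.

Lemma deriv_quot (f q : R -> R) (x d : R) : 0 < d ->
  (forall z, `|z - x| <= d -> f z - f x = q z * (z - x)) ->
  {for x, continuous q} -> deriv f x (q x).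
Proof.
move=> d0 h cq; apply/is_derive1_caratheodory.
(* Caratheodory's criterion asks for a slope at every [z]; beyond distance [d] the difference
   quotient itself is used. *)
exists (fun z => if `|z - x| <= d then q z else (f z - f x) / (z - x)); split.
- move=> z; case: ifPn => [/h//|hz]; rewrite divfK// subr_eq0.
  by apply: contraNneq hz => ->; rewrite subrr normr0 ltW.
- apply: continuous_eps => e e0; have [d' d'0 hd'] := eps_continuous cq e0.
  exists (Num.min d d'); first by rewrite lt_min d0.
  move=> z; rewrite le_min subrr normr0 (ltW d0) => /andP[-> hz].
  exact: hd'.
- by rewrite subrr normr0 (ltW d0).
Qed.

Lemma analytic_continuous_comp {V : finType} (g : (V -> R) -> R) (c : V -> R -> R) (x : R) :
  analytic_at (fun v => c v x) g -> (forall v, {for x, continuous (c v)}) ->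
  {for x, continuous (fun t => g (fun v => c v t))}.
Proof.
move=> ag cc; apply: continuous_eps => e e0.
have [d d0 hd] := analytic_cont ag e0.
have [d' d'0 hd'] : exists2 d', 0 < d' & forall v, forall z, `|z - x| <= d' ->
    `|c v z - c v x| <= d.
  apply: finite_radius_mono => [v s s' ss' h z zs|v]; last exact: eps_continuous (cc v) _ d0.
  exact: h (le_trans zs ss').
by exists d' => // z hz; apply: hd => v; apply: hd'.
Qed.

Definition upd {V : finType} (p : V -> R) (v : V) (t : R) : V -> R :=
  fun u => if u == v then t else p u.

Definition pd {V : finType} (g : (V -> R) -> R) (p : V -> R) (v : V) : R :=
  'D_1 (fun t : R => g (upd p v t)) (p v).

Lemma updE {V : finType} (p : V -> R) v : upd p v (p v) = p.
Proof. by apply/funext => u; rewrite /upd; case: eqP => [->|]. Qed.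

Lemma analytic_hadamard {V : finType} (p : V -> R) (g : (V -> R) -> R) : analytic_at p g ->
  exists2 r, 0 < r & exists k : V -> (V + V -> R) -> R,
    (forall v y z, cube p r y -> cube p r z -> analytic_at (twop y z) (k v)) /\
    (forall y z, cube p r y -> cube p r z ->
        g y - g z = \sum_v (y v - z v) * k v (twop y z)).
Proof.
move=> [r r0 [N [c bc gE]]].
have hr : 0 < r / 2 < r by lra.
have [k [hk1 hk2 _]] := hadamard hr bc gE.
have [d d0 hd] : exists2 d, 0 < d & forall v, forall Y, cube (twop p p) d Y ->
    analytic_at Y (k v).
  apply: finite_radius_mono => [v s s' ss' h Y hY|v]; first exact: h (cubeW ss' hY).
  by apply: analytic_shift; exists (r / 2); [lra|exists ((r - r / 2)^-1 * N)].
have m0 : 0 < Num.min d (r / 2) by rewrite lt_min d0; lra.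
exists (Num.min d (r / 2)) => //; exists k; split.
  move=> v y z hy hz; apply: hd; apply: (@cubeW _ _ _ _ (Num.min d (r / 2))).
    by rewrite ge_min lexx.
  by case=> u /=; [apply: hy|apply: hz].
by move=> y z hy hz; apply: hk2; [apply: cubeW hy|apply: cubeW hz]; rewrite ge_min lexx orbT.
Qed.

Lemma continuous_bigsum (J : Type) (s : seq J) (Q : J -> R -> R) (x : R) :
  (forall j, {for x, continuous (Q j)}) -> {for x, continuous (fun z => \sum_(j <- s) Q j z)}.
Proof.
move=> h; elim: s => [|j s ih].
  rewrite (_ : (fun z => _) = fun=> 0); first exact: cst_continuous.
  by apply/funext => z; rewrite big_nil.
rewrite (_ : (fun z => _) = fun z => Q j z + \sum_(j <- s) Q j z); last first.
  by apply/funext => z; rewrite big_cons.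
by apply: cvgD; [exact: h|exact: ih].
Qed.

(** Each curve [c v] has a continuous slope [q v] by Caratheodory; inserting these into Hadamard's
    formula exhibits [Q], a continuous slope of the composite. *)
Lemma hadamard_chain {V : finType} (r : R) (p : V -> R) (g : (V -> R) -> R)
    (k : V -> (V + V -> R) -> R) (c : V -> R -> R) (e : V -> R) (x : R) : 0 < r ->
  (forall v, analytic_at (twop p p) (k v)) ->
  (forall y z, cube p r y -> cube p r z ->
        g y - g z = \sum_v (y v - z v) * k v (twop y z)) ->
  (forall v, c v x = p v) -> (forall v, deriv (c v) x (e v)) ->
  deriv (fun t => g (fun v => c v t)) x (\sum_v k v (twop p p) * e v).
Proof.
move=> r0 ak gk cx dc.
have /choice[q hq] : forall v, exists q, [/\ forall z, c v z - c v x = q z * (z - x),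
   {for x, continuous q} & q x = e v].
  by move=> v; apply/is_derive1_caratheodory.
have cxp : (fun v => c v x) = p by apply/funext => v; rewrite cx.
have [d d0 hd] : exists2 d, 0 < d & forall v, forall z, `|z - x| <= d ->
    `|c v z - c v x| <= r.
  apply: finite_radius_mono => [v s s' ss' h z zs|v]; first exact: h (le_trans zs ss').
  exact: eps_continuous (deriv_continuous (dc v)) _ r0.
pose Q z := \sum_v k v (twop (fun v => c v z) p) * q v z.
have -> : \sum_v k v (twop p p) * e v = Q x.
  by rewrite /Q cxp; apply: eq_bigr => v _; have [_ _ ->] := hq v.
apply: (deriv_quot d0).
  move=> z hz; rewrite cxp gk; last 2 first.
  - by move=> v; rewrite -cx; apply: hd.
  - by apply: cube_refl; apply: ltW.
  rewrite /Q mulr_suml; apply: eq_bigr => v _.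
  by have [h _ _] := hq v; rewrite -cx h; ring.
apply: continuous_bigsum => v.
apply: cvgM; last by have [_ h _] := hq v.
apply: (@analytic_continuous_comp (V + V)%type (k v)
  (fun u z => twop (fun v => c v z) p u)).
  by rewrite (_ : (fun u => _) = twop p p)//; apply/funext => -[u|u] /=; rewrite ?cx.
move=> [u|u] /=; first exact: deriv_continuous (dc u).
exact: cst_continuous.
Qed.

Lemma pd_hadamard {V : finType} (r : R) (p : V -> R) (g : (V -> R) -> R)
    (k : V -> (V + V -> R) -> R) v : 0 < r ->
  (forall v, analytic_at (twop p p) (k v)) ->
  (forall y z, cube p r y -> cube p r z ->
        g y - g z = \sum_v (y v - z v) * k v (twop y z)) ->
  pd g p v = k v (twop p p).
Proof.
move=> r0 ak gk.
have dv (u : V) : deriv (fun t => upd p v t u) (p v) (u == v)%:R.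
  rewrite /upd; case: (u == v); [exact: deriv_id|exact: deriv_cst].
have h := hadamard_chain r0 ak gk (c := fun u t => upd p v t u) (x := p v)
   (e := fun u => (u == v)%:R) (fun u => congr1 (fun f => f u) (updE p v)) dv.
rewrite /pd; case: h => _; rewrite /= => ->.
rewrite (bigD1 v)//= eqxx mulr1 big1 ?addr0// => u uv.
by rewrite (negPf uv) mulr0.
Qed.

Lemma chain_rule {V : finType} (g : (V -> R) -> R) (c : V -> R -> R) (e : V -> R) (x : R) :
  analytic_at (fun v => c v x) g -> (forall v, deriv (c v) x (e v)) ->
  deriv (fun t => g (fun v => c v t)) x (\sum_v pd g (fun v => c v x) v * e v).
Proof.
move=> ag dc; have [r r0 [k [ak gk]]] := analytic_hadamard ag.
have cr := cube_refl (fun v => c v x) (ltW r0).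
have ak' v : analytic_at (twop (fun v => c v x) (fun v => c v x)) (k v) by apply: ak.
have := hadamard_chain r0 ak' gk (fun=> erefl) dc; apply: deriv_eq.
by apply: eq_bigr => v _; rewrite (pd_hadamard v r0 ak' gk).
Qed.

Lemma analytic_deriv {V : finType} (g : (V -> R) -> R) (p : V -> R) v :
  analytic_at p g -> deriv (fun t => g (upd p v t)) (p v) (pd g p v).
Proof.
move=> ag.
have dv (u : V) : deriv (fun t => upd p v t u) (p v) (u == v)%:R.
  rewrite /upd; case: (u == v); [exact: deriv_id|exact: deriv_cst].
have h := @chain_rule V g (fun u t => upd p v t u) _ (p v) _ dv.
have pE : (fun u => upd p v (p v) u) = p by rewrite -[RHS](updE p v).
rewrite pE in h; apply: deriv_eq (h ag).
rewrite (bigD1 v)//= eqxx mulr1 big1 ?addr0// => u uv.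
by rewrite (negPf uv) mulr0.
Qed.

Lemma analytic_lip {V : finType} (g : (V -> R) -> R) (p : V -> R) : analytic_at p g ->
  exists2 d, 0 < d & exists2 C, 0 <= C & forall y z, cube p d y -> cube p d z ->
    `|g y - g z| <= C * \sum_v `|y v - z v|.
Proof.
move=> ag; have [r r0 [k [ak gk]]] := analytic_hadamard ag.
have cr := cube_refl p (ltW r0).
have ak' v : analytic_at (twop p p) (k v) by apply: ak.
have [d d0 hd] : exists2 d, 0 < d & forall v, forall Y, cube (twop p p) d Y ->
    `|k v Y - k v (twop p p)| <= 1.
  apply: finite_radius_mono => [v s s' ss' h Y hY|v]; first exact: h (cubeW ss' hY).
  exact: analytic_cont (ak' v) ltr01.
have m0 : 0 < Num.min d r by rewrite lt_min d0.
(* Bounds every quotient near [(p, p)]: its absolute value there plus a variation of at most 1. *)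
pose C := 1 + \sum_v `|k v (twop p p)|.
have C0 : 0 <= C by rewrite addr_ge0// sumr_ge0.
exists (Num.min d r) => //; exists C => // y z hy hz.
rewrite gk; last 2 first.
- by apply: cubeW hy; rewrite ge_min lexx orbT.
- by apply: cubeW hz; rewrite ge_min lexx orbT.
apply: le_trans (ler_norm_sum _ _ _) _; rewrite mulr_sumr; apply: ler_sum => v _.
rewrite normrM mulrC ler_wpM2r//.
have h1 : `|k v (twop y z) - k v (twop p p)| <= 1.
  apply: hd; apply: (@cubeW _ _ _ _ (Num.min d r)); first by rewrite ge_min lexx.
  by case=> u /=; [apply: hy|apply: hz].
have h2 : `|k v (twop p p)| <= \sum_v `|k v (twop p p)|.
  by rewrite (bigD1 v)//= lerDl sumr_ge0.
have := ler_normD (k v (twop y z) - k v (twop p p)) (k v (twop p p)).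
by rewrite subrK /C; lra.
Qed.

(** The increment is [h] times the quotient at [(y + h e_v, y)], and [pd g y v] is the quotient at
    [(y, y)]; the Lipschitz bound for the quotient supplies the second factor [h]. The constants are
    uniform for [y] near [p]. *)
Lemma analytic_taylor {V : finType} (g : (V -> R) -> R) (p : V -> R) v : analytic_at p g ->
  exists2 d, 0 < d & exists2 C, 0 <= C & forall y h, cube p d y ->
    cube p d (upd y v (y v + h)) ->
    `|g (upd y v (y v + h)) - g y - h * pd g y v| <= C * h ^+ 2.
Proof.
move=> ag; have [r r0 [k [ak gk]]] := analytic_hadamard ag.
have cr := cube_refl p (ltW r0).
have [d d0 [C C0 hd]] := analytic_lip (ak v _ _ cr cr).
pose m := Num.min d (r / 2).
have m0 : 0 < m by rewrite lt_min d0; lra.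
have md : m <= d by rewrite ge_min lexx.
have mr2 : m <= r / 2 by rewrite ge_min lexx orbT.
have mr : m <= r by lra.
exists m => //; exists C => // y h hy hy'.
have hyr := cubeW mr hy.
have r20 : 0 < r / 2 by lra.
(* The quotients found at [p] also compute the partial derivatives at [y], because the cube of
   radius [r / 2] around [y] lies in the one of radius [r] around [p]. *)
have cyr z : cube y (r / 2) z -> cube p r z.
  move=> hz u; have := ler_normD (z u - y u) (y u - p u); rewrite addrA subrK.
  by have := hz u; have := cubeW mr2 hy u; lra.
rewrite (@pd_hadamard _ _ _ _ k v r20); last 2 first.
- by move=> u; apply: ak.
- by move=> a b /cyr ha /cyr hb; apply: gk.
rewrite gk//; last exact: cubeW mr hy'.
rewrite (bigD1 v)//= big1 ?addr0; last first.
  by move=> u uv; rewrite /upd (negPf uv) subrr mul0r.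
have -> : upd y v (y v + h) v - y v = h by rewrite /upd eqxx addrC addKr.
rewrite -mulrBr normrM -real_normK ?num_real// expr2 mulrCA ler_wpM2l//.
apply: le_trans (hd _ _ _ _) _.
- by case=> u /=; apply: cubeW md _ u.
- by case=> u /=; apply: cubeW md _ u.
rewrite ler_wpM2l// big_sumType/= [X in _ + X]big1 ?addr0; last first.
  by move=> u _; rewrite subrr normr0.
rewrite (bigD1 v)//= big1 ?addr0; last first.
  by move=> u uv; rewrite /upd (negPf uv) subrr normr0.
by rewrite /upd eqxx addrC addKr.
Qed.

(** The derivative is two-sided at the endpoints as well, so that the rules of differentiation apply
    there unchanged. *)
Definition primitive_on (a b : R) (g G : R -> R) : Prop :=
  forall t, Num.min a b <= t <= Num.max a b -> deriv G t (g t).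

(* Junk unless [g] has a primitive between [a] and [b]. *)
Definition Int (a b : R) (g : R -> R) : R :=
  let G := xget (fun=> 0) [set G | primitive_on a b g G] in G b - G a.

Lemma primitive_cst (a b : R) (g G H : R -> R) :
  primitive_on a b g G -> primitive_on a b g H -> G b - G a = H b - H a.
Proof.
move=> hG hH.
have hD t : Num.min a b <= t <= Num.max a b -> deriv (fun t => G t - H t) t 0.
  by move=> ht; apply: deriv_eq (derivB (hG t ht) (hH t ht)); rewrite subrr.
suff e u v : Num.min a b <= u -> u < v -> v <= Num.max a b -> G v - H v = G u - H u.
  have [ab|ba|->] := ltgtP a b; last by rewrite !subrr.
    have := e a b; rewrite (min_idPl (ltW ab)) (max_idPr (ltW ab)) !lexx => /(_ isT ab isT).
    by lra.
  have := e b a; rewrite (min_idPr (ltW ba)) (max_idPl (ltW ba)) !lexx => /(_ isT ba isT).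
  by lra.
move=> au uv vb.
have [||c _] := @MVT R (fun t => G t - H t) (fun=> 0) u v uv.
- move=> x; rewrite in_itv/= => /andP[ux xv]; apply: hD.
  by rewrite (le_trans au (ltW ux)) (le_trans (ltW xv) vb).
- apply: derivable_within_continuous => x; rewrite in_itv/= => /andP[ux xv].
  by have [] := hD x _ => //; rewrite (le_trans au ux) (le_trans xv vb).
by rewrite mul0r; lra.
Qed.

Lemma IntE (a b : R) (g G : R -> R) : primitive_on a b g G -> Int a b g = G b - G a.
Proof.
move=> hG; apply: (@primitive_cst a b g) => //.
by apply: (@xgetI _ _ [set G | primitive_on a b g G] G).
Qed.

Lemma eq_Int (a b : R) (g h : R -> R) :
  (forall t, Num.min a b <= t <= Num.max a b -> g t = h t) -> Int a b g = Int a b h.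
Proof.
move=> e; rewrite /Int (_ : [set G | primitive_on a b g G] = [set G | primitive_on a b h G])//.
by apply/seteqP; split => G hG t ht; [rewrite -e//|rewrite e//]; apply: hG.
Qed.

Lemma primitive_ex (a b : R) (g : R -> R) :
  (forall t, Num.min a b <= t <= Num.max a b -> {for t, continuous g}) ->
  exists G, primitive_on a b g G.
Proof.
set m := Num.min a b; set M := Num.max a b => cg.
have mM : m <= M by rewrite /m /M ge_min !le_max lexx.
(* Composition with the projection onto the segment extends [g] continuously to the line. The
   fundamental theorem on [[m - 1, M + 1]] then gives two-sided derivatives at [m] and [M]. *)
pose cl t := Num.max m (Num.min t M).
have clE t : m <= t <= M -> cl t = t.
  by move=> /andP[mt tM]; rewrite /cl (min_idPl tM) (max_idPr mt).
have clin t : m <= cl t <= M.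
  by rewrite /cl le_max lexx/= ge_max mM ge_min lexx orbT.
have lip t t' : `|cl t - cl t'| <= `|t - t'|.
  have cl3 x : [\/ x <= m /\ cl x = m, m <= x <= M /\ cl x = x | M <= x /\ cl x = M].
    have [xm|mx] := leP x m.
      by constructor 1; split => //; rewrite /cl (min_idPl (le_trans xm mM)) (max_idPl xm).
    have [xM|Mx] := leP x M.
      by constructor 2; rewrite clE (ltW mx).
    by constructor 3; split; [exact: ltW|rewrite /cl (min_idPr (ltW Mx)) (max_idPr mM)].
  have := ler_norm (t - t'); have := ler_norm (t' - t); rewrite (distrC t').
  move=> n1 n2; rewrite ler_norml.
  case: (cl3 t) => -[h1 ->]; case: (cl3 t') => -[h2 ->]; apply/andP; split; lra.
pose h t := g (cl t).
have ch t : {for t, continuous h}.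
  apply: continuous_eps => e e0; have [d d0 hd] := eps_continuous (cg _ (clin t)) e0.
  by exists d => // z hz; apply: hd; apply: le_trans (lip _ _) hz.
pose F y := (\int[@lebesgue_measure R]_(t in [set` `[m - 1, y]%R]) h t)%R.
exists F => t; rewrite -/m -/M => ht; have /andP[mt tM] := ht.
have tM1 : t < M + 1 by lra.
have [] := @continuous_FTC1_closed R h (m - 1) t (M + 1) tM1 _ _ (ch t).
- apply: continuous_compact_integrable; first exact: segment_compact.
  by apply: continuous_subspaceT => x; apply: ch.
- by lra.
by rewrite derive1E -/F => dF e; split => //; rewrite e /h clE.
Qed.

Lemma primitive_sub (a b c d : R) (g G : R -> R) : Num.min a b <= Num.min c d ->
  Num.max c d <= Num.max a b -> primitive_on a b g G -> primitive_on c d g G.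
Proof.
move=> h1 h2 h t /andP[ct td]; apply: h.
by rewrite (le_trans h1 ct) (le_trans td h2).
Qed.

Lemma IntZ (a b k : R) (g : R -> R) : (exists G, primitive_on a b g G) ->
  Int a b (fun t => k * g t) = k * Int a b g.
Proof.
move=> [G hG]; rewrite (IntE hG) (@IntE _ _ _ (fun t => k * G t)) ?mulrBr// => t ht.
exact: derivZ (hG t ht).
Qed.

Lemma IntD (a b : R) (g h : R -> R) : (exists G, primitive_on a b g G) ->
  (exists H, primitive_on a b h H) ->
  Int a b (fun t => g t + h t) = Int a b g + Int a b h.
Proof.
move=> [G hG] [H hH]; rewrite (IntE hG) (IntE hH) (@IntE _ _ _ (fun t => G t + H t)).
  by ring.
by move=> t ht; apply: derivD (hG t ht) (hH t ht).
Qed.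

Lemma IntB (a b : R) (g h : R -> R) : (exists G, primitive_on a b g G) ->
  (exists H, primitive_on a b h H) ->
  Int a b (fun t => g t - h t) = Int a b g - Int a b h.
Proof.
move=> [G hG] [H hH]; rewrite (IntE hG) (IntE hH) (@IntE _ _ _ (fun t => G t - H t)).
  by ring.
by move=> t ht; apply: derivB (hG t ht) (hH t ht).
Qed.

Lemma Int_gt0 (a b : R) (g : R -> R) : a < b -> (exists G, primitive_on a b g G) ->
  (forall t, a < t < b -> 0 < g t) -> 0 < Int a b g.
Proof.
move=> ab [G hG] g0; rewrite (IntE hG).
have hG' t : a <= t <= b -> deriv G t (g t).
  by move=> ht; apply: hG; rewrite (min_idPl (ltW ab)) (max_idPr (ltW ab)).
have [||c] := @MVT R G g a b ab.
- by move=> x; rewrite in_itv/= => /andP[ux xv]; apply: hG'; rewrite !ltW.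
- apply: derivable_within_continuous => x; rewrite in_itv/= => hx.
  by have [] := hG' x hx.
by rewrite in_itv/= => /g0 gc ->; rewrite mulr_gt0// subr_gt0.
Qed.

Lemma Int_chasles (a b c : R) (g : R -> R) : a <= b <= c -> 
  (exists G, primitive_on a c g G) -> Int a c g = Int a b g + Int b c g.
Proof.
move=> /andP[ab bc] [G hG]; have ac := le_trans ab bc.
rewrite (IntE hG) (@IntE a b g G) ?(@IntE b c g G); first by ring.
- apply: primitive_sub hG; rewrite ?(min_idPl ab) ?(min_idPl ac) ?(min_idPl bc)//.
  by rewrite (max_idPr bc) (max_idPr ac).
- apply: primitive_sub hG; rewrite ?(min_idPl ab) ?(min_idPl ac) ?(min_idPl bc)//.
  by rewrite (max_idPr ab) (max_idPr ac).
Qed.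

(** Compactness of the segment as a supremum argument: at the supremum of the [t] with [P a t], the
    local hypothesis carries [P a] further, unless [b] is reached. *)
Lemma segment_induction (P : R -> R -> Prop) (a b : R) : a <= b ->
  (forall s t u, s <= t <= u -> P s t -> P t u -> P s u) ->
  (forall s, a <= s <= b -> exists2 d, 0 < d & forall t u, s - d <= t -> t <= u ->
    u <= s + d -> a <= t -> u <= b -> P t u) -> P a b.
Proof.
move=> ab Ptr Ploc.
pose S := [set t | a <= t <= b /\ P a t].
have Sa : S a.
  split; first by rewrite lexx ab.
  have [|d d0 h] := Ploc a; first by rewrite lexx ab.
  by apply: h => //; lra.
have hS : has_sup S by split; [exists a|exists b => t [/andP[]]].
have aS : a <= sup S by apply: sup_upper_bound.
have Sb : sup S <= b by apply: ge_sup; [exists a|move=> t [/andP[]]].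
have [|d d0 h] := Ploc (sup S); first by rewrite aS.
have [t [/andP[at' tb] Pt] tS] := sup_adherent d0 hS.
have tsup : t <= sup S by apply: sup_upper_bound => //; split => //; rewrite at'.
pose t' := Num.min b (sup S + d).
have t't : t <= t' by rewrite le_min tb; lra.
have Pt' : P a t'.
  apply: (Ptr _ t) => //; first by rewrite at'.
  by apply: h => //; rewrite ?ge_min ?lexx ?orbT//; lra.
have : t' <= sup S.
  by apply: sup_upper_bound => //; split => //; rewrite (le_trans at' t't) ge_min lexx.
rewrite ge_min => /orP[bS|]; last by lra.
by move: Pt'; rewrite /t' (min_idPl _)//; lra.
Qed.

End Calculus.

(** * Analytic dependence of integrals on parameters; elementary functions *)

Section ParametricIntegrals.
Context {R : realType}.

Notation deriv f x d := (is_derive (x : R) (1 : R) (f : R -> R) (d : R)).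

(** The integration variable is one more coordinate, with index [None], so that joint analyticity is
    again [analytic_at]. *)
Definition ocons {V : finType} (s : R) (x : V -> R) : option V -> R :=
  fun o => if o is Some v then x v else s.

Definition un2 {V : finType} (g : R -> (V -> R) -> R) (y : option V -> R) : R :=
  g (y None) (fun v => y (Some v)).

Definition analytic2 {V : finType} (g : R -> (V -> R) -> R) (s : R) (x : V -> R) : Prop :=
  analytic_at (ocons s x) (un2 g).

Lemma upd_ocons {V : finType} (s t : R) (x : V -> R) : upd (ocons s x) None t = ocons t x.
Proof. by apply/funext => -[]. Qed.

Lemma cube_ocons {V : finType} (s t r : R) (x y : V -> R) :
  `|t - s| <= r -> cube x r y -> cube (ocons s x) r (ocons t y).
Proof. by move=> h1 h2 [v|] /=; [exact: h2|]. Qed.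

Lemma analytic2_continuous {V : finType} (g : R -> (V -> R) -> R) s x :
  analytic2 g s x -> {for s, continuous (g^~ x)}.
Proof.
move=> h; apply: (@analytic_continuous_comp _ _ (un2 g) (fun o t => ocons t x o)) => //.
case=> [v|] /=; first exact: cst_continuous.
exact: (deriv_continuous (deriv_id s)).
Qed.

(** Term by term: a word [w] with [m] letters [None] has the primitive [None :: w] divided by
    [m + 1]. The derivative of the sum is read off the diagonal of its Hadamard quotient by
    [dquo_diag]. *)
Lemma analytic2_primitive {V : finType} (g : R -> (V -> R) -> R) s x : analytic2 g s x ->
  exists2 d, 0 < d & exists P : (option V -> R) -> R, forall Y, cube (ocons s x) d Y ->
   [/\ analytic_at Y P, analytic_at Y (un2 g) &
    deriv (fun t => P (upd Y None t)) (Y None) (un2 g Y)].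
Proof.
move=> ag; have [r r0 [N [c bc gE]]] := ag; set p := ocons s x in bc gE ag *.
pose c' (w : seq (option V)) := c w / (count_mem None w).+1%:R.
pose P y := tot (fun w => c' w * \prod_(o <- None :: w) (y o - p o)).
have bc' : bnd (fun w => c' w * r ^+ size (None :: w)) (r * N).
  have := bndZ r bc; rewrite (ger0_norm (ltW r0)); apply: bnd_le => w.
  rewrite /= exprS mulrCA normrM [leRHS]normrM ler_wpM2l//.
  rewrite normrM [leRHS]normrM ler_wpM2r// /c' normrM ler_piMr// normfV invf_le1 ?normr_gt0//.
  by rewrite ger0_norm// ler1n.
have hr : 0 < r / 2 < r by lra.
have [k [hk1 hk2 hk3]] := hadamard hr bc' (fun y _ => erefl (P y)).
have aP : analytic_at p P by exists r => //; exists (r * N); apply: inB_fam.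
have [d1 d10 h1] := analytic_shift aP.
have [d2 d20 h2] := analytic_shift ag.
have [d3 d30 h3] : exists2 d, 0 < d & forall v, forall Y, cube (twop p p) d Y ->
    analytic_at Y (k v).
  apply: finite_radius_mono => [v e e' ee' h Y hY|v]; first exact: h (cubeW ee' hY).
  by apply: analytic_shift; exists (r / 2); [lra|exists ((r - r / 2)^-1 * (r * N))].
pose d := Num.min (Num.min d1 d2) (Num.min d3 (r / 4)).
have d0 : 0 < d by rewrite !lt_min d10 d20 d30; lra.
exists d => //; exists P => Y hY.
have dd1 : d <= d1 by rewrite /d !ge_min lexx.
have dd2 : d <= d2 by rewrite /d !ge_min lexx ?orbT.
have dd3 : d <= d3 by rewrite /d !ge_min lexx ?orbT.
have dr : d <= r / 4 by rewrite /d !ge_min lexx ?orbT.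
have aPY := h1 _ (cubeW dd1 hY).
split => //; first exact: h2 (cubeW dd2 hY).
apply: deriv_eq (analytic_deriv None aPY).
have r40 : 0 < r / 4 by lra.
have cYr z : cube Y (r / 4) z -> cube p (r / 2) z.
  move=> hz u; have := ler_normD (z u - Y u) (Y u - p u); rewrite addrA subrK.
  by have := hz u; have := cubeW dr hY u; lra.
rewrite (@pd_hadamard _ _ _ _ _ k None r40); last 2 first.
- by move=> v; apply: h3; case=> u /=; exact: cubeW dd3 hY u.
- by move=> y z /cYr hy /cYr hz; apply: hk2.
rewrite hk3 gE; last by apply: cubeW hY; lra.
apply: eq_tot => w; rewrite dquo_diag /c' mulrA divfK ?pnatr_eq0//.
Qed.

(** Near a point of the segment the integral is a difference of two values of the joint primitive,
    hence analytic in the parameters; [segment_induction] glues the pieces. The common neighbourhood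
    of [p] is carried along because additivity of the integral needs continuity for all nearby
    parameters. *)
Lemma analytic_Int {V : finType} (g : R -> (V -> R) -> R) (a b : R) (p : V -> R) : a <= b ->
  (forall s, a <= s <= b -> analytic2 g s p) ->
  (exists2 d, 0 < d & forall x s, cube p d x -> a <= s <= b -> analytic2 g s x) /\
  analytic_at p (fun x => Int a b (g^~ x)).
Proof.
move=> ab hg.
pose P s1 s2 := (exists2 d, 0 < d & forall x s, cube p d x -> s1 <= s <= s2 -> analytic2 g s x)
  /\ analytic_at p (fun x => Int s1 s2 (g^~ x)).
apply: (@segment_induction _ P a b ab).
  move=> s t u /andP[st tu] [[d d0 hd] h1] [[e e0 he] h2].
  have m0 : 0 < Num.min d e by rewrite lt_min d0.
  have hm x v : cube p (Num.min d e) x -> s <= v <= u -> analytic2 g v x.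
    move=> hx /andP[sv vu]; have [vt|tv] := leP v t.
      by apply: hd; [apply: cubeW hx; rewrite ge_min lexx|rewrite sv].
    by apply: he; [apply: cubeW hx; rewrite ge_min lexx orbT|rewrite vu ltW].
  split; first by exists (Num.min d e).
  apply: (analytic_near m0 _ (analytic_add h1 h2)) => x hx.
  rewrite (@Int_chasles _ s t u) ?st//; apply: primitive_ex => v.
  rewrite (min_idPl (le_trans st tu)) (max_idPr (le_trans st tu)) => hv.
  exact/analytic2_continuous/hm.
move=> s hs; have [d d0 [Q hQ]] := analytic2_primitive (hg s hs).
exists d => // t u st tu us _ _.
have hts v : t <= v <= u -> `|v - s| <= d.
  by move=> /andP[tv vu]; rewrite ler_norml; apply/andP; split; lra.
split.
  exists d => // x v hx hv.
  by have [] := hQ (ocons v x) (cube_ocons (hts v hv) hx).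
apply: (@analytic_near _ _ _ (fun x => Q (ocons u x) - Q (ocons t x)) _ d) => //.
  move=> x hx; rewrite (@IntE _ _ _ _ (fun v => Q (ocons v x)))// => v.
  rewrite (min_idPl tu) (max_idPr tu) => hv.
  have [_ _] := hQ (ocons v x) (cube_ocons (hts v hv) hx).
  by rewrite /un2 /= (_ : (fun t => _) = fun v => Q (ocons v x))//; apply/funext => w;
    rewrite upd_ocons.
have aQ v : t <= v <= u -> analytic_at p (fun x => Q (ocons v x)).
  move=> hv; apply: (@analytic_comp _ _ _ p Q (fun o y => ocons v y o)).
    by case=> [w|] /=; [exact: analytic_var|exact: analytic_cst].
  have [|+ _ _] := hQ (ocons v p) => //.
  by apply: cube_ocons; [exact: hts|apply: cube_refl; exact: ltW].
by apply: analytic_sub; apply: aQ; rewrite lexx tu.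
Qed.

Definition analyticR (g : R -> R) (t : R) : Prop :=
  analytic_at (fun _ : unit => t) (fun y => g (y tt)).

Lemma analyticR_comp {V : finType} (p : V -> R) h (g : (V -> R) -> R) :
  analyticR h (g p) -> analytic_at p g -> analytic_at p (fun y => h (g y)).
Proof.
move=> ah ag.
exact: (@analytic_comp _ _ _ p (fun y : unit -> R => h (y tt)) (fun _ => g)).
Qed.

Lemma analyticR_continuous g t : analyticR g t -> {for t, continuous g}.
Proof.
move=> h; apply: (@analytic_continuous_comp _ _ (fun y : unit -> R => g (y tt)) (fun _ t => t)) => //.
by move=> _; exact: (deriv_continuous (deriv_id t)).
Qed.

(** The difference quotient in the parameter, completed by the derivative at [t0], is jointly
    analytic by Hadamard's lemma. Its integral is therefore continuous in the parameter, and it is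
    the slope of the given integral. *)
Lemma Int_deriv (g : R -> R -> R) (a b t0 : R) : a <= b ->
  (forall s, a <= s <= b -> analytic2 (fun s (x : unit -> R) => g s (x tt)) s (fun=> t0)) ->
  (exists G, primitive_on a b (fun s => 'D_1 (g s) t0) G) /\
  deriv (fun t => Int a b (g^~ t)) t0 (Int a b (fun s => 'D_1 (g s) t0)).
Proof.
move=> ab hg.
pose G := (fun s (x : unit -> R) => g s (x tt)).
pose k s t := if t == t0 then 'D_1 (g s) t0 else (g s t - g s t0) / (t - t0).
pose K := (fun s (x : unit -> R) => k s (x tt)).
have hK s : a <= s <= b -> analytic2 K s (fun=> t0).
  move=> hs; have [r r0 [q [aq gq]]] := analytic_hadamard (hg s hs).
  (* Between [Y] and its projection [Z Y] onto the parameter value [t0], Hadamard's formula has a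
     single term. Its quotient is [K], also where the two points coincide. *)
  pose Z (Y : option unit -> R) := upd Y (Some tt) t0.
  have Y0r := cube_refl (ocons s (fun _ : unit => t0)) (ltW r0).
  have r20 : 0 < r / 2 by lra.
  apply: (@analytic_near _ _ _ (fun Y => q (Some tt) (twop Y (Z Y))) _ (r / 2)) => //.
    move=> Y hY; have hYr : cube (ocons s (fun=> t0)) r Y by apply: cubeW hY; lra.
    have hZr : cube (ocons s (fun=> t0)) r (Z Y).
      case=> [[]|]; first by rewrite /Z /upd /= subrr normr0 ltW.
      exact: hYr None.
    have := gq _ _ hYr hZr; rewrite (bigD1 (Some tt))//= big1 ?addr0; last first.
      by case=> [[]|]//= _; rewrite /Z /upd /= subrr mul0r.
    rewrite {1}/un2 /Z {1 2}/upd /= => e.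
    rewrite /un2 /K /k; case: eqP => [Yt0|/eqP Yt0]; last first.
      by rewrite e [RHS]mulrC mulKf// subr_eq0.
    have ZY : upd Y (Some tt) t0 = Y by rewrite -Yt0 updE.
    rewrite ZY.
    have cYr z : cube Y (r / 2) z -> cube (ocons s (fun=> t0)) r z.
      move=> hz u; have := ler_normD (z u - Y u) (Y u - ocons s (fun=> t0) u).
      by rewrite addrA subrK; have := hz u; have := hY u; lra.
    rewrite -(@pd_hadamard _ _ _ _ (un2 G) q (Some tt) r20); last 2 first.
    - by move=> v; apply: aq.
    - by move=> y z /cYr hy /cYr hz; apply: gq.
    by rewrite /pd Yt0.
  apply: (@analytic_comp _ _ _ _ (q (Some tt)) (fun u Y => twop Y (Z Y) u)); last first.
    by apply: aq => //; case=> [[]|]; rewrite /Z /upd /= subrr normr0 ltW.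
  case=> [u|[[]|]] /=; rewrite /Z /upd /=; try exact: analytic_var.
  exact: analytic_cst.
have [[d d0 hd] aK] := analytic_Int ab hK.
have [[d' d'0 hd'] _] := analytic_Int ab hg.
have kE s t : g s t - g s t0 = (t - t0) * k s t.
  by rewrite /k; case: eqP => [->|/eqP h]; rewrite ?subrr ?mul0r// mulrC divfK// subr_eq0.
have ct0 : cube (fun _ : unit => t0) d (fun=> t0) by apply: cube_refl; exact: ltW.
have ex_k t : `|t - t0| <= d -> exists G, primitive_on a b (k^~ t) G.
  move=> ht; apply: primitive_ex => s; rewrite (min_idPl ab) (max_idPr ab) => hs.
  by apply: (analytic2_continuous (hd (fun=> t) s _ hs)) => -[].
have ex_g t : `|t - t0| <= d' -> exists G, primitive_on a b (g^~ t) G.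
  move=> ht; apply: primitive_ex => s; rewrite (min_idPl ab) (max_idPr ab) => hs.
  by apply: (analytic2_continuous (hd' (fun=> t) s _ hs)) => -[].
have kt0 : k^~ t0 = fun s => 'D_1 (g s) t0 by apply/funext => s; rewrite /k eqxx.
split.
  by rewrite -kt0; apply: ex_k; rewrite subrr normr0 ltW.
rewrite -kt0.
apply: (@deriv_quot _ _ (fun t => Int a b (k^~ t)) _ (Num.min d d')).
- by rewrite lt_min d0.
- move=> t; rewrite le_min => /andP[td td'].
  rewrite -IntB; [|exact: ex_g|by apply: ex_g; rewrite subrr normr0 ltW].
  by rewrite mulrC -(IntZ _ (ex_k t td)); apply: eq_Int => s _; exact: kE.
- exact: (@analyticR_continuous (fun t => Int a b (k^~ t))).
Qed.

Lemma analyticR_pseries (h : R -> R) (a : nat -> R) t0 r N : 0 < r ->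
  bnd (fun k => a k * r ^+ k) N ->
  (forall u, `|u| <= r -> (fun n => \sum_(k < n) a k * u ^+ k) @ \oo --> h (t0 + u)) ->
  analyticR h t0.
Proof.
move=> r0 ba hh; exists r => //; exists N.
apply: (@eq_inB _ _ _ _ _ (fun y : unit -> R => tot (fun k =>
   a k * \prod_(x <- nseq k tt) (y x - t0)))); last first.
  by apply: inB_fam => //; apply: bnd_le ba => k; rewrite size_nseq.
move=> y hy; have yr : `|y tt - t0| <= r by exact: hy.
rewrite (eq_tot (v := fun k => a k * (y tt - t0) ^+ k)); last first.
  by move=> k; rewrite big_nseq iter_mulr_1.
have bu : bnd (fun k => a k * (y tt - t0) ^+ k) N.
  apply: bnd_le ba => k; rewrite !normrM ler_wpM2l// !normrX (ger0_norm (ltW r0)).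
  by rewrite lerXn2r ?nnegrE// ltW.
have := hh _ yr; rewrite (addrC t0) subrK => h1.
exact: (cvg_unique _ (tot_series bu) h1).
Qed.

Lemma bnd_exp (a : nat -> R) : (forall k, `|a k| <= (k`!%:R)^-1) ->
  exists N, bnd (fun k => a k * 1 ^+ k) N.
Proof.
move=> ha.
have [N hN] : exists N, bnd (fun k => (k`!%:R)^-1 : R) N.
  apply: bnd_cvg_series; have := @is_cvg_series_exp_coeff R 1.
  rewrite (_ : series _ = fun n => \sum_(k < n) `|(k`!%:R)^-1 : R|)//.
  apply/funext => n; rewrite /series/= big_mkord; apply: eq_bigr => k _.
  by rewrite /exp_coeff /= expr1n mul1r ger0_norm.
by exists N; apply: bnd_le hN => k; rewrite expr1n mulr1 [leRHS]ger0_norm.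
Qed.

Lemma analyticR_shift (h : R -> R) t0 : analyticR h 0 -> analyticR (fun t => h (t - t0)) t0.
Proof.
move=> a; apply: (@analyticR_comp _ _ h (fun y : unit -> R => y tt - t0)).
  by rewrite subrr.
by apply: analytic_sub; [exact: analytic_var|exact: analytic_cst].
Qed.

(** Only the series at 0 is used, with radius 1; the addition formula carries it to [t0]. The sine
    and the cosine are treated in the same way. *)
Lemma analyticR_expR t0 : analyticR expR t0.
Proof.
have a0 : analyticR (@expR R) 0.
  have [N hN] := @bnd_exp (fun k => (k`!%:R)^-1) (fun k => ltac:(by rewrite ger0_norm)).
  apply: (analyticR_pseries ltr01 hN) => u _; rewrite add0r.
  have := @is_cvg_series_exp_coeff R u; rewrite /expR /series/= exp_coeffE.
  by under eq_fun do rewrite big_mkord.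
apply: eq_analytic (analytic_scale (expR t0) (analyticR_shift t0 a0)) => y.
by rewrite -expRD addrC subrK.
Qed.

Lemma fact_coeff_le (b : R) k : `|b| <= 1 -> `|b * (k`!%:R)^-1| <= (k`!%:R)^-1.
Proof. by move=> h; rewrite normrM [X in _ * X]ger0_norm// ler_piMl. Qed.

Lemma analyticR_sin t0 : analyticR sin t0 /\ analyticR cos t0.
Proof.
have as0 : analyticR (@sin R) 0.
  have [|N hN] := @bnd_exp (fun k => (odd k)%:R * (-1) ^+ k.-1./2 * (k`!%:R)^-1).
    move=> k; apply: fact_coeff_le; rewrite normrM normrX normrN1 expr1n mulr1.
    by case: odd; rewrite ?normr1 ?normr0.
  apply: (analyticR_pseries ltr01 hN) => u _; rewrite add0r.
  have := @is_cvg_series_sin_coeff R u; rewrite sin.unlock /series/= sin_coeffE.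
  by under eq_fun do rewrite big_mkord.
have ac0 : analyticR (@cos R) 0.
  have [|N hN] := @bnd_exp (fun k => (~~ odd k)%:R * (-1) ^+ k./2 * (k`!%:R)^-1).
    move=> k; apply: fact_coeff_le; rewrite normrM normrX normrN1 expr1n mulr1.
    by case: odd; rewrite ?normr1 ?normr0.
  apply: (analyticR_pseries ltr01 hN) => u _; rewrite add0r.
  have := @is_cvg_series_cos_coeff R u; rewrite cos.unlock /series/= cos_coeffE.
  by under eq_fun do rewrite big_mkord.
have s1 := analyticR_shift t0 as0; have c1 := analyticR_shift t0 ac0; split.
  apply: eq_analytic (analytic_add (analytic_scale (sin t0) c1) (analytic_scale (cos t0) s1)) => y.
  by rewrite -sinD addrC subrK.
apply: eq_analytic (analytic_sub (analytic_scale (cos t0) c1) (analytic_scale (sin t0) s1)) => y.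
by rewrite -cosD addrC subrK.
Qed.

Lemma analyticR_inv t0 : t0 != 0 -> analyticR (fun t => t^-1) t0.
Proof.
move=> t00; have r0 : 0 < `|t0| / 2 by rewrite divr_gt0// normr_gt0.
pose a k : R := t0^-1 * (- t0^-1) ^+ k.
apply: (@analyticR_pseries _ a _ (`|t0| / 2) (`|t0|^-1 * 2)) => //.
  apply: bnd_series => n.
  have -> : \sum_(k < n) `|a k * (`|t0| / 2) ^+ k| = `|t0|^-1 * \sum_(k < n) (2^-1) ^+ k.
    rewrite mulr_sumr; apply: eq_bigr => k _.
    rewrite /a !normrM normfV -mulrA -normrM -exprMn normrX; congr (_ * _ ^+ _).
    rewrite normrM normrN normfV normrM normr_id mulKf ?normr_eq0// ger0_norm//.
  rewrite ler_wpM2l// ?invr_ge0//.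
  have -> : \sum_(k < n) (2^-1 : R) ^+ k = 2 - 2 * (2^-1) ^+ n.
    elim: n => [|n ih]; first by rewrite big_ord0 expr0; lra.
    by rewrite big_ord_recr/= ih exprS; lra.
  by rewrite lerBlDr lerDl mulr_ge0// exprn_ge0// invr_ge0.
move=> u hu.
have z1 : `|- t0^-1 * u| < 1.
  rewrite normrM normrN normfV mulrC ltr_pdivrMr ?normr_gt0// mul1r.
  by apply: le_lt_trans hu _; move: r0; lra.
have := @cvg_geometric_series R t0^-1 (- t0^-1 * u) z1.
have -> : t0^-1 * (1 - - t0^-1 * u)^-1 = (t0 + u)^-1.
  rewrite -invfM; congr (_^-1); rewrite mulrBr mulr1 mulNr mulrN opprK.
  by rewrite mulrA mulfV// mul1r.
rewrite (_ : series _ = fun n => \sum_(k < n) a k * u ^+ k)//.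
apply/funext => n; rewrite /series/= big_mkord; apply: eq_bigr => k _.
by rewrite /a exprMn mulrA.
Qed.

(** For [t] near [t0], [ln t - ln t0] is the integral over [0 <= s <= 1] of
    [(t - t0) / (t0 + s (t - t0))], so the claim follows from the analyticity of the inverse by
    [analytic_Int]. *)
Lemma analyticR_ln t0 : 0 < t0 -> analyticR (@ln R) t0.
Proof.
move=> t00.
pose g s (x : unit -> R) := (x tt - t0) / (t0 + s * (x tt - t0)).
have [||_ aI] := @analytic_Int unit g 0 1 (fun=> t0) => //.
  move=> s _; rewrite /analytic2 /un2 /g.
  have av : analytic_at (ocons s (fun _ : unit => t0)) (fun y => y (Some tt) - t0).
    by apply: analytic_sub; [exact: analytic_var|exact: analytic_cst].
  apply: analytic_mul => //.
  apply: (@analyticR_comp _ _ (fun t => t^-1) (fun y => t0 + y None * (y (Some tt) - t0))).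
    by apply: analyticR_inv; rewrite /= subrr mulr0 addr0 gt_eqF.
  apply: analytic_add; first exact: analytic_cst.
  by apply: analytic_mul => //; exact: analytic_var.
have t20 : 0 < t0 / 2 by lra.
apply: (analytic_near t20 _ (analytic_add (analytic_cst _ (ln t0)) aI)) => y hy.
have := hy tt; rewrite ler_norml => hyt.
rewrite (@IntE _ _ _ _ (fun s => ln (t0 + s * (y tt - t0)))).
  by rewrite mul0r addr0 mul1r (addrC t0) subrK addrC subrK.
move=> s; rewrite (min_idPl ler01) (max_idPr ler01) => /andP[s0 s1].
have pos : 0 < t0 + s * (y tt - t0) by case/andP: hyt => ? ?; nra.
have h1 : deriv (fun s => t0 + s * (y tt - t0)) s (y tt - t0).
  apply: deriv_eq (derivD (deriv_cst _ _) (derivM (deriv_id s) (deriv_cst (y tt - t0) s))).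
  by rewrite mul1r mulr0 addr0 add0r.
have h2 := @deriv_comp R (@ln R) (fun s => t0 + s * (y tt - t0)) s _ _
  (is_derive1_ln pos) h1.
by apply: deriv_eq h2; rewrite /g mulrC.
Qed.

Lemma analyticR_sqrt t0 : 0 < t0 -> analyticR Num.sqrt t0.
Proof.
move=> t00; have t20 : 0 < t0 / 2 by lra.
apply: (@analytic_near _ _ _ (fun y : unit -> R => expR (2^-1 * ln (y tt))) _ (t0 / 2)) => //.
  move=> y hy; have := hy tt; rewrite ler_norml => hyt.
  have y0 : 0 < y tt by case/andP: hyt => ? ?; lra.
  by rewrite -powR12_sqrt ?ltW// /powR gt_eqF.
apply: (@analyticR_comp _ _ expR (fun y : unit -> R => 2^-1 * ln (y tt))).
  exact: analyticR_expR.
by apply: analytic_scale; exact: analyticR_ln.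
Qed.

End ParametricIntegrals.

(** * Rotations in coordinate planes and weighted integrals over them *)

Section Rotations.
Context {R : realType}.

Notation deriv f x d := (is_derive (x : R) (1 : R) (f : R -> R) (d : R)).

Definition nsq {V : finType} (x : V -> R) : R := \sum_v x v ^+ 2.

Definition analytic0 {V : finType} (F : (V -> R) -> R) : Prop :=
  forall x, 0 < nsq x -> analytic_at x F.

Section RotV.
Variable V : finType.
Implicit Types (a b c d v : V) (x : V -> R) (Q : (V -> R) -> R).

Definition rot a b (t : R) x : V -> R := fun k =>
  if k == a then cos t * x a - sin t * x b
  else if k == b then sin t * x a + cos t * x b else x k.

(** The velocity at angle 0 of the rotations [rot a b]. *)
Definition gen a b x : V -> R := fun k =>
  if k == a then - x b else if k == b then x a else 0.

Definition inv a b Q : Prop := forall x t, 0 < nsq x -> Q (rot a b t x) = Q x.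

Lemma rotE_l a b t x : rot a b t x a = cos t * x a - sin t * x b.
Proof. by rewrite /rot eqxx. Qed.

Lemma rotE_r a b t x : b != a -> rot a b t x b = sin t * x a + cos t * x b.
Proof. by move=> /negPf h; rewrite /rot h eqxx. Qed.

Lemma rot0 a b x : rot a b 0 x = x.
Proof.
apply/funext => k; rewrite /rot cos0 sin0 !mul1r !mul0r subr0 add0r.
by case: eqP => [->//|_]; case: eqP => [->|].
Qed.

Lemma rotD a b s t x : b != a -> rot a b s (rot a b t x) = rot a b (s + t) x.
Proof.
move=> ba; apply/funext => k; case: (eqVneq k a) => [->|ka].
  by rewrite !rotE_l rotE_r// cosD sinD; ring.
case: (eqVneq k b) => [->|kb]; first by rewrite !rotE_r// rotE_l cosD sinD; ring.
by rewrite /rot (negPf ka) (negPf kb).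
Qed.

Lemma rotC a b c d s t x : c != a -> c != b -> d != a -> d != b ->
  rot a b s (rot c d t x) = rot c d t (rot a b s x).
Proof.
move=> /negPf ca /negPf cb /negPf da /negPf db.
apply/funext => k; rewrite /rot ca cb da db.
rewrite ![a == _]eq_sym ![b == _]eq_sym ca cb da db.
case: (eqVneq k a) => [->|_].
  by rewrite eq_sym ca eq_sym da.
case: (eqVneq k b) => [->|_] //.
by rewrite eq_sym cb eq_sym db.
Qed.

Lemma rotZ a b t l x : rot a b t (fun v => l * x v) = fun v => l * rot a b t x v.
Proof.
by apply/funext => k; rewrite /rot; case: eqP => _; [ring|case: eqP => _//; ring].
Qed.

Lemma nsq_rot a b t x : b != a -> nsq (rot a b t x) = nsq x.
Proof.
move=> ba; rewrite /nsq (bigD1 a)//= (bigD1 b)//= [RHS](bigD1 a)//= [in RHS](bigD1 b)//=.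
rewrite rotE_l rotE_r// !addrA; congr (_ + _).
  have := cos2Dsin2 t; set C := cos t; set S := sin t => h.
  have -> : (C * x a - S * x b) ^+ 2 + (S * x a + C * x b) ^+ 2 =
     (C ^+ 2 + S ^+ 2) * (x a ^+ 2 + x b ^+ 2) by ring.
  by rewrite h mul1r.
apply: eq_bigr => k /andP[/negPf ka /negPf kb].
by rewrite /rot ka kb.
Qed.

Lemma rot_2pi a b x : rot a b (pi *+ 2) x = x.
Proof.
apply/funext => k; rewrite /rot cos2pi sin2pi !mul1r !mul0r subr0 add0r.
by case: eqP => [->//|_]; case: eqP => [->|].
Qed.

Lemma deriv_rot_angle a b t x v : b != a ->
  deriv (fun t => rot a b t x v) t (gen a b (rot a b t x) v).
Proof.
move=> ba; rewrite /gen rotE_l rotE_r// /rot.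
have dc := is_derive_cos t; have ds := is_derive_sin t.
case: eqP => _; last case: eqP => _; last exact: deriv_cst.
- apply: deriv_eq (derivB (derivM dc (deriv_cst (x a) t)) (derivM ds (deriv_cst (x b) t))).
  by ring.
- apply: deriv_eq (derivD (derivM ds (deriv_cst (x a) t)) (derivM dc (deriv_cst (x b) t))).
  by ring.
Qed.

Lemma deriv_rot a b s (u : V -> R -> R) e t v : (forall k, deriv (u k) t (e k)) ->
  deriv (fun t => rot a b s (fun k => u k t) v) t (rot a b s e v).
Proof.
move=> h; rewrite /rot; case: eqP => _; last case: eqP => _ //.
- by apply: derivB; apply: derivZ.
- by apply: derivD; apply: derivZ.
Qed.

Lemma analytic_rot {V' : finType} (p : V' -> R) a b (th : (V' -> R) -> R)
    (u : V -> (V' -> R) -> R) v : analytic_at p th -> (forall k, analytic_at p (u k)) ->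
  analytic_at p (fun y => rot a b (th y) (fun k => u k y) v).
Proof.
move=> ath au.
have [as_ ac] := analyticR_sin (th p).
have ac' := analyticR_comp ac ath; have as' := analyticR_comp as_ ath.
rewrite /rot; case: eqP => _; last case: eqP => _ //.
- by apply: analytic_sub; apply: analytic_mul.
- by apply: analytic_add; apply: analytic_mul.
Qed.

Lemma analytic_nsq x : analytic_at x nsq.
Proof.
rewrite /nsq; apply: (@analytic_sum _ _ _ _ _ _ (fun v y => y v ^+ 2)) => v.
by apply: analytic_exp; exact: analytic_var.
Qed.

Definition rint a b (w : R -> R) (T : R) Q x : R :=
  Int 0 T (fun t => w t * Q (rot a b t x)).

Lemma analytic2_rint a b w Q x t : b != a -> (forall t, analyticR w t) -> analytic0 Q ->
  0 < nsq x -> analytic2 (fun t x => w t * Q (rot a b t x)) t x.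
Proof.
move=> ba aw aQ x0; rewrite /analytic2 /un2; apply: analytic_mul.
  by apply: (analyticR_comp (aw _)); exact: analytic_var.
apply: (@analytic_comp _ _ _ _ Q (fun v y => rot a b (y None) (fun k => y (Some k)) v)).
  by move=> v; apply: analytic_rot => [|k]; exact: analytic_var.
by apply: aQ; rewrite nsq_rot.
Qed.

Lemma analytic0_rint a b w T Q : b != a -> 0 <= T -> (forall t, analyticR w t) ->
  analytic0 Q -> analytic0 (rint a b w T Q).
Proof.
move=> ba T0 aw aQ x x0.
have [_] := @analytic_Int R V (fun t x => w t * Q (rot a b t x)) 0 T x T0
  (fun t _ => analytic2_rint t ba aw aQ x0).
by [].
Qed.

Lemma rint_primitive a b w T Q x : b != a -> 0 <= T -> (forall t, analyticR w t) ->
  analytic0 Q -> 0 < nsq x ->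
  exists G, primitive_on 0 T (fun t => w t * Q (rot a b t x)) G.
Proof.
move=> ba T0 aw aQ x0; apply: primitive_ex => t _.
exact: (analytic2_continuous (analytic2_rint t ba aw aQ x0)).
Qed.

Lemma rint_deriv a b w T Q (u : V -> R -> R) t0 (e : R -> R) : b != a -> 0 <= T ->
  (forall t, analyticR w t) -> analytic0 Q -> (forall v, analyticR (u v) t0) ->
  0 < nsq (fun v => u v t0) ->
  (forall th, deriv (fun t => Q (rot a b th (fun v => u v t))) t0 (e th)) ->
  (exists G, primitive_on 0 T (fun th => w th * e th) G) /\
  deriv (fun t => rint a b w T Q (fun v => u v t)) t0 (Int 0 T (fun th => w th * e th)).
Proof.
move=> ba T0 aw aQ au u0 he.
have h th : deriv (fun t => w th * Q (rot a b th (fun v => u v t))) t0 (w th * e th).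
  exact: derivZ.
have [|] := @Int_deriv R (fun th t => w th * Q (rot a b th (fun v => u v t))) 0 T t0 T0.
  move=> s _; rewrite /analytic2 /un2; apply: analytic_mul.
    by apply: (analyticR_comp (aw _)); exact: analytic_var.
  apply: (@analytic_comp _ _ _ _ Q (fun v y => rot a b (y None) (fun k => u k (y (Some tt))) v)).
    move=> v; apply: analytic_rot => [|k]; first exact: analytic_var.
    by apply: (analyticR_comp (au k)); exact: analytic_var.
  by apply: aQ; rewrite nsq_rot.
rewrite (_ : (fun s => 'D_1 _ t0) = fun th => w th * e th); first by [].
by apply/funext => th; have [_ <-] := h th.
Qed.

Lemma analyticR_rot a b x v t : analyticR (fun t => rot a b t x v) t.
Proof.
rewrite /analyticR; apply: (@analytic_rot unit _ a b (fun y => y tt) (fun k _ => x k)).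
  exact: analytic_var.
by move=> k; exact: analytic_cst.
Qed.

(** By the group law, the derivative at angle [s] is the derivative at angle 0 starting from the
    rotated point. *)
Lemma inv_deriv0 a b Q : b != a ->
  (forall x, 0 < nsq x -> deriv (fun t => Q (rot a b t x)) 0 0) -> inv a b Q.
Proof.
move=> ba h x t x0.
rewrite -[in RHS](rot0 a b x).
apply: (@is_derive_0_is_cst R (fun t => Q (rot a b t x)) t 0) => s.
have hs : deriv (fun t => Q (rot a b t (rot a b s x))) (s - s) 0.
  by rewrite subrr; apply: h; rewrite nsq_rot.
have := @deriv_comp R _ (fun r => r - s) s _ _ hs (derivB (deriv_id s) (deriv_cst s s)).
rewrite mul0r (_ : (fun t => _) = fun t => Q (rot a b t x))//.
by apply/funext => r; rewrite rotD// subrK.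
Qed.

Lemma inv_gen a b Q x : b != a -> analytic0 Q -> inv a b Q -> 0 < nsq x ->
  \sum_v pd Q x v * gen a b x v = 0.
Proof.
move=> ba aQ iQ x0.
have := @chain_rule _ _ Q (fun v t => rot a b t x v) _ 0 _ (fun v => deriv_rot_angle 0 x v ba).
rewrite (_ : (fun v => rot a b 0 x v) = x); last by rewrite -[RHS](rot0 a b).
rewrite rot0 => /(_ (aQ x x0)) h1.
apply: deriv_uniq h1 _; rewrite (_ : (fun t => _) = fun=> Q x); first exact: deriv_cst.
by apply/funext => t; apply: iQ.
Qed.

Lemma deriv_along a b Q x t : b != a -> analytic0 Q -> 0 < nsq x ->
  deriv (fun t => Q (rot a b t x)) t
    (\sum_v pd Q (rot a b t x) v * gen a b (rot a b t x) v).
Proof.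
move=> ba aQ x0.
apply: (@chain_rule _ _ Q (fun v t => rot a b t x v)).
  by apply: aQ; rewrite nsq_rot.
by move=> v; apply: deriv_rot_angle.
Qed.

Lemma analyticR_sinX k (t : R) : analyticR (fun t => sin t ^+ k) t.
Proof. by apply: analytic_exp; have [] := analyticR_sin t. Qed.

Lemma analyticR_sinXcos k (t : R) : analyticR (fun t => sin t ^+ k * cos t) t.
Proof. by apply: analytic_mul; [exact: analyticR_sinX|have [] := analyticR_sin t]. Qed.

(** Differentiation under the integral gives the integral of a derivative over a full period. The
    weight 1 is written as a power of the sine because it is the first of the Euler weights. *)
Lemma inv_circle a b Q : b != a -> analytic0 Q ->
  inv a b (rint a b (fun t => sin t ^+ 0) (pi *+ 2) Q).
Proof.
move=> ba aQ; apply: inv_deriv0 => // x x0.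
have T0 : 0 <= pi *+ 2 :> R by rewrite mulrn_wge0// pi_ge0.
pose e th := \sum_v pd Q (rot a b th x) v * gen a b (rot a b th x) v.
have he th : deriv (fun t => Q (rot a b th (rot a b t x))) 0 (e th).
  have := @deriv_comp R (fun t => Q (rot a b t x)) (fun t => th + t) 0 _ _
    (deriv_along (th + 0) ba aQ x0) (derivD (deriv_cst th 0) (deriv_id 0)).
  rewrite add0r mulr1 addr0 (_ : (fun t => Q (rot a b th (rot a b t x))) =
    fun t => Q (rot a b (th + t) x)); first by [].
  by apply/funext => t; rewrite rotD.
have [_] := rint_deriv ba T0 (analyticR_sinX 0) aQ (fun v => analyticR_rot a b x v 0)
   (ltac:(by rewrite nsq_rot)) he.
apply: deriv_eq; rewrite (@IntE _ _ _ _ (fun t => Q (rot a b t x))).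
  by rewrite rot_2pi rot0 subrr.
by move=> t _; rewrite expr0 mul1r; exact: deriv_along.
Qed.

(** Rotations in planes without a common axis commute. *)
Lemma inv_comm a b c d w T Q : b != a -> c != a -> c != b -> d != a -> d != b ->
  inv c d Q -> inv c d (rint a b w T Q).
Proof.
move=> ba ca cb da db iQ x t x0; apply: eq_Int => th _.
by rewrite rotC// iQ// nsq_rot.
Qed.

(* Applied to a function invariant in the plane [(a, b)], the last term drops out, so that
   rotating in the plane [(b, c)] amounts to a derivation in the angles [(be, ga)]. *)
Lemma euler_identity a b c be ga x v : b != a -> c != a -> c != b ->
  let z := rot a b ga x in let y := rot b c be z in
  sin be * rot b c be (rot a b ga (gen b c x)) v =
  sin be * cos ga * gen b c y v - cos be * sin ga * rot b c be (gen a b z) v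
  + sin ga * gen a b y v.
Proof.
move=> /negPf ba /negPf ca /negPf cb z y.
have ab : (a == b) = false by rewrite eq_sym.
have ac : (a == c) = false by rewrite eq_sym.
have bc : (b == c) = false by rewrite eq_sym.
have hb := cos2Dsin2 be; have hg := cos2Dsin2 ga.
rewrite /y /z /gen /rot !eqxx ?ba ?ca ?cb ?ab ?ac ?bc.
case: (eqVneq v a) => [ve|va].
  by rewrite ?ve ?ab ?ac; ring.
case: (eqVneq v b) => [ve|vb].
  rewrite ?ve ?bc ?ba; apply/eqP; rewrite -subr_eq0; apply/eqP.
  move: hb hg; set cb_ := cos be; set sb := sin be; set cg := cos ga; set sg := sin ga => hb hg.
  transitivity ((cb_ ^+ 2 + sb ^+ 2 - 1) * (sg * (cg * x a - sg * x b)) +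
     (cg ^+ 2 + sg ^+ 2 - 1) * (sb ^+ 2 * x b)); first by ring.
  by rewrite hb hg subrr !mul0r addr0.
case: (eqVneq v c) => [ve|vc].
  rewrite ?ve ?ca ?cb;  apply/eqP; rewrite -subr_eq0; apply/eqP.
  move: hb hg; set cb_ := cos be; set sb := sin be; set cg := cos ga; set sg := sin ga => hb hg.
  transitivity ((cg ^+ 2 + sg ^+ 2 - 1) * (- (sb * cb_ * x b))); first by ring.
  by rewrite hg subrr mul0r.
by rewrite ?(negPf va) ?(negPf vb) ?(negPf vc); ring.
Qed.

(** The derivative of the double integral along [gen b c] is 0: by [euler_identity] it involves only
    derivatives in the two angles, and an integration by parts in the inner angle turns the outer
    integrand into minus the derivative of [sin ga ^+ j.+1 * M (z ga)], a function that vanishes at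
    both ends. The terms match exactly for the exponents [j] and [j.+1], which are those of the Haar
    measure in Euler angles. *)
Lemma inv_euler a b c j T T' Q : b != a -> c != a -> c != b -> 0 <= T -> 0 <= T' ->
  sin T = 0 -> sin T' = 0 -> analytic0 Q -> inv a b Q ->
  inv b c (rint a b (fun t => sin t ^+ j) T (rint b c (fun t => sin t ^+ j.+1) T' Q)).
Proof.
move=> ba ca cb T0 T'0 sT sT' aQ iQ.
set J := rint b c _ T' Q.
have aJ : analytic0 J by apply: analytic0_rint => //; exact: analyticR_sinX.
apply: inv_deriv0 => // x x0.
pose z ga := rot a b ga x.
pose y be ga := rot b c be (z ga).
have z0 ga : 0 < nsq (z ga) by rewrite nsq_rot.
have y0 be ga : 0 < nsq (y be ga) by rewrite nsq_rot.
pose D be ga (u : V -> R) := \sum_v pd Q (y be ga) v * u v.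
have dt be ga : deriv (fun t => Q (rot b c be (rot a b ga (rot b c t x)))) 0
    (D be ga (rot b c be (rot a b ga (gen b c x)))).
  have := @chain_rule _ _ Q (fun v t => rot b c be (rot a b ga (rot b c t x)) v)
    (rot b c be (rot a b ga (gen b c x))) 0.
  rewrite rot0; apply; first by apply: aQ; rewrite !nsq_rot.
  move=> v; apply: (@deriv_rot b c be (fun k t => rot a b ga (rot b c t x) k)) => k.
  apply: (@deriv_rot a b ga (fun k t => rot b c t x k)) => l.
  by have := deriv_rot_angle 0 x l cb; rewrite rot0.
have dg be ga : deriv (fun ga => Q (rot b c be (rot a b ga x))) ga
    (D be ga (rot b c be (gen a b (z ga)))).
  have := @chain_rule _ _ Q (fun v t => rot b c be (rot a b t x) v)
    (rot b c be (gen a b (z ga))) ga.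
  apply; first by apply: aQ; rewrite !nsq_rot.
  move=> v; apply: (@deriv_rot b c be (fun k t => rot a b t x k)) => k.
  exact: deriv_rot_angle.
have db be ga : deriv (fun be => Q (rot b c be (z ga))) be (D be ga (gen b c (y be ga))).
  exact: deriv_along.
have rel be ga : sin be * D be ga (rot b c be (rot a b ga (gen b c x))) =
  sin be * cos ga * D be ga (gen b c (y be ga))
  - cos be * sin ga * D be ga (rot b c be (gen a b (z ga))).
  have i0 : D be ga (gen a b (y be ga)) = 0 by apply: inv_gen.
  have -> : forall A B, A - B = A - B + sin ga * 0 by move=> A B; rewrite mulr0 addr0.
  rewrite -i0 /D !mulr_sumr -sumrB -big_split/=; apply: eq_bigr => v _.
  have := euler_identity be ga x v ba ca cb; rewrite /= -/(z ga) -/(y be ga) => e.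
  by rewrite mulrCA e; ring.
pose Jt ga := Int 0 T' (fun be => sin be ^+ j.+1 *
   D be ga (rot b c be (rot a b ga (gen b c x)))).
have hJt ga : (exists G, primitive_on 0 T' (fun be => sin be ^+ j.+1 *
   D be ga (rot b c be (rot a b ga (gen b c x)))) G) /\
   deriv (fun t => J (rot a b ga (rot b c t x))) 0 (Jt ga).
  apply: (@rint_deriv b c _ T' Q (fun v t => rot a b ga (rot b c t x) v)) => //.
  - exact: analyticR_sinX.
  - move=> v; rewrite /analyticR.
    apply: (@analytic_rot unit _ a b (fun _ => ga) (fun k y => rot b c (y tt) x k)).
      exact: analytic_cst.
    by move=> k; exact: analyticR_rot.
  - by rewrite !nsq_rot.
have [_ hK] := rint_deriv ba T0 (analyticR_sinX j) aJ (fun v => analyticR_rot b c x v 0)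
   (ltac:(by rewrite nsq_rot)) (fun ga => (hJt ga).2).
apply: deriv_eq hK.
pose M := rint b c (fun t => sin t ^+ j * cos t) T' Q.
pose M' ga := Int 0 T' (fun be => sin be ^+ j * cos be * D be ga (rot b c be (gen a b (z ga)))).
have hM ga : (exists G, primitive_on 0 T' (fun be => sin be ^+ j * cos be *
    D be ga (rot b c be (gen a b (z ga)))) G) /\
   deriv (fun ga => M (rot a b ga x)) ga (M' ga).
  apply: (@rint_deriv b c _ T' Q (fun v t => rot a b t x v)) => //.
  - exact: analyticR_sinXcos.
  - by move=> v; exact: analyticR_rot.
  - by rewrite nsq_rot.
have key ga : sin ga ^+ j * Jt ga =
    - (j.+1%:R * sin ga ^+ j * cos ga * M (z ga) + sin ga ^+ j.+1 * M' ga).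
  have [[G1 hG1] _] := hJt ga.
  have [[G2 hG2] _] := hM ga.
  have [G3 hG3] := rint_primitive cb T'0 (analyticR_sinXcos j) aQ (z0 ga).
  rewrite /Jt /M /M' /rint (IntE hG1) (IntE hG2) (IntE hG3).
  set A := sin ga ^+ j.
  (* The boundary term of the integration by parts in [be]; it vanishes at 0 and at [T'] because the
     sine does. Its derivative is written in two ways, by the product rule and through [rel], and
     primitives of the same function have equal increments. *)
  pose Phi be := A * cos ga * (sin be ^+ j.+1 * Q (y be ga)).
  have e : primitive_on 0 T' (fun be => A * cos ga * ((j.+1%:R * sin be ^+ j * cos be) * Q (y be ga)
     + sin be ^+ j.+1 * D be ga (gen b c (y be ga)))) Phi.
    move=> be _; apply: derivZ; apply: derivM (db be ga).
    exact: (derivX j.+1 (is_derive_sin be)).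
  have e' : primitive_on 0 T' (fun be => A * cos ga * ((j.+1%:R * sin be ^+ j * cos be) * Q (y be ga)
     + sin be ^+ j.+1 * D be ga (gen b c (y be ga))))
     (fun be => A * G1 be + (j.+1%:R * A * cos ga * G3 be + A * sin ga * G2 be)).
    move=> be hbe.
    apply: deriv_eq (derivD (derivZ A (hG1 be hbe)) (derivD
      (derivZ (j.+1%:R * A * cos ga) (hG3 be hbe)) (derivZ (A * sin ga) (hG2 be hbe)))).
    rewrite exprSr -[sin be ^+ j * sin be * _]mulrA rel; move: (D _ _ _) (D _ _ _) => D1 D2.
    by rewrite -/(y be ga); ring.
  have := primitive_cst e e'; rewrite /Phi sT' sin0 !exprS !mul0r !mulr0 subrr -/A => h.
  apply/eqP; rewrite -subr_eq0; apply/eqP; rewrite [RHS]h; ring.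
rewrite (@IntE _ _ _ _ (fun ga => - (sin ga ^+ j.+1 * M (z ga)))).
  by rewrite sT sin0 !exprS !mul0r subrr.
move=> ga _; rewrite key.
apply: deriv_eq (derivN (derivM (derivX j.+1 (is_derive_sin ga)) (hM ga).2)).
by rewrite /= -/(z ga).
Qed.

End RotV.
End Rotations.

(** * Divergences of tangential analytic fields *)

Section TangentialDivergence.
Context {R : realType}.

Notation deriv f x d := (is_derive (x : R) (1 : R) (f : R -> R) (d : R)).

Lemma pdE {V : finType} (g : (V -> R) -> R) p v d :
  deriv (fun t => g (upd p v t)) (p v) d -> pd g p v = d.
Proof. by case. Qed.

Lemma pdD {V : finType} (g h : (V -> R) -> R) p v : analytic_at p g -> analytic_at p h ->
  pd (fun y => g y + h y) p v = pd g p v + pd h p v.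
Proof. by move=> ag ah; apply: pdE; apply: derivD; exact: analytic_deriv. Qed.

Lemma pdM {V : finType} (g h : (V -> R) -> R) p v : analytic_at p g -> analytic_at p h ->
  pd (fun y => g y * h y) p v = pd g p v * h p + g p * pd h p v.
Proof.
move=> ag ah; apply: pdE.
by have := derivM (analytic_deriv v ag) (analytic_deriv v ah); rewrite !updE.
Qed.

Lemma pd_cst {V : finType} (k : R) (p : V -> R) v : pd (fun=> k) p v = 0.
Proof. by apply: pdE; exact: deriv_cst. Qed.

(** Tangency is recorded because it lets a radial factor pass through the divergence. *)
Definition tdiv {V : finType} (F : (V -> R) -> R) : Prop :=
  exists W : V -> (V -> R) -> R, [/\ forall k, analytic0 (W k),
    forall x, 0 < nsq x -> \sum_k pd (W k) x k = F x &
    forall x, 0 < nsq x -> \sum_k x k * W k x = 0].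

Lemma eq_tdiv {V : finType} (F F' : (V -> R) -> R) : (forall x, 0 < nsq x -> F x = F' x) ->
  tdiv F -> tdiv F'.
Proof. by move=> e [W [h1 h2 h3]]; exists W; split => // x x0; rewrite h2// e. Qed.

Lemma tdiv0 {V : finType} : tdiv (fun _ : V -> R => 0).
Proof.
exists (fun _ _ => 0); split.
- by move=> k x _; exact: analytic_cst.
- by move=> x _; rewrite big1// => k _; exact: pd_cst.
- by move=> x _; rewrite big1// => k _; rewrite mulr0.
Qed.

Lemma tdivD {V : finType} (F F' : (V -> R) -> R) : tdiv F -> tdiv F' ->
  tdiv (fun x => F x + F' x).
Proof.
move=> [W [h1 h2 h3]] [W' [h1' h2' h3']]; exists (fun k x => W k x + W' k x); split.
- by move=> k x x0; apply: analytic_add; [exact: h1|exact: h1'].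
- move=> x x0; rewrite -h2// -h2'// -big_split/=; apply: eq_bigr => k _.
  by rewrite pdD//; [exact: h1|exact: h1'].
- move=> x x0; under eq_bigr do rewrite mulrDr.
  by rewrite big_split/= h3// h3'// addr0.
Qed.

(** The field is [G] times [gen a b]. As the linear field [gen a b] is tangential and divergence
    free, the divergence of the product is the derivative of [G] along the rotations. *)
Lemma tdiv_rot {V : finType} (a b : V) (F G : (V -> R) -> R) : b != a -> analytic0 G ->
  (forall x, 0 < nsq x -> deriv (fun t => G (rot a b t x)) 0 (F x)) -> tdiv F.
Proof.
move=> ba aG hF.
have agen x k : analytic_at x (fun y => gen a b y k).
  rewrite /gen; case: eqP => _; first by apply: analytic_opp; exact: analytic_var.
  by case: eqP => _; [exact: analytic_var|exact: analytic_cst].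
exists (fun k x => G x * gen a b x k); split.
- by move=> k x x0; apply: analytic_mul; [exact: aG|exact: agen].
- move=> x x0.
  have h := deriv_along 0 ba aG x0; rewrite rot0 in h.
  rewrite (deriv_uniq (hF x x0) h); apply: eq_bigr => k _.
  rewrite pdM//; last exact: aG.
  suff -> : pd (fun y => gen a b y k) x k = 0 by rewrite mulr0 addr0.
  apply: pdE.
  rewrite (_ : (fun t => _) = fun=> gen a b x k); first exact: deriv_cst.
  apply/funext => t; rewrite /gen /upd; case: (eqVneq k a) => [->|ka].
    by rewrite (negPf ba).
  by case: (eqVneq k b).
- move=> x x0; rewrite (bigD1 a)//= (bigD1 b)//= big1 ?addr0.
    by rewrite /gen !eqxx (negPf ba); ring.
  by move=> k /andP[/negPf ka /negPf kb]; rewrite /gen ka kb !mulr0.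
Qed.

(** Rescaling the variable to [t * s] fixes the interval of integration and turns the upper limit
    into a parameter, so that [analytic_Int] applies. *)
Lemma sin_primitive k : exists W : R -> R, (forall t, analyticR W t) /\
  forall t, deriv W t (sin t ^+ k).
Proof.
pose g s (x : unit -> R) := x tt * sin (x tt * s) ^+ k.
pose W (t : R) := Int 0 1 (fun s => t * sin (t * s) ^+ k).
exists W; split.
  move=> t; have [|_] := @analytic_Int R unit g 0 1 (fun=> t) ler01; last by [].
  move=> s _; rewrite /analytic2 /un2 /g.
  apply: analytic_mul; first exact: analytic_var.
  apply: analytic_exp; apply: (analyticR_comp (analyticR_sin _).1).
  by apply: analytic_mul; exact: analytic_var.
move=> t; pose M := `|t| + 1.
have M0 : 0 < M by rewrite ltr_wpDl.
have NM : - M <= M by lra.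
have [|S hS] := @primitive_ex R (- M) M (fun t => sin t ^+ k).
  by move=> s _; apply: analyticR_continuous; exact: analyticR_sinX.
have hS' s : - M <= s <= M -> deriv S s (sin s ^+ k).
  by move=> hs; apply: hS; rewrite (min_idPl NM) (max_idPr NM).
apply: (@deriv_near _ (fun t => S t - S 0) _ _ _ 1) => //; last first.
  apply: deriv_eq (derivB (hS' t _) (deriv_cst (S 0) t)); first by rewrite subr0.
  by rewrite -ler_norml /M; lra.
move=> u ut; rewrite /W (@IntE _ _ _ _ (fun s => S (u * s))); first by rewrite mulr1 mulr0.
move=> s; rewrite (min_idPl ler01) (max_idPr ler01) => /andP[s0 s1].
have us : - M <= u * s <= M.
  rewrite -ler_norml normrM (ger0_norm s0) (le_trans (ler_piMr _ s1))//.
  by have := ler_normD (u - t) t; rewrite subrK /M; lra.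
have := @deriv_comp R S (fun s => u * s) s _ _ (hS' _ us) (derivZ u (deriv_id s)).
by apply: deriv_eq; rewrite mulr1 mulrC.
Qed.

Definition avg {V : finType} (a b : V) k T (Q : (V -> R) -> R) x : R :=
  (Int 0 T (fun t => sin t ^+ k))^-1 * rint a b (fun t => sin t ^+ k) T Q x.

Lemma analytic0_avg {V : finType} (a b : V) k T Q : b != a -> 0 <= T -> analytic0 Q ->
  analytic0 (avg a b k T Q).
Proof.
move=> ba T0 aQ x x0; apply: analytic_scale; apply: analytic0_rint => //.
exact: analyticR_sinX.
Qed.

(** Let [w] be the primitive of the normalized weight with [w T = 0], hence [w 0 = -1]. By parts,
    the integral of [w] against the angular derivative of [Q (rot a b t x)] is [Q x] minus the
    average; it is also the derivative of [rint a b w T Q] along the rotations, so [tdiv_rot]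
    applies. *)
Lemma tdiv_avg {V : finType} (a b : V) k T Q : b != a -> 0 <= T ->
  0 < Int 0 T (fun t => sin t ^+ k) -> analytic0 Q ->
  tdiv (fun x => Q x - avg a b k T Q x).
Proof.
move=> ba T0 Z0 aQ; have [W [aW dW]] := sin_primitive k.
have ZE : Int 0 T (fun t => sin t ^+ k) = W T - W 0 by apply: IntE => t _.
set Z := Int 0 T _ in Z0 ZE.
pose w t := Z^-1 * (W t - W T).
have aw t : analyticR w t.
  by apply: analytic_scale; apply: analytic_sub; [exact: aW|exact: analytic_cst].
have aG := analytic0_rint ba T0 aw aQ.
apply: (tdiv_rot ba aG) => x x0.
pose e th := \sum_v pd Q (rot a b th x) v * gen a b (rot a b th x) v.
have he th : deriv (fun t => Q (rot a b th (rot a b t x))) 0 (e th).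
  have := @deriv_comp R (fun t => Q (rot a b t x)) (fun t => th + t) 0 _ _
    (deriv_along (th + 0) ba aQ x0) (derivD (deriv_cst th 0) (deriv_id 0)).
  rewrite add0r mulr1 addr0 (_ : (fun t => Q (rot a b th (rot a b t x))) =
    fun t => Q (rot a b (th + t) x)); first by [].
  by apply/funext => t; rewrite rotD.
have [_] := rint_deriv ba T0 aw aQ (fun v => analyticR_rot a b x v 0)
   (ltac:(by rewrite nsq_rot)) he.
apply: deriv_eq.
have [G hG] := rint_primitive ba T0 (analyticR_sinX k) aQ x0.
rewrite (@IntE _ _ _ _ (fun t => w t * Q (rot a b t x) - Z^-1 * G t)); last first.
  move=> t ht.
  have dw : deriv w t (Z^-1 * sin t ^+ k).
    apply: derivZ; apply: deriv_eq (derivB (dW t) (deriv_cst (W T) t)).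
    by rewrite subr0.
  apply: deriv_eq (derivB (derivM dw (deriv_along t ba aQ x0)) (derivZ Z^-1 (hG t ht))).
  by rewrite -/(e t); ring.
rewrite /avg /rint (IntE hG) -/Z rot0 /w subrr mulr0 mul0r.
have -> : Z^-1 * (W 0 - W T) = - 1 by rewrite -(opprB (W T)) -ZE mulrN mulVf// gt_eqF.
by ring.
Qed.

Definition homog0 {V : finType} (Q : (V -> R) -> R) : Prop :=
  forall x l, 0 < nsq x -> 0 < l -> Q (fun v => l * x v) = Q x.

Lemma homog0_avg {V : finType} (a b : V) k T Q : b != a -> homog0 Q ->
  homog0 (avg a b k T Q).
Proof.
move=> ba hQ x l x0 l0; congr (_ * _); apply: eq_Int => t _.
by rewrite rotZ hQ// nsq_rot.
Qed.

Lemma inv_avg {V : finType} (a b c d : V) k T Q :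
  inv c d (rint a b (fun t => sin t ^+ k) T Q) -> inv c d (avg a b k T Q).
Proof. by move=> h x t x0; rewrite /avg h. Qed.

Lemma rint_avg {V : finType} (a b c d : V) j k T T' (Q : (V -> R) -> R) x :
  b != a -> d != c -> 0 <= T -> 0 <= T' -> analytic0 Q -> 0 < nsq x ->
  rint a b (fun t => sin t ^+ j) T (avg c d k T' Q) x =
  (Int 0 T' (fun t => sin t ^+ k))^-1 *
  rint a b (fun t => sin t ^+ j) T (rint c d (fun t => sin t ^+ k) T' Q) x.
Proof.
move=> ba dc T0 T'0 aQ x0; rewrite /rint -IntZ.
  by apply: eq_Int => t _; rewrite mulrCA.
exact: (rint_primitive ba T0 (analyticR_sinX j)
  (analytic0_rint dc T'0 (analyticR_sinX k) aQ) x0).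
Qed.

Lemma polar_angle (u v : R) : exists t, sin t * u + cos t * v = 0 /\ 0 <= cos t * u - sin t * v.
Proof.
have [h|h] := eqVneq (u ^+ 2 + v ^+ 2) 0.
  have := h => /eqP; rewrite paddr_eq0 ?sqr_ge0// !sqrf_eq0 => /andP[/eqP -> /eqP ->].
  by exists 0; rewrite !mulr0 addr0 subr0.
have h0 : 0 < u ^+ 2 + v ^+ 2 by rewrite lt_neqAle eq_sym h addr_ge0 ?sqr_ge0.
pose r := Num.sqrt (u ^+ 2 + v ^+ 2).
have r0 : 0 < r by rewrite sqrtr_gt0.
have r2 : r ^+ 2 = u ^+ 2 + v ^+ 2 by rewrite sqr_sqrtr// ltW.
have ur : `|u| <= r by rewrite -sqrtr_sqr ler_sqrt// ?lerDl ?sqr_ge0// ltW.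
have ur1 : -1 <= u / r <= 1.
  by rewrite -ler_norml normrM normfV (gtr0_norm r0) ler_pdivrMr// mul1r.
have e2 : 1 - (u / r) ^+ 2 = (`|v| / r) ^+ 2.
  have rr : r ^+ 2 != 0 by rewrite expf_neq0// gt_eqF.
  rewrite !expr_div_n real_normK ?num_real// -[1](divff rr) -mulrBl r2.
  by congr (_ / _); ring.
pose a := acos (u / r).
have ca : cos a = u / r by rewrite acosK// in_itv.
have sa : sin a = `|v| / r.
  by rewrite sin_acos// e2 sqrtr_sqr ger0_norm// divr_ge0// ltW.
have [t [ct st]] : exists t, cos t = u / r /\ sin t = - v / r.
  have [v0|v0] := leP 0 v.
    by exists (- a); rewrite cosN sinN ca sa (ger0_norm v0) mulNr.
  by exists a; rewrite ca sa (ltr0_norm v0).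
exists t; rewrite ct st; split; first by ring.
have -> : u / r * u - - v / r * v = (u ^+ 2 + v ^+ 2) / r by ring.
by rewrite divr_ge0// ltW.
Qed.

(** * Successive averages in the planes of adjacent axes *)

Section AdjacentPlanes.
Variable n : nat.
Implicit Types (Q K P : ('I_n.+1 -> R) -> R) (i j m : nat).

Let o i : 'I_n.+1 := inord i.
(** The ranges of the Euler angles: a full circle in the first plane, half a turn in the others,
    where the sine is nonnegative. *)
Let T i : R := if i == 0%N then pi *+ 2 else pi.
Let A i Q := avg (o i) (o i.+1) i (T i) Q.
Let I i Q := inv (o i) (o i.+1) Q.

Lemma axis_neq i j : (i <= n)%N -> (j <= n)%N -> i != j -> o i != o j.
Proof. by move=> hi hj; rewrite -val_eqE /= !inordK. Qed.

Lemma period_gt0 i : 0 < T i.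
Proof. by have := @pi_gt0 R; rewrite /T; case: eqP => _ ?; rewrite ?mulr2n; lra. Qed.

Lemma sin_period i : sin (T i) = 0.
Proof. by rewrite /T; case: eqP => _; [exact: sin2pi|exact: sinpi]. Qed.

Lemma weight_gt0 i : 0 < Int 0 (T i) (fun t => sin t ^+ i).
Proof.
apply: (Int_gt0 (period_gt0 i)).
  by apply: primitive_ex => t _; apply: analyticR_continuous; exact: analyticR_sinX.
rewrite /T; case: eqP => [-> t _|_ t ht]; first by rewrite expr0.
by rewrite exprn_gt0// sin_gt0_pi.
Qed.

Lemma axis_succ_neq i : (i < n)%N -> o i.+1 != o i.
Proof. by move=> hi; apply: axis_neq => //; [exact: ltnW|rewrite gtn_eqF]. Qed.

(* The witness [K] is [A j (A j.+1 (... (A m Q)))]. *)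
Lemma average_down m Q : (m < n)%N -> analytic0 Q -> homog0 Q ->
  (forall i, (i < m)%N -> I i Q) -> forall d j, (j + d = m.+1)%N ->
  exists K, [/\ analytic0 K, homog0 K, forall i, (i.+1 < j)%N -> I i K,
    forall i, (j < i <= m)%N -> I i K & tdiv (fun x => Q x - K x)] /\
    ((0 < d)%N -> exists P, [/\ K = A j P, analytic0 P & forall i, i.+1 = j -> I i P]).
Proof.
move=> mn aQ hQ iQ; elim=> [|d ih] j jd.
  rewrite addn0 in jd; exists Q; split => //; split => //.
  - by move=> i; rewrite jd ltnS => /iQ.
  - by move=> i /andP[]; rewrite jd => h1 h2; move: (leq_trans h1 h2); rewrite ltnNge leqnSn.
  - by apply: eq_tdiv tdiv0 => x _; rewrite subrr.
have [|K [[aK hK lK uK tK] sK]] := ih j.+1; first by rewrite addSnnS.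
have jm : (j <= m)%N by rewrite -ltnS -jd addnS ltnS leq_addr.
have jn := leq_ltn_trans jm mn.
have jj := axis_succ_neq jn.
have T0 := ltW (period_gt0 j).
exists (A j K); split; last first.
  by move=> _; exists K; split => // i e; apply: lK; rewrite e.
split.
- exact: analytic0_avg.
- exact: homog0_avg.
(* These planes have no axis in common with plane [j], so the invariance survives the average. *)
- move=> i ij; apply: inv_avg; apply: inv_comm => //.
  + apply: axis_neq; rewrite ?ltn_eqF//; last exact: ltnW.
      exact: leq_trans (ltnW (ltnW ij)) (ltnW jn).
    exact: ltnW.
  + apply: axis_neq; rewrite ?ltn_eqF//.
      exact: leq_trans (ltnW (ltnW ij)) (ltnW jn).
    by rewrite ltnS ltnW// ltnW.
  + by apply: axis_neq; rewrite ?ltn_eqF//; [exact: leq_trans (ltnW ij) (ltnW jn)|exact: ltnW].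
  + apply: axis_neq; rewrite ?ltn_eqF//; first exact: leq_trans (ltnW ij) (ltnW jn).
    exact: ltnW.
  + by apply: lK; exact: ltnW.
- move=> i /andP[ji im]; have hin := leq_ltn_trans im mn.
  have [ij|ij] := ltnP j.+1 i.
    apply: inv_avg; apply: inv_comm => //.
    + by apply: axis_neq; rewrite ?gtn_eqF//; exact: ltnW.
    + by apply: axis_neq; rewrite ?gtn_eqF//; exact: ltnW.
    + by apply: axis_neq; rewrite ?gtn_eqF//; [exact: ltnW|exact: ltnW].
    + by apply: axis_neq; rewrite ?gtn_eqF//; exact: ltnW.
    + by apply: uK; rewrite ij.
  (* Plane [j.+1] shares an axis with plane [j]. Here [K] is itself [A j.+1 P] with [P] still
     invariant in plane [j], the situation of [inv_euler]; for this reason the induction also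
     returns [P]. *)
  have ei : i = j.+1 by apply/eqP; rewrite eqn_leq ij.
  have d0 : (0 < d)%N.
    by move: im; rewrite ei -ltnS -jd; case: (d) => //; rewrite addn1 ltnn.
  have [P [-> aP iP]] := sK d0.
  rewrite ei /I /A; apply: inv_avg => x t x0.
  have jn1 : (j.+1 < n)%N by rewrite -ei.
  have jj1 := axis_succ_neq jn1.
  have T10 := ltW (period_gt0 j.+1).
  rewrite !rint_avg// ?nsq_rot//; congr (_ * _).
  have jj2 : o j.+2 != o j by apply: axis_neq; rewrite ?gtn_eqF//; exact: ltnW.
  have h := inv_euler j jj jj2 jj1 T0 T10 (sin_period j) (sin_period j.+1) aP (iP j erefl).
  exact: h.
- apply: eq_tdiv (tdivD tK (tdiv_avg jj T0 (weight_gt0 j) aK)) => x _.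
  by rewrite -/(A j K); ring.
Qed.

(** Going down to plane 0 gives invariance in the planes 1 to [m]; plane 0 is covered because the
    outermost average is over a full circle. *)
Lemma average_step m Q : (m < n)%N -> analytic0 Q -> homog0 Q ->
  (forall i, (i < m)%N -> I i Q) ->
  exists K, [/\ analytic0 K, homog0 K, forall i, (i <= m)%N -> I i K &
     tdiv (fun x => Q x - K x)].
Proof.
move=> mn aQ hQ iQ.
have [K [[aK hK _ uK tK] /(_ isT) [P [KE aP _]]]] :=
  average_down mn aQ hQ iQ (add0n m.+1).
exists K; split => // -[_|i im]; last exact: uK.
rewrite KE; apply: inv_avg; rewrite /T /=; apply: inv_circle => //.
exact: (axis_succ_neq (leq_ltn_trans (leq0n m) mn)).
Qed.

Lemma average_all Q : analytic0 Q -> homog0 Q ->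
  exists K, [/\ analytic0 K, homog0 K, forall i, (i < n)%N -> I i K &
     tdiv (fun x => Q x - K x)].
Proof.
move=> aQ hQ.
suff h m : (m <= n)%N -> exists K, [/\ analytic0 K, homog0 K, forall i, (i < m)%N -> I i K &
     tdiv (fun x => Q x - K x)] by exact: h.
elim: m => [_|m ih mn].
  by exists Q; split => //; apply: eq_tdiv tdiv0 => x _; rewrite subrr.
have [K [aK hK iK tK]] := ih (ltnW mn).
have [K' [aK' hK' iK' tK']] := average_step mn aK hK iK.
exists K'; split => //; apply: eq_tdiv (tdivD tK tK') => x _; ring.
Qed.

(** Elimination by rotations: a rotation in the plane of the last two remaining axes annihilates one
    coordinate and makes the other nonnegative, so that no ambiguity of sign remains at the end. *)
Lemma inv_reduce Q x j : (forall i, (i < n)%N -> I i Q) -> 0 < nsq x -> (j <= n)%N ->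
  exists y, [/\ nsq y = nsq x, Q y = Q x, forall i : 'I_n.+1, (n - j < i)%N -> y i = 0 &
    (0 < j)%N -> 0 <= y (o (n - j))].
Proof.
move=> iQ x0; elim: j => [_|j ih jn].
  exists x; split => // i; rewrite subn0 => h.
  by have := ltn_ord i; rewrite ltnS leqNgt h.
have [y [ny Qy yz _]] := ih (ltnW jn).
pose k := (n - j.+1)%N.
have kn : (k < n)%N by rewrite /k ltn_subrL (leq_ltn_trans _ jn).
have kj : (n - j)%N = k.+1 by rewrite /k -subSn.
have kk := axis_succ_neq kn.
have [t [e1 e2]] := polar_angle (y (o k)) (y (o k.+1)).
exists (rot (o k) (o k.+1) t y); split.
- by rewrite nsq_rot.
- by rewrite iQ// ny.
- move=> i ki; case: (eqVneq i (o k.+1)) => [->|ik]; first by rewrite rotE_r.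
  rewrite /rot (negPf ik).
  have -> : (i == o k) = false.
    by apply/negbTE; rewrite -val_eqE /= inordK ?ltnS ?(ltnW kn)// gtn_eqF.
  apply: yz; rewrite kj ltn_neqAle ki andbT.
  by apply: contra ik => /eqP e; rewrite -val_eqE /= inordK// -e.
- by move=> _; rewrite rotE_l.
Qed.

(** Rotations bring every [x] to the positive half of the first axis, where homogeneity of degree 0
    leaves a single value. *)
Lemma inv_cst Q : (0 < n)%N -> (forall i, (i < n)%N -> I i Q) -> homog0 Q ->
  exists c, forall x, 0 < nsq x -> Q x = c.
Proof.
move=> n0 iQ hQ.
pose e : 'I_n.+1 -> R := fun i : 'I_n.+1 => (i == o 0)%:R.
have ne : nsq e = 1.
  rewrite /nsq (bigD1 (o 0))//= /e eqxx expr1n big1 ?addr0// => i /negPf ->.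
  by rewrite expr0n.
exists (Q e) => x x0.
have [y [ny <- yz yp]] := inv_reduce iQ x0 (leqnn n).
(* As [0 < n], at least one rotation was made, and so the remaining coordinate is nonnegative. *)
rewrite subnn in yz yp; have {}yp := yp n0.
have yE : y = fun v => y (o 0) * e v.
  apply/funext => v; rewrite /e; case: eqP => [->|/eqP v0]; first by rewrite mulr1.
  rewrite mulr0 yz// lt0n; apply: contra v0 => /eqP v0; apply/eqP/val_inj.
  by rewrite /= inordK.
rewrite yE hQ// ?ne// lt_neqAle yp andbT eq_sym; apply: contraTneq x0 => y0.
rewrite -ny yE y0 /nsq big1 ?ltxx// => v _.
by rewrite mul0r expr0n.
Qed.

Lemma tdiv_sphere (F : ('I_n.+1 -> R) -> R) : (0 < n)%N -> analytic0 F -> homog0 F ->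
  exists c, tdiv (fun x => F x - c).
Proof.
move=> n0 aF hF; have [K [_ hK iK tK]] := average_all aF hF.
have [c hc] := inv_cst n0 iK hK; exists c.
by apply: eq_tdiv tK => x x0; rewrite hc.
Qed.

End AdjacentPlanes.
End TangentialDivergence.

(** * From multi-index power series to germs and back *)

Section MultiIndices.
Context {R : realType}.

Lemma inB_bigsum {V : finType} (p : V -> R) r (J : Type) (s : seq J) (P : pred J)
    (N : J -> R) (g : J -> (V -> R) -> R) : 0 < r ->
  (forall j, P j -> inB p r (N j) (g j)) ->
  inB p r (\sum_(j <- s | P j) N j) (fun y => \sum_(j <- s | P j) g j y).
Proof.
move=> r0 h; elim: s => [|j s ih].
  rewrite big_nil; have := inB_cst p 0 (ltW r0); rewrite normr0.
  by apply: eq_inB => y _; rewrite big_nil.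
rewrite big_cons; case: ifP => Pj; last by apply: eq_inB ih => y _; rewrite big_cons Pj.
by apply: eq_inB (inB_add (ltW r0) (h j Pj) ih) => y _; rewrite big_cons Pj.
Qed.

Lemma inB_bigprod {V : finType} (p : V -> R) r (J : Type) (s : seq J)
    (N : J -> R) (g : J -> (V -> R) -> R) : 0 < r ->
  (forall j, inB p r (N j) (g j)) ->
  inB p r (\prod_(j <- s) N j) (fun y => \prod_(j <- s) g j y).
Proof.
move=> r0 h; elim: s => [|j s ih].
  rewrite big_nil; have := inB_cst p 1 (ltW r0); rewrite normr1.
  by apply: eq_inB => y _; rewrite big_nil.
rewrite big_cons.
by apply: eq_inB (inB_mul r0 (h j) ih) => y _; rewrite big_cons.
Qed.

Lemma inB_exp {V : finType} (p : V -> R) r N g k : 0 < r -> inB p r N g ->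
  inB p r (N ^+ k) (fun y => g y ^+ k).
Proof.
move=> r0 h; elim: k => [|k ih].
  by rewrite expr0; have := inB_cst p 1 (ltW r0); rewrite normr1.
by rewrite exprS; apply: eq_inB (inB_mul r0 h ih) => y _; rewrite exprS.
Qed.

Lemma enorm_nsq n (x : 'rV[R]_n) : enorm x = Num.sqrt (nsq (x 0)).
Proof. by []. Qed.

Lemma nsq_ge0 {V : finType} (x : V -> R) : 0 <= nsq x.
Proof. by apply: sumr_ge0 => v _; rewrite sqr_ge0. Qed.

Lemma enorm_lt n (x : 'rV[R]_n) r : 0 < r -> nsq (x 0) < r ^+ 2 -> enorm x < r.
Proof.
move=> r0 h; rewrite -[ltRHS](ger0_norm (ltW r0)) -sqrtr_sqr ltr_sqrt//.
by rewrite exprn_gt0.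
Qed.

Lemma coord_enorm n (x : 'rV[R]_n) i : `|x 0 i| <= enorm x.
Proof.
rewrite -sqrtr_sqr ler_sqrt ?nsq_ge0// (bigD1 i)//= lerDl.
by apply: sumr_ge0 => j _; rewrite sqr_ge0.
Qed.

Lemma rowK n (x : 'rV[R]_n) : \row_i x 0 i = x.
Proof. by apply/rowP => i; rewrite mxE. Qed.

(** The series is a sum of homogeneous polynomials [p k] of norm at most [M k]. Absolute convergence
    at the corner [a + (s, ..., s)] is exactly the summability of [M], because every monomial there
    has absolute value [s] to the power of its degree. *)
Lemma real_analytic_germ n (D : set 'rV[R]_n) f a : real_analytic_on D f -> D a ->
  analytic_at (a 0) (fun y => f (\row_i y i)).
Proof.
move=> hf Da; have [r [r0 [c hc]]] := hf a Da.
(* The cube of this radius lies in the ball of radius [r], as [n * s ^+ 2 < r ^+ 2]. *)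
pose s := r / n.+1%:R.
have s0 : 0 < s by rewrite divr_gt0.
have hball (y : 'I_n -> R) : cube (a 0) s y -> enorm (\row_i y i - a) < r.
  move=> hy; apply: enorm_lt => //.
  apply: (@le_lt_trans _ _ (\sum_(i < n) s ^+ 2)).
    apply: ler_sum => i _; rewrite !mxE -real_normK ?num_real//.
    by rewrite lerXn2r ?nnegrE ?(ltW s0)//; exact: hy.
  rewrite sumr_const card_ord -mulr_natl /s expr_div_n.
  rewrite mulrCA gtr_pMr ?exprn_gt0// ltr_pdivrMr ?exprn_gt0// mul1r -natrX ltr_nat.
  by rewrite expnS expn1 (leq_trans (ltnSn n))// leq_pmulr.
pose p k (y : 'I_n -> R) := sum_deg k (fun al => c al * monomial al a (\row_i y i)).
pose M k := sum_deg k (fun al => `|c al| * \prod_(i < n) s ^+ al i) : R.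
have hp k : inB (a 0) s (M k) (p k).
  rewrite /M /p /sum_deg; apply: inB_bigsum => // al _.
  apply: inB_scale; first exact: ltW.
  rewrite /monomial; apply: (@eq_inB _ _ _ _ _ (fun y => \prod_(i < n) (y i - a 0 i) ^+ al i)).
    by move=> y _; apply: eq_bigr => i _; rewrite mxE.
  by apply: inB_bigprod => // i; apply: inB_exp => //; apply: inB_var; exact: ltW.
have [N hN] : exists N, bnd M N.
  apply: bnd_cvg_series.
  pose y : 'I_n -> R := fun i => a 0 i + s.
  have hy : cube (a 0) s y by move=> i; rewrite /y addrC addKr gtr0_norm.
  have [_ [+ _]] := hc _ (hball _ hy).
  rewrite (_ : (fun n => _) = fun N => \sum_(k < N) `|M k|)//.
  apply/funext => m; apply: eq_bigr => k _.
  rewrite ger0_norm; last first.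
    by apply: sumr_ge0 => al _; rewrite mulr_ge0// prodr_ge0// => i _; rewrite exprn_ge0// ltW.
  apply: eq_bigr => al _; rewrite normrM; congr (_ * _).
  rewrite /monomial normr_prod; apply: eq_bigr => i _.
  by rewrite !mxE /y addrC addKr normrX gtr0_norm.
exists s => //; exists N.
apply: (@eq_inB _ _ _ _ _ (fun y => tot (fun k => p k y))); last exact: inB_sum hp hN.
move=> y hy; have [_ [_ cv]] := hc _ (hball _ hy).
have bp : bnd (fun k => p k y) N.
  apply: bnd_le hN => k; apply: le_trans (ler_norm _).
  exact: inB_bound (ltW s0) (hp k) hy.
exact: (cvg_unique _ (tot_series bp) cv).
Qed.

Definition content {n : nat} (w : seq 'I_n) (al : 'I_n -> nat) : bool :=
  [forall i, count_mem i w == al i].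

Lemma contentP {n : nat} (w : seq 'I_n) (al : 'I_n -> nat) :
  reflect (forall i, count_mem i w = al i) (content w al).
Proof. by apply: (iffP forallP) => h i; [exact/eqP/h|apply/eqP/h]. Qed.

Lemma sum_count_mem {n : nat} (w : seq 'I_n) :
  (\sum_(i < n) count_mem i w)%N = size w.
Proof.
elim: w => [|x w ih] /=; first by rewrite big1.
rewrite big_split/= ih (bigD1 x)//= eqxx big1 ?addn0// => i ix.
by rewrite eq_sym (negPf ix).
Qed.

Lemma prod_count_mem {n : nat} (w : seq 'I_n) (z : 'I_n -> R) :
  \prod_(x <- w) z x = \prod_(i < n) z i ^+ count_mem i w.
Proof.
elim: w => [|x w ih] /=; first by rewrite big_nil big1.
rewrite big_cons ih.
under [RHS]eq_bigr do rewrite exprD.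
rewrite big_split/=; congr (_ * _).
rewrite (bigD1 x)//= eqxx expr1 big1 ?mulr1// => i ix.
by rewrite eq_sym (negPf ix).
Qed.

(** The words of length [k] are exactly those whose content is a multi-index of degree [k], and
    every word has one content. *)
Lemma tot_content {n : nat} (d : seq 'I_n -> R) N k : bnd d N ->
  sum_deg k (fun al => tot (fun w => if content w al then d w else 0)) =
  tot (fun w => if size w == k then d w else 0).
Proof.
move=> bd; rewrite /sum_deg.
have bal (al : {ffun 'I_n -> 'I_k.+1}) :
    bnd (fun w => if content w (fun i => nat_of_ord (al i)) then d w else 0) N.
  by apply: bnd_le bd => w; case: ifP; rewrite ?normr0.
have [_ <-] := @bnd_sum R (seq 'I_n) _ (index_enum {ffun 'I_n -> 'I_k.+1})
  (fun al => (\sum_(i < n) (al i : nat))%N == k) _ (fun=> N) (fun al _ => bal al).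
apply: eq_tot => w; case: eqP => [sw|sw].
  have hc i : (count_mem i w < k.+1)%N by rewrite ltnS -sw count_size.
  pose al0 : {ffun 'I_n -> 'I_k.+1} := [ffun i => Ordinal (hc i)].
  rewrite (bigD1 al0)/=; last first.
    apply/eqP; transitivity (size w) => //; rewrite -sum_count_mem.
    by apply: eq_bigr => i _; rewrite ffunE.
  rewrite ifT; last by apply/contentP => i; rewrite ffunE.
  rewrite big1 ?addr0// => al /andP[_ ne]; case: contentP => // h; case/negP: ne.
  by apply/eqP/ffunP => i; apply: val_inj; rewrite ffunE /= h.
rewrite big1// => al /eqP hal; case: contentP => // h; case: sw.
by rewrite -hal -sum_count_mem; apply: eq_bigr => i _; rewrite h.
Qed.

Lemma sum_tot_size {V : finType} (d : seq V -> R) N m : bnd d N ->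
  \sum_(k < m) tot (fun w => if size w == k then d w else 0) =
  tot (fun w => if (size w < m)%N then d w else 0).
Proof.
move=> bd.
have bk (k : 'I_m) : bnd (fun w => if size w == k then d w else 0) N.
  by apply: bnd_le bd => w; case: ifP; rewrite ?normr0.
have [_ <-] := @bnd_sum R (seq V) _ (index_enum 'I_m) xpredT _ (fun=> N) (fun k _ => bk k).
apply: eq_tot => w; case: ltnP => h.
  rewrite (bigD1 (Ordinal h))//= eqxx big1 ?addr0// => k /negPf.
  by rewrite -val_eqE /= eq_sym => ->.
by rewrite big1// => k _; rewrite gtn_eqF// (leq_trans (ltn_ord k)).
Qed.

(** Words with the same content have the same monomial, because the values of the variables commute;
    so their coefficients are added. Regrouping an absolutely summable family in this way preserves
    absolute convergence and the sum. *)
Lemma germ_real_analytic n (D : set 'rV[R]_n) f :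
  (forall a, D a -> exists2 r, 0 < r & forall x, enorm (x - a) < r -> D x) ->
  (forall a, D a -> analytic_at (a 0) (fun y => f (\row_i y i))) ->
  real_analytic_on D f.
Proof.
move=> oD af a Da; have [r r0 hr] := oD a Da.
have [s s0 [N [c bc fE]]] := af a Da.
exists (Num.min r s); split; first by rewrite lt_min r0.
pose C (al : 'I_n -> nat) := tot (fun w => if content w al then c w else 0).
exists C => x; rewrite lt_min => /andP[xr xs].
split; first exact: hr.
have hx : cube (a 0) s (x 0).
  by move=> i; have := coord_enorm (x - a) i; rewrite !mxE => h; apply: le_trans h (ltW xs).
pose d w := c w * \prod_(i <- w) (x 0 i - a 0 i).
have bd : bnd d N by exact: bnd_word hx (ltW s0) bc.
have bC al : exists M, bnd (fun w => if content w al then c w else 0) M.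
  exists (`|s ^- (\sum_(i < n) al i)| * N).
  apply: bnd_le (bndZ (s ^- (\sum_(i < n) al i)) bc) => w.
  case: contentP => [h|_]; last by rewrite normr0.
  have -> : (\sum_(i < n) al i)%N = size w.
    by rewrite -sum_count_mem; apply: eq_bigr => i _; rewrite h.
  by rewrite mulrC mulfK// expf_neq0// gt_eqF.
have CE al : C al * monomial al a x = tot (fun w => if content w al then d w else 0).
  have [M bM] := bC al.
  rewrite mulrC -(totZ _ bM); apply: eq_tot => w; case: contentP => [h|_]; last by rewrite mulr0.
  rewrite mulrC /d prod_count_mem; congr (_ * _).
  by apply: eq_bigr => i _; rewrite h.
have babs : bnd (fun w => `|d w|) N by apply: bnd_le bd => w; rewrite normr_id.
split; last first.
  rewrite (_ : (fun m => _) = fun m => tot (fun w => if (size w < m)%N then d w else 0)).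
    rewrite (_ : f x = tot d); first exact: tot_grading bd.
    by have := fE _ hx; rewrite rowK.
  apply/funext => m; rewrite -(sum_tot_size m bd); apply: eq_bigr => k _.
  by rewrite -(tot_content k bd); apply: eq_bigr => al _.
apply: nondecreasing_is_cvgn.
  move=> i j ij; rewrite -!(big_mkord xpredT (fun k => sum_deg k _)).
  rewrite (big_cat_nat (leq0n i) ij)//= lerDl sumr_ge0// => k _.
  by apply: sumr_ge0 => al _.
exists N => _ [m _ <-].
apply: (@le_trans _ _ (\sum_(k < m) tot (fun w => if size w == k then `|d w| else 0))).
  apply: ler_sum => k _; rewrite -(tot_content k babs); apply: ler_sum => al _.
  have b1 : bnd (fun w => if content w (fun i => nat_of_ord (al i)) then d w else 0) N.
    by apply: bnd_le bd => w; case: ifP; rewrite ?normr0.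
  rewrite CE; apply: le_trans (ler_norm_tot b1) _.
  rewrite (tot_ge0E (N := N)).
  - by rewrite (@eq_ns _ _ _ (fun w => if content w (fun i => nat_of_ord (al i)) then `|d w| else 0))//
      => w; case: ifP => _; rewrite ?normr_id.
  - by apply: bnd_le bd => w; case: ifP; rewrite ?normr0 ?normr_id.
  - by move=> w; case: ifP.
rewrite (sum_tot_size m babs); apply: le_trans (ler_norm _) _; apply: ler_tot.
by apply: bnd_le babs => w; case: ifP; rewrite ?normr0.
Qed.

End MultiIndices.

(** * Construction of the field up to a multiple of the cutoff *)

Section Construction.
Context {R : realType}.

Notation deriv f x d := (is_derive (x : R) (1 : R) (f : R -> R) (d : R)).

Definition rad {V : finType} (x : V -> R) : R := Num.sqrt (nsq x).

Lemma rad_gt0 {V : finType} (x : V -> R) : (0 < rad x) = (0 < nsq x).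
Proof. exact: sqrtr_gt0. Qed.

Lemma radZ {V : finType} (x : V -> R) l : 0 <= l -> rad (fun v => l * x v) = l * rad x.
Proof.
move=> l0; rewrite /rad (_ : nsq _ = l ^+ 2 * nsq x).
  by rewrite sqrtrM ?sqr_ge0// sqrtr_sqr ger0_norm.
by rewrite /nsq mulr_sumr; apply: eq_bigr => v _; rewrite exprMn.
Qed.

Lemma analytic_rad {V : finType} (x : V -> R) : 0 < nsq x -> analytic_at x rad.
Proof.
by move=> x0; apply: (analyticR_comp (analyticR_sqrt x0)); exact: analytic_nsq.
Qed.

Lemma rad_sq {V : finType} (x : V -> R) : rad x ^+ 2 = nsq x.
Proof. by rewrite sqr_sqrtr// nsq_ge0. Qed.

Definition dirn {V : finType} (x : V -> R) : V -> R := fun v => x v / rad x.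

Lemma dirnZ {V : finType} (x : V -> R) l : 0 < l -> dirn (fun v => l * x v) = dirn x.
Proof.
move=> l0; apply/funext => v; rewrite /dirn radZ ?ltW// invfM mulrACA divff ?mul1r//.
by rewrite gt_eqF.
Qed.

Lemma rad_dirn {V : finType} (x : V -> R) s : 0 <= s -> 0 < nsq x ->
  rad (fun v => s * dirn x v) = s.
Proof.
move=> s0 x0; have r0 : 0 < rad x by rewrite rad_gt0.
rewrite radZ// (_ : dirn x = fun v => (rad x)^-1 * x v); last first.
  by apply/funext => v; rewrite /dirn mulrC.
by rewrite radZ ?invr_ge0 ?ltW// mulVf ?mulr1// gt_eqF.
Qed.

Lemma dirnE {V : finType} (x : V -> R) s : (fun v => s * dirn x v) = fun v => s / rad x * x v.
Proof. by apply/funext => v; rewrite /dirn; ring. Qed.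

Lemma dirn_rad {V : finType} (x : V -> R) : 0 < nsq x -> (fun v => rad x * dirn x v) = x.
Proof.
move=> x0; apply/funext => v; rewrite /dirn mulrC divfK// gt_eqF//.
by rewrite rad_gt0.
Qed.

Lemma analytic_dirn {V V' : finType} (p : V' -> R) (u : V -> (V' -> R) -> R) v :
  0 < nsq (fun k => u k p) -> (forall k, analytic_at p (u k)) ->
  analytic_at p (fun y => dirn (fun k => u k y) v).
Proof.
move=> x0 au; apply: analytic_mul => //.
apply: (@analyticR_comp _ _ _ (fun t => t^-1) (fun y => rad (fun k => u k y))).
  by apply: analyticR_inv; rewrite gt_eqF// rad_gt0.
by apply: (@analytic_comp _ _ _ p rad u) => //; exact: analytic_rad.
Qed.

Lemma pd_nsq {V : finType} (x : V -> R) k : pd nsq x k = 2 * x k.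
Proof.
apply: pdE; rewrite (_ : (fun t => _) = fun t => t ^+ 2 + \sum_(v | v != k) x v ^+ 2).
  apply: deriv_eq (derivD (derivX 2 (deriv_id (x k))) (deriv_cst _ _)).
  by rewrite /= expr1 mulr1 addr0.
apply/funext => t; rewrite /nsq (bigD1 k)//= /upd eqxx; congr (_ + _).
by apply: eq_bigr => v /negPf ->.
Qed.

Lemma pd_var {V : finType} (x : V -> R) k : pd (fun y => y k) x k = 1.
Proof.
apply: pdE; rewrite (_ : (fun t => _) = fun t => t); first exact: deriv_id.
by apply/funext => t; rewrite /upd eqxx.
Qed.

Lemma analytic2_ray {V : finType} (n : nat) (g : (V -> R) -> R) (a b s : R) x :
  0 <= a -> (forall x, a < rad x < b -> analytic_at x g) -> a < s < b -> 0 < nsq x ->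
  analytic2 (fun s x => s ^+ n * g (fun v => s * dirn x v)) s x.
Proof.
move=> a0 ag hs x0; have s0 : 0 <= s by case/andP: hs => h _; exact: le_trans a0 (ltW h).
rewrite /analytic2 /un2; apply: analytic_mul.
  by apply: analytic_exp; exact: analytic_var.
apply: (@analytic_comp _ _ _ _ g (fun v y => y None * dirn (fun k => y (Some k)) v)).
  move=> v; apply: analytic_mul; first exact: analytic_var.
  by apply: analytic_dirn => // k; exact: analytic_var.
by apply: ag; rewrite rad_dirn.
Qed.

Section Field.
Variables (n : nat) (R1 R2 de : R) (f : ('I_n.+1 -> R) -> R).
Hypotheses (n0 : (0 < n)%N) (R10 : 0 < R1) (R12 : R1 < R2) (de01 : 0 < de < 1).
Notation r1 := (R1 * (1 - de)).
Notation r2 := (R2 * (1 + de)).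
Hypothesis af : forall x, r1 < rad x < r2 -> analytic_at x f.
Implicit Types x : 'I_n.+1 -> R.

Lemma inner_radius : 0 < r1 < R1.
Proof.
case/andP: de01 => h1 h2; have h3 := mulr_gt0 R10 h1.
have h4 : 0 < R1 * (1 - de) by rewrite mulr_gt0// subr_gt0.
by rewrite h4 /=; lra.
Qed.

Lemma outer_radius : R2 < r2.
Proof. by case/andP: de01 => h1 h2; have := R10; have := R12; move=> ? ?; nra. Qed.

Lemma annulus_nz x : r1 < rad x -> 0 < nsq x.
Proof. by case/andP: inner_radius => h _ h'; rewrite -rad_gt0 (lt_trans h h'). Qed.

(** The space has dimension [n.+1], hence the polar density [s ^+ n]. *)
Definition ray_integral x : R := Int R1 R2 (fun s => s ^+ n * f (fun v => s * dirn x v)).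

Lemma segment_annulus s : R1 <= s <= R2 -> r1 < s < r2.
Proof.
case/andP: inner_radius => _ h1 /andP[h2 h3]; rewrite (lt_le_trans h1 h2).
by rewrite (le_lt_trans h3 outer_radius).
Qed.

Lemma r1_ge0 : 0 <= r1. Proof. by case/andP: inner_radius => /ltW. Qed.

Lemma analytic0_ray_integral : analytic0 ray_integral.
Proof.
move=> x x0; have [_] := @analytic_Int R 'I_n.+1
  (fun s x => s ^+ n * f (fun v => s * dirn x v)) R1 R2 x (ltW R12)
  (fun s hs => analytic2_ray n r1_ge0 af (segment_annulus hs) x0).
by [].
Qed.

Lemma homog0_ray_integral : homog0 ray_integral.
Proof. by move=> x l x0 l0; rewrite /ray_integral dirnZ. Qed.

Definition wt (s : R) : R := s ^+ n * ((s ^+ 2 - R1 ^+ 2) * (R2 ^+ 2 - s ^+ 2)).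
Definition wtZ : R := Int R1 R2 wt.

Lemma wt_primitive : exists G, primitive_on R1 R2 wt G.
Proof.
apply: primitive_ex => s _; apply: analyticR_continuous; rewrite /analyticR /wt.
have av : analytic_at (fun _ : unit => s) (fun y => y tt) by exact: analytic_var.
apply: analytic_mul; first exact: analytic_exp.
by apply: analytic_mul; apply: analytic_sub;
  do ?[exact: analytic_cst|exact: analytic_exp].
Qed.

Lemma wtZ_gt0 : 0 < wtZ.
Proof.
apply: (Int_gt0 R12 wt_primitive) => s /andP[h1 h2].
have s0 := lt_trans R10 h1.
by rewrite /wt mulr_gt0 ?exprn_gt0// mulr_gt0// subr_gt0 ltrXn2r// ?nnegrE ltW.
Qed.

Definition cutoff x : R := wtZ^-1 * ((nsq x - R1 ^+ 2) * (R2 ^+ 2 - nsq x)).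

Lemma analytic_cutoff x : analytic_at x cutoff.
Proof.
apply: analytic_scale; have h := analytic_nsq x.
by apply: analytic_mul; apply: analytic_sub => //; exact: analytic_cst.
Qed.

(** A radial function has a gradient proportional to [x], thus orthogonal to tangential fields. *)
Lemma pd_cutoff x k : pd cutoff x k =
  wtZ^-1 * (2 * (R2 ^+ 2 - nsq x) - (nsq x - R1 ^+ 2) * 2) * x k.
Proof.
have dn : deriv (fun t => nsq (upd x k t)) (x k) (2 * x k).
  by rewrite -pd_nsq; apply: analytic_deriv; exact: analytic_nsq.
apply: pdE; apply: deriv_eq (derivZ wtZ^-1 (derivM (derivB dn (deriv_cst (R1 ^+ 2) _))
  (derivB (deriv_cst (R2 ^+ 2) _) dn))).
by rewrite updE; ring.
Qed.

Definition remainder x : R := f x - cutoff x * ray_integral x.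

Lemma analytic_remainder x : r1 < rad x < r2 -> analytic_at x remainder.
Proof.
move=> hx; apply: analytic_sub; first exact: af.
apply: analytic_mul; first exact: analytic_cutoff.
by apply: analytic0_ray_integral; apply: annulus_nz; case/andP: hx.
Qed.

Let rint_ray x s : R := s ^+ n * remainder (fun v => s * dirn x v).

(** The integral of [rint_ray x] from [R1] to [rad x], rescaled to [[0, 1]]: the upper limit becomes
    a parameter of the integrand, as [analytic_Int] requires. *)
Definition flux x : R :=
  Int 0 1 (fun t => (rad x - R1) * rint_ray x (R1 + t * (rad x - R1))).

Lemma flux_between x t : r1 < rad x < r2 -> 0 <= t <= 1 ->
  r1 < R1 + t * (rad x - R1) < r2.
Proof.
case/andP: inner_radius => _ h1; have h2 := outer_radius; have := R12.
move=> h12 /andP[h3 h4] /andP[t0 t1].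
have e : R1 + t * (rad x - R1) = (1 - t) * R1 + t * rad x by ring.
rewrite e; apply/andP; split.
  have := mulr_ge0 t0 (ltW (_ : 0 < rad x - r1)); rewrite subr_gt0 => /(_ h3) ?.
  have : 0 <= (1 - t) * (R1 - r1) by rewrite mulr_ge0//; lra.
  case: (eqVneq t 0) => [->|t00]; first by nra.
  have tt : 0 < t by rewrite lt_neqAle eq_sym t00.
  have : 0 < t * (rad x - r1) by rewrite mulr_gt0// subr_gt0.
  by nra.
case: (eqVneq t 0) => [->|t00]; first by nra.
have tt : 0 < t by rewrite lt_neqAle eq_sym t00.
have : 0 < t * (r2 - rad x) by rewrite mulr_gt0// subr_gt0.
have : 0 <= (1 - t) * (r2 - R1) by rewrite mulr_ge0//; lra.
by nra.
Qed.

Lemma analytic_flux x : r1 < rad x < r2 -> analytic_at x flux.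
Proof.
move=> hx; have x0 : 0 < nsq x by apply: annulus_nz; case/andP: hx.
have [|_] := @analytic_Int R 'I_n.+1 (fun t x => (rad x - R1) *
  rint_ray x (R1 + t * (rad x - R1))) 0 1 x ler01; last by [].
move=> t ht; rewrite /analytic2 /un2.
have arad : analytic_at (ocons t x) (fun y => rad (fun v => y (Some v)) - R1).
  apply: analytic_sub; last exact: analytic_cst.
  apply: (@analytic_comp _ _ _ _ rad (fun v y => y (Some v))); last exact: analytic_rad.
  by move=> v; exact: analytic_var.
apply: analytic_mul => //.
apply: (@analytic_comp _ _ _ _
  (un2 (fun s x => s ^+ n * remainder (fun v => s * dirn x v)))
  (fun o y => ocons (R1 + y None * (rad (fun v => y (Some v)) - R1)) (fun v => y (Some v)) o)).
  case=> [v|] /=; first exact: analytic_var.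
  apply: analytic_add; first exact: analytic_cst.
  by apply: analytic_mul => //; exact: analytic_var.
exact: (analytic2_ray n r1_ge0 analytic_remainder (flux_between hx ht) x0).
Qed.

(** The segment has [R1] and [rad x] in its interior, in whichever order they come, so that the
    primitive also computes [flux] at nearby multiples of [x]. *)
Lemma ray_primitive x : r1 < rad x < r2 -> exists a b S,
  [/\ r1 < a, a < R1, a < rad x, R1 < b & rad x < b] /\
  (forall s, a <= s <= b -> deriv S s (rint_ray x s)).
Proof.
move=> hx; have x0 : 0 < nsq x by apply: annulus_nz; case/andP: hx.
case/andP: inner_radius => _ h1; have h2 := outer_radius; have h3 := R12.
case/andP: hx => hx1 hx2.
have [a [a1 a2 a3]] : exists a, [/\ r1 < a, a < R1 & a < rad x].
  by case: (leP R1 (rad x)) => h; [exists ((r1 + R1) / 2)|exists ((r1 + rad x) / 2)]; split; lra.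
have [b [b1 b2 b3]] : exists b, [/\ b < r2, R1 < b & rad x < b].
  by case: (leP R1 (rad x)) => h; [exists ((r2 + rad x) / 2)|exists ((r2 + R1) / 2)]; split; lra.
have ab : a <= b by lra.
have [|S hS] := @primitive_ex R a b (rint_ray x).
  move=> s; rewrite (min_idPl ab) (max_idPr ab) => /andP[as_ sb].
  have hs : r1 < s < r2 by rewrite (lt_le_trans a1 as_) (le_lt_trans sb b1).
  exact: (analytic2_continuous (analytic2_ray n r1_ge0 analytic_remainder hs x0)).
exists a, b, S; split => // s hs; apply: hS.
by rewrite (min_idPl ab) (max_idPr ab).
Qed.

Lemma fluxE x y a b S : 0 < nsq x -> dirn y = dirn x -> a <= R1 <= b -> a <= rad y <= b ->
  (forall s, a <= s <= b -> deriv S s (rint_ray x s)) ->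
  flux y = S (rad y) - S R1.
Proof.
move=> x0 e /andP[h1 h2] /andP[h3 h4] hS.
rewrite /flux (@IntE _ _ _ _ (fun t => S (R1 + t * (rad y - R1)))).
  by rewrite mul1r mul0r addr0 (addrC R1) subrK.
move=> t; rewrite (min_idPl ler01) (max_idPr ler01) => /andP[t0 t1].
have hs : a <= R1 + t * (rad y - R1) <= b by apply/andP; split; nra.
have d1 : deriv (fun t => R1 + t * (rad y - R1)) t (rad y - R1).
  apply: deriv_eq (derivD (deriv_cst R1 t) (derivM (deriv_id t) (deriv_cst (rad y - R1) t))).
  by ring.
have := @deriv_comp R S (fun t => R1 + t * (rad y - R1)) t _ _ (hS _ hs) d1.
by apply: deriv_eq; rewrite mulrC /rint_ray e.
Qed.

Lemma flux_inner x : rad x = R1 -> flux x = 0.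
Proof.
move=> e; have hx : r1 < rad x < r2.
  by rewrite e; apply: segment_annulus; rewrite lexx ltW.
have x0 : 0 < nsq x by apply: annulus_nz; case/andP: hx.
have [a [b [S [[h1 h2 h3 h4 h5] hS]]]] := ray_primitive hx.
by rewrite (fluxE x0 erefl _ _ hS) ?e ?subrr// !ltW.
Qed.

(** Along a ray [ray_integral] is constant and comes out of the integral; by the normalization of
    the cutoff, what remains is [ray_integral x - ray_integral x]. *)
Lemma flux_outer x : rad x = R2 -> flux x = 0.
Proof.
move=> e; have hx : r1 < rad x < r2.
  by rewrite e; apply: segment_annulus; rewrite lexx ltW.
have x0 : 0 < nsq x by apply: annulus_nz; case/andP: hx.
have [a [b [S [[h1 h2 h3 h4 h5] hS]]]] := ray_primitive hx.
rewrite (fluxE x0 erefl _ _ hS) ?ltW//= e.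
have -> : S R2 - S R1 = Int R1 R2 (rint_ray x).
  rewrite (@IntE _ _ _ _ S)// => s; rewrite (min_idPl (ltW R12)) (max_idPr (ltW R12)).
  move=> /andP[s1 s2]; apply: hS; rewrite (le_trans (ltW h2) s1) (le_trans s2)// -e ltW//.
have Fs s : 0 < s -> ray_integral (fun v => s * dirn x v) = ray_integral x.
  by move=> s0; rewrite dirnE homog0_ray_integral// divr_gt0// rad_gt0.
have [G hG] := wt_primitive.
have [|G' hG'] := @primitive_ex R R1 R2 (fun s => s ^+ n * f (fun v => s * dirn x v)).
  move=> s; rewrite (min_idPl (ltW R12)) (max_idPr (ltW R12)) => hs.
  exact: (analytic2_continuous (analytic2_ray n r1_ge0 af (segment_annulus hs) x0)).
rewrite (@eq_Int _ _ _ _ (fun s => s ^+ n * f (fun v => s * dirn x v)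
  - (wtZ^-1 * ray_integral x) * wt s)); last first.
  move=> s; rewrite (min_idPl (ltW R12)) (max_idPr (ltW R12)) => /andP[s1 s2].
  have s0 := lt_le_trans R10 s1.
  rewrite /rint_ray /remainder Fs// /cutoff -rad_sq rad_dirn ?(ltW s0)// /wt; ring.
rewrite IntB; [|by exists G'|]; last first.
  by exists (fun s => wtZ^-1 * ray_integral x * G s) => s hs; apply: derivZ; exact: hG.
rewrite IntZ; last exact: wt_primitive.
rewrite -/wtZ -/(ray_integral x) mulrAC mulVf ?mul1r ?subrr// gt_eqF//.
exact: wtZ_gt0.
Qed.

Definition radial_coef x : R := (rad x) ^- n.+1 * flux x.

Lemma analytic_radial_coef x : r1 < rad x < r2 -> analytic_at x radial_coef.
Proof.
move=> hx; have x0 : 0 < nsq x by apply: annulus_nz; case/andP: hx.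
apply: analytic_mul; last exact: analytic_flux.
apply: (@analyticR_comp _ _ _ (fun t => t^-1) (fun y => rad y ^+ n.+1)).
  by apply: analyticR_inv; rewrite expf_neq0// gt_eqF// rad_gt0.
by apply: analytic_exp; exact: analytic_rad.
Qed.

(** Write [K] for [radial_coef]. The divergence of [K x] is [(n + 1) K] plus the derivative of [K]
    along [x], that is, of [K (t x)] at [t = 1]. In the latter the power of [rad] contributes
    [- (n + 1) K], and differentiating the flux by its upper limit leaves the remainder. *)
Lemma radial_divergence x : r1 < rad x < r2 ->
  \sum_k pd (fun y => radial_coef y * y k) x k = remainder x.
Proof.
move=> hx; have x0 : 0 < nsq x by apply: annulus_nz; case/andP: hx.
have rx0 : 0 < rad x by rewrite rad_gt0.
have aK := analytic_radial_coef hx.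
rewrite (eq_bigr (fun k => pd radial_coef x k * x k + radial_coef x)); last first.
  by move=> k _; rewrite pdM ?pd_var ?mulr1//; exact: analytic_var.
rewrite big_split/= sumr_const card_ord.
have [a [b [S [[h1 h2 h3 h4 h5] hS]]]] := ray_primitive hx.
have dv k : deriv (fun t => t * x k) 1 (x k).
  by apply: deriv_eq (derivM (deriv_id 1) (deriv_cst (x k) 1)); rewrite mul1r mulr0 addr0.
have x1 : (fun v => 1 * x v) = x by apply/funext => v; rewrite mul1r.
have := @chain_rule R _ radial_coef (fun v t => t * x v) x 1; rewrite x1 => /(_ aK dv) e1.
have d1 : deriv (fun t => (t * rad x) ^- n.+1 * (S (t * rad x) - S R1)) 1
    (- (n.+1%:R * radial_coef x) + remainder x).
  have dr : deriv (fun t => t * rad x) 1 (rad x).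
    by apply: deriv_eq (derivM (deriv_id 1) (deriv_cst (rad x) 1)); rewrite mul1r mulr0 addr0.
  have dS : deriv (fun t => S (t * rad x)) 1 (rint_ray x (rad x) * rad x).
    apply: (@deriv_comp R S (fun t => t * rad x) 1) dr.
    by rewrite mul1r; apply: hS; rewrite !ltW.
  have dX := derivX n.+1 dr.
  have nz : (1 * rad x) ^+ n.+1 != 0 by rewrite mul1r expf_neq0// gt_eqF.
  have dV := @is_deriveV R (fun t => (t * rad x) ^+ n.+1) 1 _ 1 nz dX.
  apply: deriv_eq (derivM dV (derivB dS (deriv_cst (S R1) 1))).
  rewrite subr0 !mul1r /radial_coef (fluxE x0 erefl _ _ hS) ?ltW//.
  rewrite /rint_ray dirn_rad//= /GRing.scale/=.
  set r := rad x in rx0 *; have r0 : r != 0 by rewrite gt_eqF.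
  have rn : r ^+ n != 0 by rewrite expf_neq0.
  rewrite !exprS; set s := S r - S R1; set h := remainder x.
  move: (r ^+ n) rn => rn rn0.
  rewrite -[n.+1%:R]natr1 /=; move: (n%:R) => m.
  by field; rewrite r0 rn0.
have d2 : deriv (fun t => radial_coef (fun v => t * x v)) 1
    (- (n.+1%:R * radial_coef x) + remainder x).
  (* Keeps [t] positive and [t * rad x] between [a] and [b], where [S] computes the flux. *)
  pose e := Num.min 1 (Num.min ((b - rad x) / rad x) ((rad x - a) / rad x)).
  have e0 : 0 < e by rewrite !lt_min ltr01 !divr_gt0// subr_gt0.
  apply: (deriv_near e0 _ d1) => t; rewrite !lt_min => /andP[t1 /andP[tb ta]].
  have t0 : 0 < t by move: t1; rewrite ltr_norml => /andP[]; lra.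
  have rt : rad (fun v => t * x v) = t * rad x by rewrite radZ// ltW.
  have hR : a <= R1 <= b by rewrite !ltW.
  have ht : a <= rad (fun v => t * x v) <= b.
    move: tb ta; rewrite rt !ltr_pdivlMr// => tb ta.
    have := ler_norm (t - 1); have := ler_norm (1 - t); rewrite (distrC 1) => n1 n2.
    by apply/andP; split; nra.
  by rewrite /radial_coef (fluxE x0 (dirnZ _ t0) hR ht hS) rt.
rewrite (deriv_uniq e1 d2) -mulr_natl; ring.
Qed.

Theorem divergence_modulo_cutoff : exists c, exists U : 'I_n.+1 -> ('I_n.+1 -> R) -> R,
  [/\ forall k x, r1 < rad x < r2 -> analytic_at x (U k),
      forall x, r1 < rad x < r2 -> \sum_k pd (U k) x k = f x - c * cutoff x &
      forall k x, rad x = R1 \/ rad x = R2 -> U k x = 0].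
Proof.
have [c [W [aW dW tW]]] := tdiv_sphere n0 analytic0_ray_integral homog0_ray_integral.
exists c, (fun k x => cutoff x * W k x + radial_coef x * x k); split.
- move=> k x hx; have x0 : 0 < nsq x by apply: annulus_nz; case/andP: hx.
  apply: analytic_add; apply: analytic_mul.
  + exact: analytic_cutoff.
  + exact: aW.
  + exact: analytic_radial_coef.
  + exact: analytic_var.
- move=> x hx; have x0 : 0 < nsq x by apply: annulus_nz; case/andP: hx.
  rewrite (eq_bigr (fun k => (pd cutoff x k * W k x + cutoff x * pd (W k) x k) +
    pd (fun y => radial_coef y * y k) x k)); last first.
    have ac := analytic_cutoff x; have ar := analytic_radial_coef hx.
    move=> k _; have aw := aW k x x0; have av := analytic_var x k.
    by rewrite pdD; [rewrite (pdM _ ac aw)| |]; first by []; exact: analytic_mul.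
  rewrite big_split/= radial_divergence// big_split/= -mulr_sumr dW//.
  rewrite (eq_bigr (fun k => wtZ^-1 * (2 * (R2 ^+ 2 - nsq x) - (nsq x - R1 ^+ 2) * 2) *
    (x k * W k x))); last by move=> k _; rewrite pd_cutoff mulrA.
  by rewrite -mulr_sumr tW// mulr0 add0r /remainder; ring.
- move=> k x hx; rewrite /cutoff /radial_coef -rad_sq.
  by case: hx => e; rewrite e ?(flux_inner e) ?(flux_outer e) subrr !(mulr0, mul0r) addr0.
Qed.

End Field.
End Construction.

(** * Integrals over the line of Lipschitz functions with compact support *)

Section LineIntegral.
Context {R : realType}.

Notation deriv f x d := (is_derive (x : R) (1 : R) (f : R -> R) (d : R)).
Notation mu := (@lebesgue_measure R).

Definition RI (f : R -> R) : R := Rintegral mu setT f.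

(* No measurability is needed: the integral is a supremum over simple functions. *)
Lemma nonneg_le_integral (f g : R -> \bar R) :
  (forall x, 0 <= f x)%E -> (forall x, f x <= g x)%E ->
  (\int[mu]_x f x <= \int[mu]_x g x)%E.
Proof.
move=> f0 fg.
have g0 x : (0 <= g x)%E by exact: le_trans (f0 x) (fg x).
rewrite !ge0_integralE// !patch_setT; apply: ereal_sup_le => _ [h hf <-].
by exists h => // x; apply: le_trans (hf x) (fg x).
Qed.

Lemma patch_support (f : R -> R) (a b : R) : (forall t, ~~ (a <= t <= b) -> f t = 0) ->
  (fun x => (f x)%:E) \_ `[a, b]%classic = (fun x => (f x)%:E).
Proof.
move=> h; apply/funext => t; rewrite patchE.
case: ifPn => //; rewrite notin_setE /= in_itv/= => /negP ht.
by rewrite h.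
Qed.

Lemma continuous_integrable (f : R -> R) (a b : R) : (forall t, {for t, continuous f}) ->
  (forall t, ~~ (a <= t <= b) -> f t = 0) -> mu.-integrable setT (fun x => (f x)%:E).
Proof.
move=> cf h.
have h1 : {within `[a, b], continuous f} by apply: continuous_subspaceT => x; exact: cf.
have h2 := continuous_compact_integrable (@segment_compact _ a b) h1.
have mab : measurable (`[a, b]%classic : set (measurableTypeR R)) by [].
have h3 := (@integrable_mkcond _ _ R mu _ _ mab).1 h2.
by rewrite (patch_support h) in h3.
Qed.

Lemma RI_Int (f : R -> R) (a b : R) : a < b -> (forall t, {for t, continuous f}) ->
  (forall t, ~~ (a <= t <= b) -> f t = 0) -> RI f = Int a b f.
Proof.
move=> ab cf h.
have [S hS] : exists S, primitive_on a b f S by apply: primitive_ex => t _; exact: cf.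
have hS' t : a <= t <= b -> deriv S t (f t).
  by move=> ht; apply: hS; rewrite (min_idPl (ltW ab)) (max_idPr (ltW ab)).
rewrite (IntE hS) /RI /Rintegral -(patch_support h) -integral_mkcond.
have cS t : a <= t <= b -> S x @[x --> t] --> S t.
  by move=> ht; have := deriv_continuous (hS' t ht).
rewrite (@continuous_FTC2 R f S a b ab)//.
- by apply: continuous_subspaceT => x; exact: cf.
- split.
  + by move=> x; rewrite in_itv/= => /andP[h1 h2]; have [] := hS' x _; rewrite ?ltW.
  + by apply: cvg_at_right_filter; apply: cS; rewrite lexx ltW.
  + by apply: cvg_at_left_filter; apply: cS; rewrite lexx ltW.
- move=> x; rewrite in_itv/= => /andP[h1 h2].
  by rewrite derive1E; have [|_ ->] := hS' x; rewrite ?ltW.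
Qed.

(** Monotonicity is applied to positive and negative parts separately; [l] and [u] make these
    integrals finite, as is needed to subtract them as reals. The function [g] may be discontinuous,
    as an extension by zero is. *)
Lemma RI_squeeze (l g u : R -> R) (a b : R) : (forall t, {for t, continuous l}) ->
  (forall t, {for t, continuous u}) -> (forall t, ~~ (a <= t <= b) -> l t = 0) ->
  (forall t, ~~ (a <= t <= b) -> u t = 0) -> (forall t, l t <= g t <= u t) ->
  RI l <= RI g <= RI u.
Proof.
move=> cl cu sl su lgu.
have il := continuous_integrable cl sl; have iu := continuous_integrable cu su.
pose e (f : R -> R) := fun x => (f x)%:E.
pose p f := (\int[mu]_x (e f)^\+ x)%E; pose m f := (\int[mu]_x (e f)^\- x)%E.
have lp : p l \is a fin_num by exact: integrable_pos_fin_num il.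
have lm : m l \is a fin_num by exact: integrable_neg_fin_num il.
have up : p u \is a fin_num by exact: integrable_pos_fin_num iu.
have um : m u \is a fin_num by exact: integrable_neg_fin_num iu.
have pmono f g' : (forall x, f x <= g' x) -> (p f <= p g')%E.
  move=> h; apply: nonneg_le_integral => x; first exact: funepos_ge0.
  by rewrite !funeposE /e ge_max !le_max lee_fin h lexx !orbT.
have mmono f g' : (forall x, f x <= g' x) -> (m g' <= m f)%E.
  move=> h; apply: nonneg_le_integral => x; first exact: funeneg_ge0.
  by rewrite !funenegE /e ge_max !le_max leeN2 lee_fin h lexx !orbT.
have p0 f : (0 <= p f)%E by apply: integral_ge0 => x _; exact: funepos_ge0.
have m0 f : (0 <= m f)%E by apply: integral_ge0 => x _; exact: funeneg_ge0.
have hl x : l x <= g x by case/andP: (lgu x).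
have hu x : g x <= u x by case/andP: (lgu x).
have gp : p g \is a fin_num.
  by rewrite ge0_fin_numE// (le_lt_trans (pmono _ _ hu))// -ge0_fin_numE.
have gm : m g \is a fin_num.
  by rewrite ge0_fin_numE// (le_lt_trans (mmono _ _ hl))// -ge0_fin_numE.
have RIE f : p f \is a fin_num -> m f \is a fin_num -> RI f = fine (p f) - fine (m f).
  by move=> h1 h2; rewrite /RI /Rintegral integralE -/(p f) -/(m f) fineB.
rewrite !RIE//; apply/andP; split; apply: lerB; apply: fine_le => //.
- exact: pmono.
- exact: mmono.
- exact: pmono.
- exact: mmono.
Qed.

Lemma Int_le_bound (f : R -> R) (a b M : R) : a <= b -> (exists G, primitive_on a b f G) ->
  (forall t, a <= t <= b -> `|f t| <= M) -> `|Int a b f| <= M * (b - a).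
Proof.
rewrite le_eqVlt => /predU1P[->|ab].
  by move=> [G hG] _; rewrite (IntE hG) !subrr normr0 mulr0.
move=> [G hG] hM; rewrite (IntE hG).
have hG' t : a <= t <= b -> deriv G t (f t).
  by move=> ht; apply: hG; rewrite (min_idPl (ltW ab)) (max_idPr (ltW ab)).
have [||c] := @MVT R G f a b ab.
- by move=> x; rewrite in_itv/= => /andP[ux xv]; apply: hG'; rewrite !ltW.
- apply: derivable_within_continuous => x; rewrite in_itv/= => hx.
  by have [] := hG' x hx.
rewrite in_itv/= => /andP[c1 c2] ->; rewrite normrM [X in _ * X]gtr0_norm ?subr_gt0//.
by rewrite ler_wpM2r ?subr_ge0 ?(ltW ab)//; apply: hM; rewrite !ltW.
Qed.

(** Integrating out all other coordinates of a Lipschitz function with compact support leads to this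
    class, with explicit constants, so that iterated integrals never leave it. *)
Definition lipc1 (B L : R) (f : R -> R) : Prop :=
  (forall s t, `|f s - f t| <= L * `|s - t|) /\ (forall t, B < `|t| -> f t = 0).

Lemma lipc1_continuous B L f t : 0 <= L -> lipc1 B L f -> {for t, continuous f}.
Proof.
move=> L0 [h _]; apply: continuous_eps => e e0; exists (e / (L + 1)).
  by rewrite divr_gt0// ltr_wpDl.
move=> z hz; apply: le_trans (h _ _) _; apply: (@le_trans _ _ ((L + 1) * `|z - t|)).
  by rewrite ler_wpM2r// lerDl.
by rewrite mulrC -ler_pdivlMr// ltr_wpDl.
Qed.

Lemma lipc1_support B L f : lipc1 B L f -> forall t, ~~ (- B <= t <= B) -> f t = 0.
Proof. by move=> [_ h] t; rewrite -ler_norml -ltNge => /h. Qed.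

Lemma RI_lipc1 B L f : 0 < B -> 0 <= L -> lipc1 B L f -> RI f = Int (- B) B f.
Proof.
move=> B0 L0 hf; apply: RI_Int; first by lra.
  by move=> t; apply: lipc1_continuous hf.
exact: lipc1_support hf.
Qed.

Lemma lipc1_primitive a b B L f : 0 <= L -> lipc1 B L f -> exists G, primitive_on a b f G.
Proof. by move=> L0 hf; apply: primitive_ex => t _; apply: lipc1_continuous hf. Qed.

Lemma lipc1_comb B L M f g k : lipc1 B L f -> lipc1 B M g ->
  lipc1 B (L + `|k| * M) (fun t => f t + k * g t).
Proof.
move=> [f1 f2] [g1 g2]; split; last by move=> t ht; rewrite f2// g2// mulr0 addr0.
move=> s t; have -> : f s + k * g s - (f t + k * g t) = (f s - f t) + k * (g s - g t) by ring.
apply: le_trans (ler_normD _ _) _; rewrite mulrDl lerD// normrM -mulrA ler_wpM2l//.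
Qed.

Lemma RI_lin B L M f g k : 0 < B -> 0 <= L -> 0 <= M -> lipc1 B L f -> lipc1 B M g ->
  RI (fun t => f t + k * g t) = RI f + k * RI g.
Proof.
move=> B0 L0 M0 hf hg.
rewrite (RI_lipc1 B0 _ (lipc1_comb k hf hg)) ?addr_ge0 ?mulr_ge0//.
rewrite (RI_lipc1 B0 L0 hf) (RI_lipc1 B0 M0 hg).
have [G hG] := lipc1_primitive (- B) B M0 hg.
rewrite IntD; [|exact: lipc1_primitive hf|].
  by rewrite IntZ//; exists G.
by exists (fun t => k * G t) => t ht; apply: derivZ; exact: hG.
Qed.

Lemma RI_bound B L M f : 0 < B -> 0 <= L -> lipc1 B L f -> (forall t, `|f t| <= M) ->
  `|RI f| <= M * (2 * B).
Proof.
move=> B0 L0 hf hM; rewrite (RI_lipc1 B0 L0 hf).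
have -> : 2 * B = B - - B by ring.
apply: Int_le_bound; first by lra.
  exact: lipc1_primitive hf.
by move=> t _.
Qed.

Lemma RI_shift B L f h : 0 < B -> 0 <= L -> lipc1 B L f ->
  RI (fun t => f (t + h)) = RI f.
Proof.
move=> B0 L0 hf; rewrite (RI_lipc1 B0 L0 hf).
have ds t : deriv (fun t => t + h) t 1.
  by apply: deriv_eq (derivD (deriv_id t) (deriv_cst h t)); rewrite addr0.
rewrite (@RI_Int _ (- B - h) (B - h)); last 3 first.
- by lra.
- move=> t; apply: (@continuous_comp _ _ _ (fun t => t + h) f).
    exact: deriv_continuous (ds t).
  exact: lipc1_continuous hf.
- move=> t ht; apply: (lipc1_support hf); apply: contra ht => /andP[h1 h2].
  by apply/andP; split; lra.
have [S hS] := lipc1_primitive (- B) B L0 hf.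
rewrite (IntE hS) (@IntE _ _ _ _ (fun t => S (t + h))) ?subrK// => t.
have e1 : - B - h <= B - h by lra.
have e2 : - B <= B by lra.
rewrite (min_idPl e1) (max_idPr e1) => /andP[h1 h2].
have := @deriv_comp R S (fun t => t + h) t _ _ (hS (t + h) _) (ds t).
rewrite mulr1; apply; rewrite (min_idPl e2) (max_idPr e2).
by apply/andP; split; lra.
Qed.

Lemma Int_ge0 (f : R -> R) (a b : R) : a <= b -> (exists G, primitive_on a b f G) ->
  (forall t, a <= t <= b -> 0 <= f t) -> 0 <= Int a b f.
Proof.
rewrite le_eqVlt => /predU1P[->|ab].
  by move=> [G hG] _; rewrite (IntE hG) subrr.
move=> [G hG] hM; rewrite (IntE hG).
have hG' t : a <= t <= b -> deriv G t (f t).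
  by move=> ht; apply: hG; rewrite (min_idPl (ltW ab)) (max_idPr (ltW ab)).
have [||c] := @MVT R G f a b ab.
- by move=> x; rewrite in_itv/= => /andP[ux xv]; apply: hG'; rewrite !ltW.
- apply: derivable_within_continuous => x; rewrite in_itv/= => hx.
  by have [] := hG' x hx.
rewrite in_itv/= => /andP[c1 c2] ->; rewrite mulr_ge0 ?subr_ge0 ?(ltW ab)//.
by apply: hM; rewrite !ltW.
Qed.

Lemma RI_gt0 B L f t0 : 0 < B -> 0 <= L -> lipc1 B L f -> (forall t, 0 <= f t) ->
  0 < f t0 -> 0 < RI f.
Proof.
move=> B0 L0 hf f0 ft0; rewrite (RI_lipc1 B0 L0 hf).
have tB : `|t0| <= B by rewrite leNgt; apply: contraTN ft0 => /hf.2 ->; rewrite ltxx.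
have e20 : 0 < f t0 / 2 by lra.
have [d d0 hd] := eps_continuous (lipc1_continuous (t := t0) L0 hf) e20.
have fpos t : `|t - t0| <= d -> 0 < f t.
  by move=> /hd; rewrite ler_norml => /andP[]; lra.
move: tB; rewrite ler_norml => /andP[tB1 tB2].
have pr a b := lipc1_primitive a b L0 hf.
have [t0B|t0B] := ltP t0 B.
  pose u := Num.min B (t0 + d).
  have t0u : t0 < u by rewrite lt_min t0B; lra.
  have uB : u <= B by rewrite ge_min lexx.
  have ud : u <= t0 + d by rewrite ge_min lexx orbT.
  rewrite (@Int_chasles _ (- B) t0 B) ?tB1 ?(ltW t0B)//.
  rewrite (@Int_chasles _ t0 u B) ?uB ?(ltW t0u)//.
  rewrite ltr_wpDl//; first by apply: Int_ge0 => //; exact: pr.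
  rewrite ltr_wpDr//; first by apply: Int_ge0 => //; exact: pr.
  apply: Int_gt0 => // t /andP[h1 h2].
  by apply: fpos; rewrite ler_norml; apply/andP; split; lra.
pose u := Num.max (- B) (t0 - d).
have ut0 : u < t0 by rewrite gt_max; apply/andP; split; lra.
have uB : - B <= u by rewrite le_max lexx.
have ud : t0 - d <= u by rewrite le_max lexx orbT.
rewrite (Int_chasles (b := u)); last 2 first.
- by rewrite uB; lra.
- exact: pr.
rewrite ltr_wpDl//; first by apply: Int_ge0 => //; exact: pr.
apply: Int_gt0 => // [|t /andP[h1 h2]]; first by lra.
by apply: fpos; rewrite ler_norml; apply/andP; split; lra.
Qed.

(** The set [al <= t ^+ 2 <= be] consists of two intervals of length at most [Num.sqrt (be - al)].
    The bound involves only the difference, and [al] may be negative: slices of a shell in space are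
    of this kind. *)
Lemma RI_shell L f al be B : 0 < B -> 0 <= L -> lipc1 B L f -> (forall t, 0 <= f t <= 1) ->
  (forall t, ~~ (al <= t ^+ 2 <= be) -> f t = 0) -> al <= be ->
  RI f <= 2 * Num.sqrt (be - al).
Proof.
move=> B0 L0 hf f01 hs ab.
pose s1 := Num.sqrt (Num.max al 0); pose s2 := Num.sqrt (Num.max be 0).
have a0 : 0 <= Num.max al 0 by rewrite le_max lexx orbT.
have b0 : 0 <= Num.max be 0 by rewrite le_max lexx orbT.
have m12 : Num.max al 0 <= Num.max be 0 by rewrite ge_max !le_max ab lexx orbT.
have s10 : 0 <= s1 by exact: sqrtr_ge0.
have s12 : s1 <= s2 by rewrite ler_sqrt.
have sd : s2 - s1 <= Num.sqrt (be - al).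
  have h : Num.max be 0 - Num.max al 0 <= be - al.
    by case: (leP al 0) => h1; case: (leP be 0) => h2; lra.
  apply: (@le_trans _ _ (Num.sqrt (Num.max be 0 - Num.max al 0))); last first.
    by rewrite ler_sqrt// subr_ge0.
  have e1 : s1 ^+ 2 = Num.max al 0 by rewrite sqr_sqrtr.
  have e2 : s2 ^+ 2 = Num.max be 0 by rewrite sqr_sqrtr.
  rewrite -e1 -e2 -[leLHS]ger0_norm ?subr_ge0// -sqrtr_sqr ler_sqrt; last first.
    by rewrite subr_ge0 lerXn2r// ?nnegrE// (le_trans s10).
  by nra.
have out t : `|t| < s1 -> f t = 0.
  move=> ht; apply: hs; rewrite negb_and -!ltNge; apply/orP; left.
  have : t ^+ 2 < s1 ^+ 2.
    by rewrite -real_normK ?num_real// ltrXn2r ?nnegrE.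
  rewrite sqr_sqrtr//; have := sqr_ge0 t; case: (leP al 0) => // ? ?; lra.
have out2 t : s2 < `|t| -> f t = 0.
  move=> ht; apply: hs; rewrite negb_and -!ltNge; apply/orP; right.
  have : s2 ^+ 2 < t ^+ 2.
    by rewrite -[X in _ < X]real_normK ?num_real// ltrXn2r ?nnegrE// (le_trans s10).
  by rewrite sqr_sqrtr//; case: (leP be 0) => // ? ?; lra.
have pr a b := lipc1_primitive a b L0 hf.
pose b := s2 + 1.
have fcont t : {for t, continuous f} by apply: lipc1_continuous hf.
rewrite (@RI_Int f (- b) b) ?/b; last 3 first.
- by lra.
- exact: fcont.
- move=> t; rewrite -ler_norml -ltNge => h; apply: out2; lra.
have z0 u v : u <= v -> (forall t, u < t < v -> f t = 0) -> Int u v f = 0.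
  rewrite le_eqVlt => /predU1P[->|uv] hz; have [G hG] := pr u v.
    have [G' hG'] := pr v v.
    by rewrite (IntE hG') subrr.
  apply/eqP; rewrite -normr_le0.
  have hG' t : u <= t <= v -> deriv G t (f t).
    by move=> ht; apply: hG; rewrite (min_idPl (ltW uv)) (max_idPr (ltW uv)).
  rewrite (IntE hG); have [||c] := @MVT R G f u v uv.
  - by move=> x; rewrite in_itv/= => /andP[ux xv]; apply: hG'; rewrite !ltW.
  - apply: derivable_within_continuous => x; rewrite in_itv/= => hx.
    by have [] := hG' x hx.
  by rewrite in_itv/= => /hz -> ->; rewrite mul0r normr0.
have up u v : u <= v -> Int u v f <= v - u.
  move=> uv; apply: le_trans (ler_norm _) _; rewrite -[leRHS]mul1r.
  by apply: Int_le_bound => // t _; have /andP[h1 h2] := f01 t; rewrite ger0_norm.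
rewrite (@Int_chasles _ _ (- s2)); last 2 first.
- by apply/andP; split; lra.
- exact: pr.
rewrite (@Int_chasles _ (- s2) (- s1)); last 2 first.
- by apply/andP; split; lra.
- exact: pr.
rewrite (@Int_chasles _ (- s1) s1); last 2 first.
- by apply/andP; split; lra.
- exact: pr.
rewrite (@Int_chasles _ s1 s2); last 2 first.
- by apply/andP; split; lra.
- exact: pr.
rewrite (z0 (- (s2 + 1))); last 2 first.
- by lra.
- by move=> t /andP[h1 h2]; apply: out2; rewrite ltr0_norm; lra.
rewrite (z0 (- s1)); last 2 first.
- by lra.
- by move=> t ht; apply: out; rewrite ltr_norml.
rewrite (z0 s2); last 2 first.
- by lra.
- by move=> t /andP[h1 h2]; apply: out2; rewrite gtr0_norm; lra.
have := up (- s2) (- s1); have := up s1 s2.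
by lra.
Qed.

End LineIntegral.

(** * Iterated integrals over space *)

Section SpaceIntegral.
Context {R : realType}.

(** The l1 distance is additive over slices, so that a slice keeps the Lipschitz constant. *)
Definition dist1 {n : nat} (x y : 'rV[R]_n) : R := \sum_(i < n) `|x 0 i - y 0 i|.

Definition lipc {n : nat} (B L : R) (g : 'rV[R]_n -> R) : Prop :=
  (forall x y, `|g x - g y| <= L * dist1 x y) /\
  (forall (x : 'rV[R]_n) (i : 'I_n), B < `|x 0 i| -> g x = 0).

Definition slice {n : nat} (t : R) (y : 'rV[R]_n) : 'rV[R]_n.+1 :=
  row_mx (\row_(j < 1) t) y.

Lemma slice0 n t (y : 'rV[R]_n) : slice t y 0 ord0 = t.
Proof.
rewrite /slice (_ : ord0 = lshift n ord0 :> 'I_(1 + n)); last exact: val_inj.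
by rewrite (row_mxEl (\row_(j < 1) t) y) mxE.
Qed.

Lemma sliceS n t (y : 'rV[R]_n) j : slice t y 0 (lift ord0 j) = y 0 j.
Proof.
rewrite /slice (_ : lift ord0 j = rshift 1 j :> 'I_(1 + n)); last exact: val_inj.
by rewrite (row_mxEr (\row_(j < 1) t) y).
Qed.

Lemma dist1_slice n s t (y z : 'rV[R]_n) :
  dist1 (slice s y) (slice t z) = `|s - t| + dist1 y z.
Proof.
rewrite /dist1 big_ord_recl !slice0; congr (_ + _).
by apply: eq_bigr => j _; rewrite !sliceS.
Qed.

Lemma dist1xx n (x : 'rV[R]_n) : dist1 x x = 0.
Proof. by rewrite /dist1 big1// => i _; rewrite subrr normr0. Qed.

Lemma dist1_ge0 n (x y : 'rV[R]_n) : 0 <= dist1 x y.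
Proof. by apply: sumr_ge0. Qed.

Lemma integral_RnS n (g : 'rV[R]_n.+1 -> R) :
  integral_Rn g = RI (fun t => integral_Rn (fun y => g (slice t y))).
Proof. by []. Qed.

Lemma lipc_slice n B L (g : 'rV[R]_n.+1 -> R) t : lipc B L g ->
  lipc B L (fun y => g (slice t y)).
Proof.
move=> [h1 h2]; split.
  by move=> x y; have := h1 (slice t x) (slice t y); rewrite dist1_slice subrr normr0 add0r.
by move=> x i hx; apply: (h2 _ (lift ord0 i)); rewrite sliceS.
Qed.

Lemma lipcW n B B' L L' (g : 'rV[R]_n -> R) : B <= B' -> L <= L' -> lipc B L g -> lipc B' L' g.
Proof.
move=> BB LL [h1 h2]; split.
  by move=> x y; apply: le_trans (h1 x y) _; rewrite ler_wpM2r// dist1_ge0.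
by move=> x i hx; apply: (h2 x i); exact: le_lt_trans hx.
Qed.

Lemma lipc_comb n B L M (g h : 'rV[R]_n -> R) k : lipc B L g -> lipc B M h ->
  lipc B (L + `|k| * M) (fun x => g x + k * h x).
Proof.
move=> [g1 g2] [h1 h2]; split; last by move=> x i hx; rewrite (g2 x i)// (h2 x i)// mulr0 addr0.
move=> x y; have -> : g x + k * h x - (g y + k * h y) = (g x - g y) + k * (h x - h y) by ring.
by apply: le_trans (ler_normD _ _) _; rewrite mulrDl lerD// normrM -mulrA ler_wpM2l.
Qed.

Section FixedBox.
Variable B : R.
Hypothesis B0 : 0 < B.

(** The three parts need one another: bound and linearity in dimension [n] make the slice integral
    Lipschitz, and this regularity lets the one-dimensional lemmas prove bound and linearity in
    dimension [n.+1]. *)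
Lemma integral_lipc n :
  (forall L M (g : 'rV[R]_n -> R), 0 <= L -> lipc B L g -> (forall x, `|g x| <= M) ->
    `|integral_Rn g| <= M * (2 * B) ^+ n) /\
  (forall L M (g h : 'rV[R]_n -> R) k, 0 <= L -> 0 <= M -> lipc B L g -> lipc B M h ->
    integral_Rn (fun x => g x + k * h x) = integral_Rn g + k * integral_Rn h) /\
  (forall L (g : 'rV[R]_n.+1 -> R), 0 <= L -> lipc B L g ->
    lipc1 B (L * (2 * B) ^+ n) (fun t => integral_Rn (fun y => g (slice t y)))).
Proof.
have B2n m : 0 <= (2 * B) ^+ m by rewrite exprn_ge0// mulr_ge0// ltW.
suff slc m :
   (forall L M (g : 'rV[R]_m -> R), 0 <= L -> lipc B L g -> (forall x, `|g x| <= M) ->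
    `|integral_Rn g| <= M * (2 * B) ^+ m) /\
  (forall L M (g h : 'rV[R]_m -> R) k, 0 <= L -> 0 <= M -> lipc B L g -> lipc B M h ->
    integral_Rn (fun x => g x + k * h x) = integral_Rn g + k * integral_Rn h) ->
  (forall L (g : 'rV[R]_m.+1 -> R), 0 <= L -> lipc B L g ->
    lipc1 B (L * (2 * B) ^+ m) (fun t => integral_Rn (fun y => g (slice t y)))).
  elim: n => [|n [ih1 [ih2 ih3]]].
    split; [|split]; [| |apply: slc; split].
    - by move=> L M g _ _ /(_ 0) h; rewrite /= expr0 mulr1.
    - by [].
    - by move=> L M g _ _ /(_ 0) h; rewrite /= expr0 mulr1.
    - by [].
  have h1 L M (g : 'rV[R]_n.+1 -> R) : 0 <= L -> lipc B L g -> (forall x, `|g x| <= M) ->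
     `|integral_Rn g| <= M * (2 * B) ^+ n.+1.
    move=> L0 hg hM; rewrite integral_RnS exprSr (mulrA M).
    have Ln : 0 <= L * (2 * B) ^+ n by rewrite mulr_ge0.
    apply: (RI_bound B0 Ln (ih3 L g L0 hg)) => t.
    by apply: (ih1 L) => //; exact: lipc_slice.
  have h2 L M (g h : 'rV[R]_n.+1 -> R) k : 0 <= L -> 0 <= M -> lipc B L g -> lipc B M h ->
    integral_Rn (fun x => g x + k * h x) = integral_Rn g + k * integral_Rn h.
    move=> L0 M0 hg hh; rewrite !integral_RnS.
    rewrite -(RI_lin k B0 _ _ (ih3 L g L0 hg) (ih3 M h M0 hh)) ?mulr_ge0//.
    congr RI; apply/funext => t; apply: (ih2 L M) => //; exact: lipc_slice.
  by split => //; split => //; apply: slc; split.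
move=> [ih1 ih2] L g L0 hg; split; last first.
  move=> t ht; apply/eqP; rewrite -normr_le0 -[leRHS](mul0r ((2 * B) ^+ m)).
  apply: (ih1 L) => //; first exact: lipc_slice.
  move=> y; rewrite normr_le0; apply/eqP.
  by have [_ h] := hg; apply: (h _ ord0); rewrite slice0.
move=> s t.
have hs := lipc_slice s hg; have ht := lipc_slice t hg.
(* By linearity the difference is the integral of a single function, which the Lipschitz condition
   bounds by [L] times the distance of [s] and [t]. *)
have -> : integral_Rn (fun y => g (slice s y)) - integral_Rn (fun y => g (slice t y)) =
  integral_Rn (fun y => g (slice s y) + (-1) * g (slice t y)).
  by rewrite (ih2 L L)// mulN1r.
rewrite mulrAC; apply: (ih1 (L + `|-1| * L)) => //.
- by rewrite addr_ge0// mulr_ge0.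
- exact: lipc_comb.
- move=> y; rewrite mulN1r; have [h _] := hg.
  by apply: le_trans (h _ _) _; rewrite dist1_slice dist1xx addr0.
Qed.

Lemma integral_slice n L (g : 'rV[R]_n.+1 -> R) : 0 <= L -> lipc B L g ->
  lipc1 B (L * (2 * B) ^+ n) (fun t => integral_Rn (fun y => g (slice t y))) /\
  0 <= L * (2 * B) ^+ n.
Proof.
move=> L0 hg; have [_ [_ h]] := integral_lipc n; split; first exact: h.
by rewrite mulr_ge0// exprn_ge0// mulr_ge0// ltW.
Qed.

Lemma integral_squeeze n : forall L M (l g u : 'rV[R]_n -> R), 0 <= L -> 0 <= M ->
  lipc B L l -> lipc B M u -> (forall x, l x <= g x <= u x) ->
  integral_Rn l <= integral_Rn g <= integral_Rn u.
Proof.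
elim: n => [|n ih] L M l g u L0 M0 hl hu h; first exact: h.
rewrite !integral_RnS.
have [sl Ln] := integral_slice L0 hl; have [su Mn] := integral_slice M0 hu.
apply: (@RI_squeeze _ _ _ _ (- B) B).
- by move=> t; apply: lipc1_continuous sl.
- by move=> t; apply: lipc1_continuous su.
- exact: lipc1_support sl.
- exact: lipc1_support su.
- by move=> t; apply: (ih L M) => //; exact: lipc_slice.
Qed.

Lemma integral_shift n : forall L (g : 'rV[R]_n -> R) v, 0 <= L -> lipc B L g ->
  integral_Rn (fun x => g (x + v)) = integral_Rn g.
Proof.
elim: n => [|n ih] L g v L0 hg.
  by rewrite /=; congr (g _); apply/rowP => -[].
rewrite !integral_RnS.
have [sg Ln] := integral_slice L0 hg.
pose v0 := v 0 ord0; pose v' : 'rV[R]_n := \row_j v 0 (lift ord0 j).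
have sE t (y : 'rV[R]_n) : slice t y + v = slice (t + v0) (y + v').
  apply/rowP => i; rewrite mxE.
  by case: (unliftP ord0 i) => [j|] ->; rewrite ?slice0// !sliceS !mxE.
rewrite -(RI_shift v0 B0 Ln sg); congr RI; apply/funext => t.
rewrite -(ih L (fun y => g (slice (t + v0) y)) v' L0); last exact: lipc_slice.
by congr integral_Rn; apply/funext => y; rewrite sE.
Qed.

Lemma integral_gt0 n : forall L (g : 'rV[R]_n -> R) x, 0 <= L -> lipc B L g ->
  (forall x, 0 <= g x) -> 0 < g x -> 0 < integral_Rn g.
Proof.
elim: n => [|n ih] L g x L0 hg g0 gx.
  by rewrite /= (_ : 0 = x)//; apply/rowP => -[].
rewrite integral_RnS.
have [sg Ln] := integral_slice L0 hg.
have sge t : 0 <= integral_Rn (fun y => g (slice t y)).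
  have z0 : lipc B 0 (fun _ : 'rV[R]_n => 0).
    by split => // a b; rewrite subrr normr0 mul0r.
  have := @integral_squeeze n 0 L (fun=> 0) (fun y => g (slice t y)) (fun y => g (slice t y))
    (lexx 0) L0 z0 (lipc_slice t hg) (fun y => ltac:(by rewrite g0 lexx)).
  have -> : integral_Rn (fun _ : 'rV[R]_n => 0) = 0.
    apply/eqP; rewrite -normr_le0 -[leRHS](mul0r ((2 * B) ^+ n)).
    have [h _] := integral_lipc n; apply: (h 0) => // y; by rewrite normr0.
  by case/andP.
apply: (RI_gt0 (t0 := x 0 ord0) B0 Ln sg) => //.
apply: (ih L _ (\row_j x 0 (lift ord0 j)) L0 (lipc_slice _ hg)) => //.
rewrite (_ : slice _ _ = x)//; apply/rowP => i.
by case: (unliftP ord0 i) => [j|] ->; rewrite ?slice0// sliceS mxE.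
Qed.

(** The slice of the shell at height [t] is the shell between [al - t ^+ 2] and [be - t ^+ 2], with
    the same difference, and the bound depends on nothing else of the shell. Each further
    integration costs a factor [2 * B]. *)
Lemma integral_shell n : forall L (g : 'rV[R]_n.+1 -> R) al be, 0 <= L -> lipc B L g ->
  (forall x, 0 <= g x <= 1) -> (forall x : 'rV[R]_n.+1, ~~ (al <= nsq (x 0) <= be) -> g x = 0) ->
  al <= be -> integral_Rn g <= 2 * Num.sqrt (be - al) * (2 * B) ^+ n.
Proof.
have nsqE m t (y : 'rV[R]_m) : nsq (slice t y 0) = t ^+ 2 + nsq (y 0).
  rewrite /nsq big_ord_recl slice0; congr (_ + _).
  by apply: eq_bigr => j _; rewrite sliceS.
elim: n => [|n ih] L g al be L0 hg g01 hs ab.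
  rewrite integral_RnS expr0 mulr1.
  have [sg Ln] := integral_slice L0 hg.
  apply: (RI_shell B0 Ln sg) => // [t|t ht] /=; first exact: g01.
  by apply: hs; rewrite nsqE /nsq big_ord0 addr0.
rewrite integral_RnS exprSr (mulrA (2 * Num.sqrt _)).
have [sg Ln] := integral_slice L0 hg.
apply: le_trans (ler_norm _) _; apply: (RI_bound B0 Ln sg) => t.
have ht := lipc_slice t hg.
rewrite ler_norml; apply/andP; split; last first.
  have -> : be - al = (be - t ^+ 2) - (al - t ^+ 2) by ring.
  apply: (ih L _ (al - t ^+ 2) (be - t ^+ 2) L0 ht) => //; last by rewrite lerD2r.
  move=> y hy; apply: hs; apply: contra hy; rewrite nsqE => /andP[h1 h2].
  by apply/andP; split; lra.
have z0 : lipc B 0 (fun _ : 'rV[R]_n.+1 => 0).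
  by split => // a b; rewrite subrr normr0 mul0r.
have := @integral_squeeze n.+1 0 L (fun=> 0) (fun y => g (slice t y)) (fun y => g (slice t y))
  (lexx 0) L0 z0 ht (fun y => ltac:(by case/andP: (g01 (slice t y)) => ->; rewrite lexx)).
have -> : integral_Rn (fun _ : 'rV[R]_n.+1 => 0) = 0.
  apply/eqP; rewrite -normr_le0 -[leRHS](mul0r ((2 * B) ^+ n.+1)).
  have [h _] := integral_lipc n.+1; apply: (h 0) => // y; by rewrite normr0.
move=> /andP[h _]; apply: le_trans h; rewrite oppr_le0 !mulr_ge0// ?sqrtr_ge0//.
by rewrite exprn_ge0// mulr_ge0// ltW.
Qed.

End FixedBox.
End SpaceIntegral.

(** * Vanishing of the constant *)

Section Vanishing.
Context {R : realType}.

Lemma coord_rad {V : finType} (x : V -> R) v : `|x v| <= rad x.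
Proof.
rewrite -sqrtr_sqr ler_sqrt ?nsq_ge0// /nsq (bigD1 v)//= lerDl.
by apply: sumr_ge0 => u _; rewrite sqr_ge0.
Qed.

Lemma rad_le {V : finType} (x y : V -> R) : rad x <= rad y + \sum_v `|x v - y v|.
Proof.
set s := \sum_v _; have s0 : 0 <= s by apply: sumr_ge0.
have ry0 : 0 <= rad y by exact: sqrtr_ge0.
have rs0 : 0 <= rad y + s by exact: addr_ge0.
rewrite -[leRHS](ger0_norm rs0) -sqrtr_sqr ler_sqrt ?sqr_ge0//.
have hd v : `|x v - y v| <= s.
  by rewrite /s (bigD1 v)//= lerDl sumr_ge0.
rewrite sqrrD rad_sq /nsq.
have -> : \sum_v x v ^+ 2 = \sum_v y v ^+ 2 + \sum_v (y v * (x v - y v) *+ 2) +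
    \sum_v (x v - y v) ^+ 2.
  by rewrite -!big_split/=; apply: eq_bigr => v _; rewrite -mulr_natl; ring.
apply: lerD; first apply: lerD => //.
  rewrite sumrMnl lerMn2r/= /s mulr_sumr; apply: ler_sum => v _.
  by apply: le_trans (ler_norm _) _; rewrite normrM ler_wpM2r ?coord_rad.
rewrite expr2 {1}/s mulr_suml; apply: ler_sum => v _.
by rewrite -real_normK ?num_real// expr2 ler_wpM2l.
Qed.

Lemma rad_lip n (x y : 'rV[R]_n) : `|rad (x 0) - rad (y 0)| <= dist1 x y.
Proof.
rewrite ler_norml; have := rad_le (x 0) (y 0); have := rad_le (y 0) (x 0).
rewrite -!/(dist1 _ _) => h1 h2.
have e : dist1 y x = dist1 x y by apply: eq_bigr => i _; rewrite distrC.
by apply/andP; split; move: h1 h2; rewrite -!/(dist1 _ _) ?e; lra.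
Qed.

Section Annulus.
Variables (n : nat) (R1 R2 : R).
Hypotheses (R10 : 0 < R1) (R12 : R1 < R2).
Local Notation V := 'I_n.+1.
Local Notation E := 'rV[R]_n.+1.

Let A (x : E) := R1 <= rad (x 0) <= R2.

(** Monotonicity ties both constants to one index, with radius [1 / (i + 1)] and bound [i + 1], so
    that compactness of a cube provides a single index. Points off the closed annulus have a
    neighbourhood where the condition is void. *)
Lemma annulus_uniform (Q : E -> R -> R -> Prop) :
  (forall p d d' C C', 0 < d' -> d' <= d -> C <= C' -> Q p d C -> Q p d' C') ->
  (forall p, A p -> exists2 d, 0 < d & exists2 C, 0 <= C & forall q : E,
     cube (p 0) d (q 0) -> Q q d C) ->
  exists2 d, 0 < d & exists2 C, 0 <= C & forall p, A p -> Q p d C.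
Proof.
move=> Qm Ql.
pose K := [set v : E | forall i, `[- R2, R2]%classic (v ord0 i)].
have cK : compact K.
  by apply: (@rV_compact _ _ (fun=> `[- R2, R2]%classic)) => i; exact: segment_compact.
pose P (i : nat) (q : E) := A q -> Q q (i.+1%:R)^-1 i.+1%:R.
have /compact_near_coveringP/(_ nat \oo P _) := cK.
have ballE (p q : E) e : ball p e q -> cube (p 0) e (q 0).
  by move=> [_ h] i; have := h ord0 i; rewrite /ball/= distrC => /ltW.
case.
  move=> p _; have [Ap|nAp] := boolP (R1 <= rad (p 0) <= R2).
    have [d d0 [C C0 hQ]] := Ql p Ap.
    have [N [hN1 hN2]] : exists N : nat, C <= N%:R /\ d^-1 <= N%:R.
      have m0 : 0 <= Num.max C d^-1 by rewrite le_max C0.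
      exists (Num.truncn (Num.max C d^-1)).+1.
      have := ltW (truncnS_gt (Num.max C d^-1)).
      by rewrite ge_max => /andP[].
    exists (ball p d, [set i | (N <= i)%N]).
      by split => /=; [exact: nbhsx_ballx|exists N].
    move=> [q i] [/= /ballE hq Ni] _; apply: Qm (hQ q hq).
    - by rewrite invr_gt0.
    - rewrite -[leRHS]invrK lef_pV2 ?posrE ?invr_gt0//.
      by apply: le_trans hN2 _; rewrite ler_nat (leq_trans Ni).
    - by apply: le_trans hN1 _; rewrite ler_nat (leq_trans Ni).
  have [e e0 he] : exists2 e, 0 < e & forall q : E, cube (p 0) e (q 0) -> ~~ A q.
    pose g := Num.max (R1 - rad (p 0)) (rad (p 0) - R2).
    have g0 : 0 < g.
      by rewrite lt_max !subr_gt0 !ltNge -negb_and.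
    exists (g / (n.+1%:R * 2)); first by rewrite divr_gt0.
    move=> q hq; apply: contraL g0 => /andP[q1 q2]; rewrite -leNgt.
    have hd : dist1 q p <= g / 2.
      apply: (@le_trans _ _ (\sum_(i < n.+1) g / (n.+1%:R * 2))).
        by apply: ler_sum => i _; exact: hq.
      rewrite sumr_const card_ord -[leLHS]mulr_natl; have : n.+1%:R != 0 :> R by [].
      by move: (n.+1%:R) => m m0; have -> : m * (g / (m * 2)) = g / 2 by field.
    have := rad_lip q p; rewrite ler_norml => /andP[l1 l2].
    have : g <= g / 2 by rewrite {1}/g ge_max; apply/andP; split; lra.
    by lra.
  exists (ball p e, setT).
    by split => /=; [exact: nbhsx_ballx|exact: filterT].
  by move=> [q i] [/= /ballE hq _] Aq; have := he q hq; rewrite Aq.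
move=> N _ /(_ N (leqnn N)) h.
exists (N.+1%:R)^-1; first by rewrite invr_gt0.
exists N.+1%:R => // p Ap; apply: h => // i /=.
rewrite in_itv/= -ler_norml; apply: le_trans (coord_rad _ _) _.
by case/andP: Ap.
Qed.

Definition ext (g : (V -> R) -> R) (x : E) : R :=
  if `[< open_annulus R1 R2 x >] then g (x 0) else 0.

Lemma extE g x : ext g x = if R1 < rad (x 0) < R2 then g (x 0) else 0.
Proof. by rewrite /ext /open_annulus/= asboolb. Qed.

Section OneFunction.
Variable g : (V -> R) -> R.
Hypothesis ag : forall x, R1 <= rad x <= R2 -> analytic_at x g.

Lemma annulus_bounds : exists2 d, 0 < d & exists2 C, 0 <= C & forall p : E, A p ->
  [/\ forall q : E, A q -> cube (p 0) d (q 0) -> `|g (p 0) - g (q 0)| <= C * dist1 p q,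
      forall k h, `|h| <= d ->
      `|g (upd (p 0) k (p 0 k + h)) - g (p 0) - h * pd g (p 0) k| <= C * h ^+ 2 &
      `|g (p 0)| <= C].
Proof.
pose Q (p : E) (d C : R) :=
  [/\ forall q : E, A q -> cube (p 0) d (q 0) -> `|g (p 0) - g (q 0)| <= C * dist1 p q,
      forall k h, `|h| <= d ->
      `|g (upd (p 0) k (p 0 k + h)) - g (p 0) - h * pd g (p 0) k| <= C * h ^+ 2 &
      `|g (p 0)| <= C].
apply: (@annulus_uniform Q).
  move=> p d d' C C' _ dd CC [h1 h2 h3]; split.
  - move=> q Aq hq; apply: le_trans (h1 q Aq (cubeW dd hq)) _.
    by rewrite ler_wpM2r// dist1_ge0.
  - move=> k h hh; apply: le_trans (h2 k h (le_trans hh dd)) _.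
    by rewrite ler_wpM2r// sqr_ge0.
  - exact: le_trans h3 CC.
move=> p Ap; have agp := ag Ap.
have [d1 d10 [C1 C10 h1]] := analytic_lip agp.
have [d2 d20 h2] : exists2 d, 0 < d & forall k, exists2 C, 0 <= C & forall y h,
    cube (p 0) d y -> cube (p 0) d (upd y k (y k + h)) ->
    `|g (upd y k (y k + h)) - g y - h * pd g y k| <= C * h ^+ 2.
  apply: finite_radius_mono => [k e e' ee [C C0 h]|k]; last exact: analytic_taylor.
  exists C => // y t hy hy'; exact: h (cubeW ee hy) (cubeW ee hy').
have /choice[C2 hC2] : forall k, exists C, 0 <= C /\ forall y h,
    cube (p 0) d2 y -> cube (p 0) d2 (upd y k (y k + h)) ->
    `|g (upd y k (y k + h)) - g y - h * pd g y k| <= C * h ^+ 2.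
  by move=> k; have [C ? ?] := h2 k; exists C.
have [d3 d30 h3] := analytic_cont agp ltr01.
pose d := Num.min d1 (Num.min d2 d3).
have d0 : 0 < d by rewrite !lt_min d10 d20.
have dd1 : d <= d1 by rewrite ge_min lexx.
have dd2 : d <= d2 by rewrite !ge_min lexx orbT.
have dd3 : d <= d3 by rewrite !ge_min lexx !orbT.
pose C := C1 + \sum_k C2 k + (`|g (p 0)| + 1).
have S0 : 0 <= \sum_k C2 k by apply: sumr_ge0 => k _; have [] := hC2 k.
have C0 : 0 <= C by rewrite !addr_ge0.
(* For [q] within [d / 2] of [p], the cube of radius [d / 2] around [q] stays where the estimates at
   [p] hold. *)
exists (d / 2); first by lra.
exists C => // q hq.
have big y : cube (q 0) (d / 2) y -> cube (p 0) d y.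
  move=> hy u; have := ler_normD (y u - q 0 u) (q 0 u - p 0 u); rewrite addrA subrK.
  by have := hy u; have := hq u; lra.
have hqd : cube (p 0) d (q 0) by apply: big; apply: cube_refl; lra.
split.
- move=> q' _ hq'; apply: le_trans (h1 _ _ (cubeW dd1 hqd) (cubeW dd1 (big _ hq'))) _.
  rewrite ler_wpM2r ?sumr_ge0// /C; have := normr_ge0 (g (p 0)); lra.
- move=> k h hh; have [Ck0 hk] := hC2 k.
  apply: le_trans (hk _ _ (cubeW dd2 hqd) _) _.
    apply: cubeW dd2 _; apply: big => u; rewrite /upd; case: eqP => [->|_].
      by rewrite addrC addKr.
    by rewrite subrr normr0; lra.
  rewrite ler_wpM2r ?sqr_ge0// /C.
  have : C2 k <= \sum_k C2 k.
    by rewrite (bigD1 k)//= lerDl sumr_ge0// => j _; have [] := hC2 j.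
  by have := normr_ge0 (g (p 0)); lra.
- have := h3 _ (cubeW dd3 hqd); have := ler_normD (g (q 0) - g (p 0)) (g (p 0)).
  by rewrite subrK /C; lra.
Qed.

Hypothesis g_bd : forall x, rad x = R1 \/ rad x = R2 -> g x = 0.

Lemma ext_closed x : A x -> ext g x = g (x 0).
Proof.
move=> /andP[h1 h2]; rewrite extE; case: ifPn => // /nandP[]; rewrite -leNgt => h.
  by rewrite g_bd//; left; apply: le_anti; rewrite h h1.
by rewrite g_bd//; right; apply: le_anti; rewrite h h2.
Qed.

Lemma ext_out x : ~~ A x -> ext g x = 0.
Proof.
by move=> h; rewrite extE ifN//; apply: contra h => /andP[h1 h2]; rewrite /A !ltW.
Qed.

(** The annulus is not convex: nearby points use the local Lipschitz bound, distant ones the bound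
    of [g]. If only one point lies in the annulus, [g] there is compared with its value 0 at the
    radial projection to the sphere separating the two points. *)
Lemma lipc_ext B : R2 <= B -> exists2 L, 0 <= L & lipc B L (ext g).
Proof.
move=> RB; have [d d0 [C C0 hb]] := annulus_bounds.
pose L0 := C + 2 * C / d.
have L00 : 0 <= L0 by rewrite addr_ge0// divr_ge0 ?mulr_ge0// ltW.
have lipA x y : A x -> A y -> `|g (x 0) - g (y 0)| <= L0 * dist1 x y.
  move=> Ax Ay; have [h1 _ hx] := hb x Ax; have [_ _ hy] := hb y Ay.
  have [dd|dd] := leP (dist1 x y) d.
    apply: le_trans (h1 y Ay _) _.
      move=> i; apply: le_trans dd; rewrite /dist1 (bigD1 i)//= distrC lerDl.
      exact: sumr_ge0.
    by rewrite ler_wpM2r ?dist1_ge0// lerDl divr_ge0 ?mulr_ge0// ltW.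
  apply: (@le_trans _ _ (2 * C)); first by have := ler_normB (g (x 0)) (g (y 0)); lra.
  apply: (@le_trans _ _ (2 * C / d * dist1 x y)); last first.
    by rewrite ler_wpM2r ?dist1_ge0// lerDr.
  by rewrite mulrAC ler_pdivlMr// ler_wpM2l ?mulr_ge0// ltW.
(* The factor for bounding the l1 distance of a radial displacement by its length. *)
pose m : R := n.+1%:R.
have m1 : 1 <= m by rewrite ler1n.
have lip_out x y : A x -> ~~ A y -> `|ext g x - ext g y| <= L0 * m * dist1 x y.
  move=> Ax nAy; rewrite (ext_out nAy) subr0 ext_closed//.
  have rx0 : 0 < rad (x 0) by case/andP: Ax => h _; exact: lt_le_trans h.
  have [r [hr rx]] : exists r, (r = R1 \/ r = R2) /\ `|rad (x 0) - r| <= dist1 x y.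
    have := rad_lip x y; rewrite ler_norml => /andP[l1 l2].
    move: nAy Ax => /nandP[]; rewrite -ltNge => h /andP[x1 x2].
      by exists R1; split; [left|rewrite ger0_norm; lra].
    by exists R2; split; [right|rewrite distrC ger0_norm; lra].
  have r0 : 0 < r by case: hr => ->; [exact: R10|exact: lt_trans R12].
  pose w : E := \row_i (r / rad (x 0) * x 0 i).
  have wE : (w 0) = fun i => r / rad (x 0) * x 0 i by apply/funext => i; rewrite mxE.
  have rw : rad (w 0) = r by rewrite wE radZ ?divr_ge0 ?ltW// divfK// gt_eqF.
  have Aw : A w by rewrite /A rw; case: hr => ->; rewrite lexx ?(ltW R12)//= ltW.
  have gw : g (w 0) = 0 by apply: g_bd; rewrite rw.
  have := lipA x w Ax Aw; rewrite gw subr0 => h; apply: le_trans h _.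
  rewrite -mulrA ler_wpM2l//.
  apply: (@le_trans _ _ (\sum_(i < n.+1) `|rad (x 0) - r|)).
    apply: ler_sum => i _; rewrite mxE.
    have -> : x 0 i - r / rad (x 0) * x 0 i = (rad (x 0) - r) * (x 0 i / rad (x 0)).
      by field; rewrite gt_eqF.
    rewrite normrM ler_piMr// normrM normfV (gtr0_norm rx0) ler_pdivrMr// mul1r.
    exact: coord_rad.
  by rewrite sumr_const card_ord -mulr_natl ler_wpM2l.
exists (L0 * m); first by rewrite mulr_ge0.
split; last first.
  move=> x i hx; apply: ext_out; apply/nandP; right; rewrite -ltNge.
  exact: le_lt_trans RB (lt_le_trans hx (coord_rad _ _)).
move=> x y; have [Ax|nAx] := boolP (A x); have [Ay|nAy] := boolP (A y).
- rewrite !ext_closed//; apply: le_trans (lipA x y Ax Ay) _.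
  by rewrite ler_wpM2r ?dist1_ge0// ler_peMr.
- exact: lip_out.
- rewrite distrC (_ : dist1 x y = dist1 y x); last by apply: eq_bigr => i _; rewrite distrC.
  exact: lip_out.
- by rewrite !ext_out// subrr normr0 !mulr_ge0// dist1_ge0.
Qed.

End OneFunction.

Definition clamp (t : R) : R := Num.max 0 (Num.min 1 t).

Lemma clamp_lip s t : `|clamp s - clamp t| <= `|s - t|.
Proof.
have c3 x : [\/ x <= 0 /\ clamp x = 0, 0 <= x <= 1 /\ clamp x = x | 1 <= x /\ clamp x = 1].
  rewrite /clamp; have [x0|x0] := leP x 0.
    by constructor 1; split => //; rewrite (min_idPr (le_trans x0 ler01)) (max_idPl x0).
  have [x1|x1] := leP x 1.
    by constructor 2; rewrite (max_idPr (ltW x0)) (ltW x0).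
  by constructor 3; split; [exact: ltW|rewrite (max_idPr ler01)].
have := ler_norm (s - t); have := ler_norm (t - s); rewrite (distrC t).
move=> n1 n2; rewrite ler_norml.
by case: (c3 s) => -[h1 ->]; case: (c3 t) => -[h2 ->]; apply/andP; split; lra.
Qed.

Lemma clamp01 t : 0 <= clamp t <= 1.
Proof. by rewrite /clamp le_max lexx/= ge_max ler01 ge_min lexx. Qed.

Lemma clamp_ge1 t : 1 <= t -> clamp t = 1.
Proof. by move=> h; rewrite /clamp (min_idPl h) (max_idPr ler01). Qed.

Lemma clamp_le0 t : t <= 0 -> clamp t = 0.
Proof. by move=> h; rewrite /clamp (min_idPr (le_trans h ler01)) (max_idPl h). Qed.

(** Equal to 1 where [rad] is within [w] of [r], and to 0 beyond distance [2 * w]. With [r = 0] and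
    [w = R2 + 1] it is 1 on the whole closed annulus, a Lipschitz substitute for the constant 1. *)
Definition bump (r w : R) (x : E) : R := clamp (2 - `|rad (x 0) - r| / w).

Lemma lipc_bump r w B : 0 < w -> r + 2 * w <= B -> lipc B w^-1 (bump r w).
Proof.
move=> w0 rB; split.
  move=> x y; apply: le_trans (clamp_lip _ _) _.
  have -> : 2 - `|rad (x 0) - r| / w - (2 - `|rad (y 0) - r| / w) =
     w^-1 * (`|rad (y 0) - r| - `|rad (x 0) - r|) by ring.
  have w1 : 0 <= w^-1 by rewrite invr_ge0 ltW.
  rewrite normrM (ger0_norm w1) ler_wpM2l//.
  apply: le_trans (ler_dist_dist _ _) _.
  have -> : rad (y 0) - r - (rad (x 0) - r) = - (rad (x 0) - rad (y 0)) by ring.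
  by rewrite normrN; exact: rad_lip.
move=> x i hx; apply: clamp_le0; rewrite subr_le0 ler_pdivlMr//.
have h := lt_le_trans (le_lt_trans rB hx) (coord_rad (x 0) i).
by rewrite ger0_norm; lra.
Qed.

(** The support lies in a shell whose squared radii differ by [8 * r * w]. The resulting order, the
    square root of [w], is weaker than the true one but tends to 0. *)
Lemma integral_bump r w B : 0 < w -> 2 * w <= r -> r + 2 * w <= B -> 0 < B ->
  integral_Rn (bump r w) <= 2 * Num.sqrt (8 * r * w) * (2 * B) ^+ n.
Proof.
move=> w0 wr rB B0.
have -> : 8 * r * w = (r + 2 * w) ^+ 2 - (r - 2 * w) ^+ 2 by ring.
apply: (integral_shell B0 _ (lipc_bump w0 rB)).
- by rewrite invr_ge0 ltW.
- by move=> x; exact: clamp01.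
- move=> x hx; apply: clamp_le0; rewrite subr_le0 ler_pdivlMr// leNgt.
  apply: contra hx; rewrite ltr_norml -rad_sq => /andP[h1 h2].
  have r0 : 0 <= rad (x 0) by exact: sqrtr_ge0.
  by rewrite !lerXn2r ?nnegrE//; lra.
- by rewrite lerXn2r ?nnegrE//; lra.
Qed.

Section Flux.
Variables (U : V -> (V -> R) -> R) (f phi : (V -> R) -> R) (c : R).
Hypotheses (aU : forall k x, R1 <= rad x <= R2 -> analytic_at x (U k))
  (af : forall x, R1 <= rad x <= R2 -> analytic_at x f)
  (aphi : forall x, R1 <= rad x <= R2 -> analytic_at x phi)
  (U_bd : forall k x, rad x = R1 \/ rad x = R2 -> U k x = 0)
  (phi_bd : forall x, rad x = R1 \/ rad x = R2 -> phi x = 0)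
  (phi_gt0 : forall x, R1 < rad x < R2 -> 0 < phi x)
  (divU : forall x, R1 <= rad x <= R2 -> \sum_k pd (U k) x k = f x - c * phi x).

Let B := R2 + 3.
Let e (k : V) : E := delta_mx 0 k.

Let difquo (h : R) (x : E) : R := \sum_k h^-1 * (ext (U k) (x + h *: e k) - ext (U k) x).

Lemma shift_coord (x : E) k h : (x + h *: e k) 0 = upd (x 0) k (x 0 k + h).
Proof.
apply/funext => i; rewrite !mxE /upd eqxx /=; case: eqP => [->|_].
  by rewrite mulr1.
by rewrite mulr0 addr0.
Qed.

Lemma dist1_shift (x : E) k h : dist1 (x + h *: e k) x = `|h|.
Proof.
rewrite /dist1 (bigD1 k)//= big1 ?addr0.
  by rewrite shift_coord /upd eqxx addrC addKr.
by move=> i /negPf ik; rewrite shift_coord /upd ik subrr normr0.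
Qed.

Lemma lipc_shift (g : E -> R) L k h B' : lipc B L g -> B + `|h| <= B' ->
  lipc B' L (fun x => g (x + h *: e k)).
Proof.
move=> [h1 h2] BB; split.
  move=> x y; apply: le_trans (h1 _ _) _.
  rewrite (_ : dist1 _ _ = dist1 x y)//; apply: eq_bigr => i _.
  by rewrite !mxE opprD addrACA subrr addr0.
move=> x i hx; apply: (h2 _ i); rewrite shift_coord /upd.
have hB : B + `|h| < `|x 0 i| by exact: le_lt_trans hx.
case: eqP => [ik|_].
  have := ler_normB (x 0 k + h) h; rewrite addrK -ik; lra.
by have := normr_ge0 h; lra.
Qed.

(** Translation invariance applies to each component separately, its extension being Lipschitz. The
    support grows by the shift, at most 1, whence the box [B + 1]. *)
Lemma lipc_difquo (h : R) : 0 < h <= 1 -> exists2 L, 0 <= L &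
  lipc (B + 1) L (difquo h) /\ integral_Rn (difquo h) = 0.
Proof.
move=> /andP[h0 h1].
have B0 : 0 < B + 1 by have := R10; have := R12; rewrite /B; lra.
rewrite /difquo; elim: (index_enum _) => [|k s [L L0 [hL iL]]].
  exists 0 => //; rewrite (_ : (fun x => _) = fun=> 0); last first.
    by apply/funext => x; rewrite big_nil.
  have hz : lipc (B + 1) 0 (fun _ : E => 0) by split => // x y; rewrite subrr normr0 mul0r.
  split => //; apply/eqP; rewrite -normr_le0 -[leRHS](mul0r ((2 * (B + 1)) ^+ n.+1)).
  by have [bd _] := integral_lipc B0 n.+1; apply: (bd 0) => // y; rewrite normr0.
have RB : R2 <= B by rewrite /B; lra.
have [M M0 hM] := lipc_ext (aU k) (U_bd k) RB.
have hM' : lipc (B + 1) M (ext (U k)) by apply: lipcW hM => //; lra.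
have hs : lipc (B + 1) M (fun x => ext (U k) (x + h *: e k)).
  by apply: (lipc_shift k hM); rewrite gtr0_norm// lerD2l.
have hd := lipc_comb (-1) hs hM'.
have M2 : 0 <= M + `|-1| * M by rewrite addr_ge0// mulr_ge0.
have [_ [ilin _]] := integral_lipc B0 n.+1.
have id : integral_Rn (fun x => ext (U k) (x + h *: e k) + (-1) * ext (U k) x) = 0.
  by rewrite (ilin M M)// (integral_shift B0 _ M0 hM') mulN1r subrr.
exists (L + `|h^-1| * (M + `|-1| * M)); first by rewrite addr_ge0// mulr_ge0.
rewrite (_ : (fun x => _) = fun x => (\sum_(k <- s) h^-1 * (ext (U k) (x + h *: e k)
   - ext (U k) x)) + h^-1 * (ext (U k) (x + h *: e k) + (-1) * ext (U k) x)); last first.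
  by apply/funext => x; rewrite big_cons addrC mulN1r.
split; first exact: lipc_comb hL hd.
by rewrite (ilin _ _ _ _ _ L0 M2 hL hd) iL id mulr0 addr0.
Qed.

(** Farther than [h] from both spheres, a shift by [h] does not cross them: inside, Taylor's
    estimate and the equation for the divergence give order [h]; outside, everything is 0. Nearer to
    a sphere all terms are merely bounded, and one of the two thin bumps equals 1. *)
Lemma difquo_estimate : exists2 C, 0 <= C & exists2 h0, 0 < h0 <= 1 &
  forall h x, 0 < h <= h0 -> `|ext f x - (difquo h x + c * ext phi x)| <=
    C * h * bump 0 (R2 + 1) x + C * (bump R1 h x + bump R2 h x).
Proof.
have [df df0 [Cf Cf0 hf]] := annulus_bounds af.
have [dp dp0 [Cp Cp0 hp]] := annulus_bounds aphi.
have [d d0 hd] : exists2 d, 0 < d & forall k, exists2 C, 0 <= C & forall p : E, A p ->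
    forall h, `|h| <= d ->
    `|U k (upd (p 0) k (p 0 k + h)) - U k (p 0) - h * pd (U k) (p 0) k| <= C * h ^+ 2.
  apply: finite_radius_mono => [k s s' ss [C C0 h]|k].
    by exists C => // p Ap t ht; apply: h => //; exact: le_trans ss.
  have [d d0 [C C0 h]] := annulus_bounds (aU k).
  by exists d => //; exists C => // p Ap t ht; have [_ h2 _] := h p Ap; exact: h2.
have /choice[CU hCU] : forall k, exists C, 0 <= C /\ forall p : E, A p ->
    forall h, `|h| <= d ->
    `|U k (upd (p 0) k (p 0 k + h)) - U k (p 0) - h * pd (U k) (p 0) k| <= C * h ^+ 2.
  by move=> k; have [C ? ?] := hd k; exists C.
have /choice[LU hLU] : forall k, exists L, 0 <= L /\ lipc R2 L (ext (U k)).
  by move=> k; have [L ? ?] := lipc_ext (aU k) (U_bd k) (lexx R2); exists L.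
pose S1 := \sum_k CU k; pose S2 := \sum_k LU k.
have S10 : 0 <= S1 by apply: sumr_ge0 => k _; have [] := hCU k.
have S20 : 0 <= S2 by apply: sumr_ge0 => k _; have [] := hLU k.
(* The crude bound used near the spheres; the difference quotients are bounded by the Lipschitz
   constants of the extended components, uniformly in [h]. *)
set T := Cf + S2 + `|c| * Cp.
have T0 : 0 <= T by rewrite !addr_ge0// mulr_ge0.
have [C [C0 TC SC]] : exists C, [/\ 0 <= C, T <= C & S1 <= C].
  by exists (S1 + T); rewrite addr_ge0// lerDr lerDl.
exists C => //; exists (Num.min 1 d); first by rewrite lt_min ltr01 d0 ge_min lexx.
move=> h x; rewrite le_min => /andP[h0 /andP[h1 hd']].
have bp r w y : 0 <= bump r w y by case/andP: (clamp01 (2 - `|rad (y 0) - r| / w)).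
have extf_le : `|ext f x| <= Cf.
  rewrite extE; case: ifP => [/andP[a1 a2]|_]; last by rewrite normr0.
  by have [|_ _ h3] := hf x; rewrite // /A !ltW.
have extp_le : `|ext phi x| <= Cp.
  rewrite extE; case: ifP => [/andP[a1 a2]|_]; last by rewrite normr0.
  by have [|_ _ h3] := hp x; rewrite // /A !ltW.
have quo_le : `|difquo h x| <= S2.
  apply: le_trans (ler_norm_sum _ _ _) _; apply: ler_sum => k _.
  have [L0 [hL _]] := hLU k.
  rewrite normrM normfV (gtr0_norm h0) mulrC ler_pdivrMr//.
  by apply: le_trans (hL _ _) _; rewrite dist1_shift gtr0_norm.
have tot_le : `|ext f x - (difquo h x + c * ext phi x)| <= T.
  have a1 := ler_normB (ext f x) (difquo h x + c * ext phi x).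
  have a2 := ler_normD (difquo h x) (c * ext phi x).
  have a3 : `|c * ext phi x| <= `|c| * Cp by rewrite normrM ler_wpM2l.
  by rewrite /T; lra.
have sh0 : 0 <= C * h * bump 0 (R2 + 1) x by rewrite !mulr_ge0// ltW.
have [n1|n1] := leP `|rad (x 0) - R1| h.
  have b1 : bump R1 h x = 1.
    apply: clamp_ge1; rewrite lerBrDr -lerBrDl; have -> : 2 - 1 = 1 :> R by ring.
    by rewrite ler_pdivrMr// mul1r.
  have := bp R2 h x => b2; rewrite b1; apply: le_trans tot_le _.
  by have b3 := mulr_ge0 C0 b2; rewrite mulrDr mulr1; lra.
have [n2|n2] := leP `|rad (x 0) - R2| h.
  have b1 : bump R2 h x = 1.
    apply: clamp_ge1; rewrite lerBrDr -lerBrDl; have -> : 2 - 1 = 1 :> R by ring.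
    by rewrite ler_pdivrMr// mul1r.
  have := bp R1 h x => b2; rewrite b1; apply: le_trans tot_le _.
  by have b3 := mulr_ge0 C0 b2; rewrite mulrDr mulr1; lra.
have sb0 : 0 <= C * (bump R1 h x + bump R2 h x) by rewrite mulr_ge0// addr_ge0.
have nx k : `|rad ((x + h *: e k) 0) - rad (x 0)| <= h.
  by apply: le_trans (rad_lip _ _) _; rewrite dist1_shift gtr0_norm.
have [inA|outA] := boolP (A x); last first.
  have allout k : ext (U k) (x + h *: e k) = 0.
    apply: ext_out; move: outA => /nandP[]; rewrite -ltNge => hx; apply/nandP.
      left; rewrite -ltNge; have := nx k; rewrite ler_norml => /andP[_ ?].
      by move: n1; rewrite ltr0_norm ?subr_lt0//; lra.
    right; rewrite -ltNge; have := nx k; rewrite ler_norml => /andP[? _].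
    by move: n2; rewrite gtr0_norm ?subr_gt0//; lra.
  have -> : difquo h x = 0.
    by rewrite /difquo big1// => k _; rewrite allout ext_out// subrr mulr0.
  by rewrite !ext_out// mulr0 addr0 subrr normr0 addr_ge0.
have /andP[a1 a2] := inA.
have x1 : R1 + h < rad (x 0).
  by move: n1; rewrite ger0_norm ?subr_ge0//; lra.
have x2 : rad (x 0) < R2 - h.
  by move: n2; rewrite ler0_norm ?subr_le0//; lra.
have Ak k : A (x + h *: e k).
  by have := nx k; rewrite ler_norml /A => /andP[? ?]; apply/andP; split; lra.
have fE : ext f x = f (x 0) by rewrite extE ifT//; apply/andP; split; lra.
rewrite fE (ext_closed phi_bd inA).
have -> : f (x 0) = \sum_k pd (U k) (x 0) k + c * phi (x 0) by rewrite divU// subrK.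
have -> : \sum_k pd (U k) (x 0) k + c * phi (x 0) - (difquo h x + c * phi (x 0)) =
   \sum_k (pd (U k) (x 0) k - h^-1 * (ext (U k) (x + h *: e k) - ext (U k) x)).
  by rewrite sumrB /difquo; ring.
apply: (@le_trans _ _ (S1 * h)).
  apply: le_trans (ler_norm_sum _ _ _) _; rewrite mulr_suml; apply: ler_sum => k _.
  rewrite (ext_closed (U_bd k) (Ak k)) (ext_closed (U_bd k) inA) shift_coord.
  have [Ck0 hk] := hCU k.
  have := hk x inA h; rewrite (gtr0_norm h0) => /(_ hd') ht.
  have hn : h != 0 by rewrite gt_eqF.
  set D := pd _ _ _ in ht *; set u := U k _ in ht *; set v := U k _ in ht *.
  have -> : D - h^-1 * (u - v) = - (h^-1 * (u - v - h * D)) by field.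
  rewrite normrN normrM normfV (gtr0_norm h0) mulrC ler_pdivrMr//.
  by rewrite -mulrA -expr2.
have bb : bump 0 (R2 + 1) x = 1.
  apply: clamp_ge1; rewrite lerBrDr -lerBrDl; have -> : 2 - 1 = 1 :> R by ring.
  by rewrite subr0 ger0_norm ?sqrtr_ge0// ler_pdivrMr ?mul1r; have := R10; have := R12; lra.
rewrite bb mulr1; apply: (@le_trans _ _ (C * h)); last by rewrite lerDl.
by rewrite ler_wpM2r ?(ltW h0).
Qed.

(** Integrating the estimate gives [|c| * I <= K * t] for all small [t], where [I] is the positive
    integral of [phi]. The extension of [f] may jump; it is squeezed between the Lipschitz functions
    [w (-1)] and [w 1], whose integrals are known by linearity. *)
Lemma flux_constant : integral_Rn (ext f) = 0 -> c = 0.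
Proof.
move=> If; have [C C0 [h0 /andP[h00 h01] est]] := difquo_estimate.
have R20 : 0 < R2 by exact: lt_trans R12.
(* Large enough for the support of [bump 0 (R2 + 1)], of radius [2 * R2 + 2], and for that of
   [difquo], of radius [R2 + 4]. *)
pose B' := 2 * R2 + 5.
have B'0 : 0 < B' by rewrite /B'; lra.
have R2B : R2 <= B' by rewrite /B'; lra.
have [Lp Lp0 hPhi] := lipc_ext aphi phi_bd R2B.
set I := integral_Rn (ext phi).
have I0 : 0 < I.
  pose r := (R1 + R2) / 2.
  have r0 : 0 < r by have := R10; rewrite /r; lra.
  have rE : rad ((r *: e ord0) 0) = r.
    rewrite /rad /nsq (bigD1 ord0)//= big1 ?addr0.
      by rewrite !mxE eqxx mulr1 sqrtr_sqr gtr0_norm.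
    by move=> i /negPf i0; rewrite !mxE i0 andbF mulr0 expr0n.
  have rin : R1 < rad ((r *: e ord0) 0) < R2 by rewrite rE /r; apply/andP; split; have := R12; lra.
  apply: (integral_gt0 (x := r *: e ord0) B'0 Lp0 hPhi).
    by move=> x; rewrite extE; case: ifP => // /phi_gt0/ltW.
  by rewrite extE rin phi_gt0.
have h2 : 0 + 2 * (R2 + 1) <= B' by rewrite /B'; lra.
have R21 : 0 < R2 + 1 by lra.
have hb0 := lipc_bump R21 h2; set I0b := integral_Rn (bump 0 (R2 + 1)).
pose P := (2 * B') ^+ n.
have P0 : 0 <= P by rewrite exprn_ge0// mulr_ge0// ltW.
pose K := C * I0b + C * (2 * Num.sqrt (8 * R1) * P + 2 * Num.sqrt (8 * R2) * P).
have I0b0 : 0 <= I0b.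
  apply/ltW/(integral_gt0 (x := 0) B'0 _ hb0); first by rewrite invr_ge0 ltW.
    by move=> x; case/andP: (clamp01 (2 - `|rad (x 0) - 0| / (R2 + 1))).
  rewrite /bump (_ : rad _ = 0) ?subrr ?normr0 ?mul0r ?subr0 ?clamp_ge1 ?ler1n//.
  by rewrite /rad /nsq big1 ?sqrtr0// => i _; rewrite mxE expr0n.
have K0 : 0 <= K by rewrite !(addr_ge0, mulr_ge0)// sqrtr_ge0.
(* The bound [R1 / 2] ensures [2 * h <= R1], as [integral_bump] requires. *)
pose t0 := Num.min h0 (R1 / 2).
have t00 : 0 < t0 by rewrite lt_min h00 divr_gt0.
have main t : 0 < t <= t0 -> `|c| * I <= K * t.
  rewrite le_min => /andP[tp /andP[th tR]].
  have t1 : t <= 1 by exact: le_trans h01.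
  (* The shells contribute the order of the square root of [h], which becomes linear in [t]. *)
  pose h := t ^+ 2.
  have hp : 0 < h by rewrite exprn_gt0.
  have ht : h <= t by rewrite /h expr2 ler_piMl// ltW.
  have hle : 0 < h <= h0 by rewrite hp (le_trans ht).
  have [|Ld Ld0 [hD ID]] := @lipc_difquo h.
    by rewrite hp (le_trans ht).
  have hD' : lipc B' Ld (difquo h).
    by apply: lipcW hD => //; rewrite /B /B'; lra.
  have r1 : R1 + 2 * h <= B' by rewrite /B'; have := R12; lra.
  have r2 : R2 + 2 * h <= B' by rewrite /B'; lra.
  have hb1 := lipc_bump hp r1; have hb2 := lipc_bump hp r2.
  have hi0 : 0 <= h^-1 by rewrite invr_ge0 ltW.
  have Ri0 : 0 <= (R2 + 1)^-1 by rewrite invr_ge0 ltW.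
  have [_ [ilin _]] := integral_lipc B'0 n.+1.
  set I1 := integral_Rn (bump R1 h); set I2 := integral_Rn (bump R2 h).
  pose w s (x : E) := difquo h x + c * ext phi x + (s * C * h) * bump 0 (R2 + 1) x
     + (s * C) * bump R1 h x + (s * C) * bump R2 h x.
  have hw s : exists2 L, 0 <= L & lipc B' L (w s) /\
      integral_Rn (w s) = c * I + s * (C * h * I0b + C * (I1 + I2)).
    have l1 := lipc_comb c hD' hPhi.
    have l2 := lipc_comb (s * C * h) l1 hb0.
    have l3 := lipc_comb (s * C) l2 hb1.
    have l4 := lipc_comb (s * C) l3 hb2.
    have p1 : 0 <= Ld + `|c| * Lp by rewrite addr_ge0// mulr_ge0.
    have p2 : 0 <= Ld + `|c| * Lp + `|s * C * h| * (R2 + 1)^-1.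
      by rewrite addr_ge0// mulr_ge0.
    have p3 := addr_ge0 p2 (mulr_ge0 (normr_ge0 (s * C)) hi0).
    have p4 := addr_ge0 p3 (mulr_ge0 (normr_ge0 (s * C)) hi0).
    eexists; [exact: p4|split; first exact: l4].
    rewrite /w (ilin _ _ _ _ _ p3 hi0 l3 hb2) (ilin _ _ _ _ _ p2 hi0 l2 hb1).
    rewrite (ilin _ _ _ _ _ p1 Ri0 l1 hb0) (ilin _ _ _ _ _ Ld0 Lp0 hD' hPhi) ID.
    by rewrite -/I -/I0b -/I1 -/I2; ring.
  have [L1 L10 [hl il]] := hw (-1); have [L2 L20 [hu iu]] := hw 1.
  have sq x : w (-1) x <= ext f x <= w 1 x.
    have := est h x hle; rewrite ler_norml /w => /andP[e1 e2].
    by apply/andP; split; lra.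
  have := integral_squeeze B'0 L10 L20 hl hu sq; rewrite If il iu => /andP[q1 q2].
  have b r : 0 < r -> 2 * h <= r -> r + 2 * h <= B' ->
      integral_Rn (bump r h) <= 2 * Num.sqrt (8 * r) * P * t.
    move=> r0 hr hB; apply: le_trans (integral_bump hp hr hB B'0) _.
    rewrite sqrtrM ?mulr_ge0 ?(ltW r0)// sqrtr_sqr (gtr0_norm tp) -/P.
    by rewrite (_ : 2 * _ * P = 2 * Num.sqrt (8 * r) * P * t)//; ring.
  have b1 : I1 <= 2 * Num.sqrt (8 * R1) * P * t by apply: b => //; have := R10; lra.
  have b2 : I2 <= 2 * Num.sqrt (8 * R2) * P * t by apply: b => //; have := R12; lra.
  have b3 : C * (I1 + I2) <= C * (2 * Num.sqrt (8 * R1) * P + 2 * Num.sqrt (8 * R2) * P) * t.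
    by rewrite -mulrA ler_wpM2l// mulrDl lerD.
  have b4 : C * h * I0b <= C * I0b * t by rewrite mulrAC ler_wpM2l// mulr_ge0.
  have -> : `|c| * I = `|c * I| by rewrite normrM (gtr0_norm I0).
  by rewrite /K mulrDl ler_norml; apply/andP; split; lra.
apply/eqP; rewrite -normr_le0 -(pmulr_lle0 _ I0) leNgt; apply/negP => a0.
set a := `|c| * I in main a0.
have K1 : 0 < 2 * (K + 1) by lra.
(* For this [t] one would have [2 * (K + 1) * t <= a <= K * t], impossible for [0 < t] and
   [0 <= K]. *)
pose t := Num.min t0 (a / (2 * (K + 1))).
have tp : 0 < t by rewrite lt_min t00 divr_gt0.
have := main t; rewrite tp ge_min lexx => /(_ isT).
have : (2 * (K + 1)) * t <= a.
  by rewrite -ler_pdivlMl// mulrC ge_min lexx orbT.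
have := mulr_ge0 K0 (ltW tp); lra.
Qed.

End Flux.
End Annulus.
End Vanishing.

(** * Passage to row vectors, and conclusion *)

Section RowVectors.
Context {R : realType}.

(** The two derivatives are limits of literally the same difference quotient. *)
Lemma derive_row_pd n (g : ('I_n -> R) -> R) (x : 'rV[R]_n) k :
  derive (fun y : 'rV[R]_n => g (y 0)) x (delta_mx 0 k) = pd g (x 0) k.
Proof.
rewrite /pd /derive; set F := (F in lim (F @ _)); set G := (G in _ = lim (G @ _)).
suff -> : F = G by [].
apply/funext => h; rewrite /F /G /=.
have -> : (h *: delta_mx 0 k + x) 0 = upd (x 0) k (h *: 1 + x 0 k).
  apply/funext => i; rewrite !mxE /upd eqxx/=; case: eqP => [->|_] //.
  by rewrite mulr0 add0r.
by rewrite updE.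
Qed.

Lemma open_annulus_ball n (R1 R2 : R) (a : 'rV[R]_n) : open_annulus R1 R2 a ->
  exists2 r, 0 < r & forall x, enorm (x - a) < r -> open_annulus R1 R2 x.
Proof.
move=> /andP[a1 a2]; pose m := Num.min (enorm a - R1) (R2 - enorm a).
have m0 : 0 < m by rewrite lt_min !subr_gt0 a1.
exists (m / n.+1%:R); first by rewrite divr_gt0.
move=> x hx; have hd : dist1 x a < m.
  apply: (@le_lt_trans _ _ (\sum_(i < n) enorm (x - a))).
    by apply: ler_sum => i _; have := coord_enorm (x - a) i; rewrite !mxE.
  rewrite sumr_const card_ord -mulr_natl.
  apply: (@le_lt_trans _ _ (n.+1%:R * enorm (x - a))).
    by rewrite ler_wpM2r ?sqrtr_ge0// ler_nat.
  by rewrite -ltr_pdivlMl// mulrC.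
have nE (y : 'rV[R]_n) : rad (y 0) = enorm y by [].
have := rad_lip x a; rewrite !nE ler_norml.
move: hd; rewrite lt_min => /andP[h1 h2] /andP[l1 l2].
by rewrite /open_annulus/=; apply/andP; split; lra.
Qed.

End RowVectors.

Theorem theorem1p1 (R : realType) (n : nat) (R1 R2 : R) (f : 'rV[R]_n -> R) :
  (2 <= n)%N -> 0 < R1 -> R1 < R2 ->
  real_analytic_on_closed_annulus R1 R2 f ->
  integral_Rn (fun x : 'rV[R]_n => if `[< open_annulus R1 R2 x >] then f x else 0) = 0 ->
  exists U : 'rV[R]_n -> 'rV[R]_n,
    exists delta : R, 0 < delta < 1 /\
    (forall i : 'I_n,
       real_analytic_on (open_annulus (R1 * (1 - delta)) (R2 * (1 + delta)))
         (fun y => U y 0 i)) /\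
    (forall x, closed_annulus R1 R2 x -> divergence U x = f x) /\
    (forall x, enorm x = R1 \/ enorm x = R2 -> U x = 0).
Proof.
case: n f => [//|n] f n2 R10 R12 [de [de01 [ft [aft ftE]]]] If.
pose g (y : 'I_n.+1 -> R) := ft (\row_i y i).
have rE (y : 'I_n.+1 -> R) : rad y = enorm (\row_i y i).
  by rewrite /rad enorm_nsq; congr (Num.sqrt (nsq _)); apply/funext => i; rewrite mxE.
have rowE (y : 'I_n.+1 -> R) : (\row_i y i) 0 = y by apply/funext => i; rewrite mxE.
have ag y : R1 * (1 - de) < rad y < R2 * (1 + de) -> analytic_at y g.
  by rewrite rE => hy; rewrite -[y]rowE; exact: real_analytic_germ aft hy.
have sub (y : 'I_n.+1 -> R) : R1 <= rad y <= R2 -> R1 * (1 - de) < rad y < R2 * (1 + de).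
  move=> /andP[y1 y2]; case/andP: de01 => d0 d1; apply/andP; split.
    by apply: lt_le_trans y1; rewrite gtr_pMr//; lra.
  by apply: le_lt_trans y2 _; rewrite ltr_pMr ?(lt_trans R10)//; lra.
have [c [U [aU divU U0]]] := divergence_modulo_cutoff n2 R10 R12 de01 ag.
have sq (x : 'I_n.+1 -> R) : nsq x = rad x ^+ 2 by rewrite rad_sq.
have c0 : c = 0.
  apply: (@flux_constant _ _ _ _ R10 R12 U g (cutoff R1 R2) c) => //.
  - by move=> k x hx; apply: aU; exact: sub.
  - by move=> x hx; apply: ag; exact: sub.
  - by move=> x _; exact: analytic_cutoff.
  - by move=> x [] h; rewrite /cutoff sq h subrr ?mul0r ?mulr0.
  - move=> x /andP[h1 h2]; rewrite /cutoff mulr_gt0 ?invr_gt0 ?wtZ_gt0// sq.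
    have r0 : 0 <= rad x by exact: sqrtr_ge0.
    by rewrite mulr_gt0// subr_gt0 ltrXn2r// ?nnegrE ltW// (lt_trans R10).
  - by move=> x hx; apply: divU; exact: sub.
  - rewrite -[RHS]If; congr integral_Rn; apply/funext => x; rewrite /ext.
    case: asboolP => // /andP[h1 h2].
    by rewrite /g rowK ftE//; rewrite /closed_annulus/= !ltW.
(* The field is analytic on the same larger annulus as the extension [ft], hence the same [de]. *)
exists (fun y => \row_i U i (y 0)), de; split => //; split; [|split].
- move=> i; apply: germ_real_analytic; first exact: open_annulus_ball.
  move=> a ha; rewrite (_ : (fun y => _) = U i); first exact: aU.
  by apply/funext => y; rewrite mxE rowE.
- move=> x hx; have := divU (x 0) (sub _ hx); rewrite c0 mul0r subr0 /g rowK ftE// => <-.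
  rewrite /divergence; apply: eq_bigr => k _; rewrite -derive_row_pd.
  by congr derive; apply/funext => y; rewrite mxE.
- by move=> x hx; apply/rowP => i; rewrite !mxE U0.
Qed.
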